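(* Let $\pi$ be a probability density on $\mathbb{R}^d$ with compact support $\mathbb{X}\subset\mathbb{R}^d$, such that $\pi$ is continuous, bounded and bounded away from zero on $\mathbb{X}$. Assume that $\mathbb{X}$ has a uniformly continuous normal (i.e. the one-element collection $\{\mathbb{X}\}$ has uniformly continuous normals) and that $\alpha^*\in(0,\frac12)$. Let $(X_n)_{n\ge1}$ be generated by either the ASM algorithm or the ASWAM algorithm (defined in the context) with target $\pi$ and desired acceptance rate $\alpha^*$. Then for any bounded (measurable) function $f$, $$\frac1n\sum_{k=1}^n f(X_k)\xrightarrow{n\to\infty}\int_{\mathbb{R}^d} f(x)\pi(x)\,dx\qquad\text{almost surely.}$$
   Context: Uniformly continuous normals. A $C^1$ domain in $\mathbb{R}^d$ is a domain whose boundary is locally a graph of a continuously differentiable function. Let $\{A_i\}_{i\in I}$ be a collection of sets $A_i\subset\mathbb{R}^d$, each consisting of finitely many disjoint components that are closures of $C^1$ domains, and let $n_i(x)$ be the outer-pointing (unit) normal at $x\in\partial A_i$. The collection has uniformly continuous normals if for all $\epsilon>0$ there is $\delta>0$ such that for any $i\in I$, $\|n_i(x)-n_i(y)\|\le\epsilon$ for all $x,y\in\partial A_i$ with $\|x-y\|\le\delta$. Scaling function assumption. $\phi:\mathbb{R}\to(0,\infty)$ is increasing and surjective, piecewise differentiable, and there are constants $h,c>0$ and $\kappa\ge1$ such that $\phi'(s+\bar h)\le c\max\{1,\phi^\kappa(s)\}$ for all $s\in\mathbb{R}$ and all $0\le\bar h\le h$. Proposal assumption. The probability density $q$ on $\mathbb{R}^d$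 can be written $q(z)=\hat q(\|z\|)$ where $\hat q:[0,\infty)\to(0,\infty)$ is bounded, decreasing and differentiable. Moreover, for any $\xi\in(0,1)$ there exist $\epsilon^*>0$, constants $0\le a<b<\infty$ and $c_1,c_2,c_3>0$ such that for all $\epsilon\in[0,\epsilon^*]$: $\xi\hat q'(x)-\hat q'(x+\epsilon)\ge c_1$ for all $a\le x\le b$, and $\int_0^\infty\min\{0,\xi\hat q'(x)-\hat q'(x+\epsilon)\}\,dx\ge -c_2e^{-c_3\epsilon^{-1}}$ (with right-hand side read as $0$ when $\epsilon=0$). Step size assumption. $(\eta_n)_{n\ge2}$ is non-negative, $\sum_{n\ge 2}\eta_n=\infty$ and $\sum_{n\ge 2}\eta_n^2<\infty$. ASM algorithm. Let $\Sigma\in\mathbb{R}^{d\times d}$ be symmetric positive definite and let $\phi$, $q$, $(\eta_n)$ satisfy the three assumptions above. Let $W_n\sim q$ be independent and $U_n$ be independent and uniformly distributed on $[0,1]$ (all mutually independent). Let $X_1\equiv x_1\in\mathbb{R}^d$ with $\pi(x_1)>0$, $S_1\equiv s_1\in\mathbb{R}$, and for $n\ge2$ recursively $Y_n=X_{n-1}+\phi(S_{n-1})\Sigma^{1/2}W_n$; $\alpha_n=\min\{1,\pi(Y_n)/\pi(X_{n-1})\}$; $X_n=Y_n$ if $U_n\le\alpha_n$ and $X_n=X_{n-1}$ otherwise; $S_n=S_{n-1}+\eta_n(\alpha_n-\alpha^* )$. ASWAM algorithm. As ASM, but with $Y_n=X_{n-1}+\phi(S_{n-1})\Sigma_{n-1}^{1/2}W_n$,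 where $\mu_1\equiv x_1$, $\Sigma_1$ is a symmetric positive definite matrix, and for $n\ge 2$ $\hat\mu_n=(1-\eta_n)\mu_{n-1}+\eta_nX_n$, $\hat\Sigma_n=(1-\eta_n)\Sigma_{n-1}+\eta_n(X_n-\mu_{n-1})(X_n-\mu_{n-1})^T$, and $(\mu_n,\Sigma_n)=(\hat\mu_n,\hat\Sigma_n)$ if $(\hat\mu_n,\hat\Sigma_n)\in\mathbb{S}_\zeta$ and $(\mu_n,\Sigma_n)=(\mu_{n-1},\Sigma_{n-1})$ otherwise. Here $\zeta\in[1,\infty)$ is a constant and $\mathbb{S}_\zeta=\{(\mu,\Sigma):\Sigma\text{ symmetric},\ \|\mu\|\le\zeta,\ \lambda(\Sigma)\subset[\zeta^{-1},\zeta]\}$ with $\lambda(\Sigma)$ the set of eigenvalues of $\Sigma$; the process is assumed to start in this set, $(\mu_1,\Sigma_1)\in\mathbb{S}_\zeta$. *)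

(* Defs.v *)
From HB Require Import structures.
From mathcomp Require Import all_boot all_order all_algebra.
From mathcomp Require Import all_classical all_reals all_analysis.

Set Implicit Arguments.
Unset Strict Implicit.
Unset Printing Implicit Defensive.

Import Order.TTheory GRing.Theory Num.Theory.
Import numFieldNormedType.Exports.

Local Open Scope classical_set_scope.
Local Open Scope ring_scope.

(* Matrices over R carry the sigma-algebra generated by the entries, which is
   the Borel sigma-algebra of the library's topology on 'M[R]_(m, n). *)
Definition matrix_display : measure_display. Proof. exact: default_measure_display. Qed.

Section measurable_matrix.
Context {R : realType} (m n : nat).

Definition mx_measurable : set (set 'M[R]_(m, n)) :=
  <<s \bigcup_(ij : 'I_m * 'I_n)
        preimage_set_system setT (fun A : 'M[R]_(m, n) => A ij.1 ij.2)
          measurable >>.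

Let mx_measurable0 : mx_measurable set0.
Proof. exact: sigma_algebra0. Qed.

Let mx_measurableC A : mx_measurable A -> mx_measurable (~` A).
Proof. exact: sigma_algebraC. Qed.

Let mx_measurable_bigcup (F : (set 'M[R]_(m, n))^nat) :
  (forall i, mx_measurable (F i)) -> mx_measurable (\bigcup_i F i).
Proof. exact: sigma_algebra_bigcup. Qed.

HB.instance Definition _ := @isMeasurable.Build matrix_display
  'M[R]_(m, n) mx_measurable mx_measurable0 mx_measurableC
  mx_measurable_bigcup.

End measurable_matrix.

Section measurable_matrix_theory.
Context {R : realType} (m n : nat).

Lemma measurable_entry i j :
  measurable_fun setT (fun A : 'M[R]_(m, n) => A i j).
Proof.
move=> _ B mB; apply: sub_sigma_algebra; exists (i, j) => //.
by exists B.
Qed.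

Lemma measurable_fun_mx d (T : measurableType d) (f : T -> 'M[R]_(m, n)) :
  (forall i j, measurable_fun setT (fun t => f t i j)) -> measurable_fun setT f.
Proof.
move=> mf.
apply: (@measurability _ _ _ _ _ f
  (\bigcup_(ij : 'I_m * 'I_n) preimage_set_system setT
     (fun A : 'M[R]_(m, n) => A ij.1 ij.2) measurable)) => //.
move=> _ [_ [[i j] _ [B mB <-]] <-].
rewrite setTI; have := mf i j measurableT B mB.
by rewrite !setTI.
Qed.

End measurable_matrix_theory.

Section lebesgue_cons.
Context {R : realType} (d : nat).
Variable mu : {sigma_finite_measure set 'cV[R]_d -> \bar R}.

Definition cV_cons (p : measurableTypeR R * 'cV[R]_d) : 'cV[R]_d.+1 :=
  col_mx (p.1)%:M p.2.

Lemma measurable_cV_cons : measurable_fun setT cV_cons.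
Proof.
apply: measurable_fun_mx => i j.
rewrite [j]ord1 {j} /cV_cons.
case: (split_ordP (i : 'I_(1 + d))) => k ->.
  rewrite [X in measurable_fun _ X](_ : _ = fst); first exact: measurable_fst.
  apply/funext => p; rewrite [LHS](@col_mxEu _ 1 d) ord1 mxE eqxx.
  exact: mulr1n.
rewrite [X in measurable_fun _ X](_ : _ = (fun v : 'cV[R]_d => v k 0) \o snd).
  by apply: measurableT_comp; [exact: measurable_entry|exact: measurable_snd].
by apply/funext => p; rewrite [LHS](@col_mxEd _ 1 d).
Qed.

Definition lebesgue_cons : set 'cV[R]_d.+1 -> \bar R :=
  pushforward (lebesgue_measure \x mu)%E cV_cons.

Let lebesgue_cons0 : lebesgue_cons set0 = 0%E.
Proof. by rewrite /lebesgue_cons /pushforward preimage_set0 measure0. Qed.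

Let lebesgue_cons_ge0 A : (0 <= lebesgue_cons A)%E.
Proof. by rewrite /lebesgue_cons /pushforward; exact: measure_ge0. Qed.

Let lebesgue_cons_sigma_additive : semi_sigma_additive lebesgue_cons.
Proof.
exact: (measure_semi_sigma_additive
  (s := measure_function_pushforward__canonical__measure_function_Measure
          (lebesgue_measure \x mu)%E measurable_cV_cons)).
Qed.

HB.instance Definition _ := isMeasure.Build _ _ _ lebesgue_cons
  lebesgue_cons0 lebesgue_cons_ge0 lebesgue_cons_sigma_additive.

Definition cV_uncons (v : 'cV[R]_d.+1) : measurableTypeR R * 'cV[R]_d :=
  (v 0 0, dsubmx (v : 'cV[R]_(1 + d))).

Lemma measurable_cV_uncons : measurable_fun setT cV_uncons.
Proof.
apply: measurable_fun_pair => /=; first exact: measurable_entry.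
apply: measurable_fun_mx => i j.
rewrite [X in measurable_fun _ X](_ : _ =
  (fun v : 'cV[R]_d.+1 => v (rshift 1 i) j)); first exact: measurable_entry.
by apply/funext => v; rewrite mxE.
Qed.

Lemma cV_consK : cancel cV_cons cV_uncons.
Proof.
move=> [x v]; congr pair; last exact: (@col_mxKd _ 1 d).
have -> : (0 : 'I_d.+1) = lshift d (0 : 'I_1) by apply/val_inj.
by rewrite [LHS](@col_mxEu _ 1 d) mxE eqxx mulr1n.
Qed.

Let lebesgue_cons_sigma_finite : sigma_finite setT lebesgue_cons.
Proof.
have /sigma_finiteP[F [TF ndF Foo]] := sigma_finiteT (@lebesgue_measure R).
have /sigma_finiteP[G [TG ndG Goo]] := sigma_finiteT mu.
exists (fun n => cV_uncons @^-1` (F n `*` G n)).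
  rewrite -preimage_bigcup (_ : \bigcup_k _ = setT) ?preimage_setT//.
  rewrite -setXTT TF TG predeqE => -[x y]; split.
    by move=> [n _ []/= ? ?]; split; exists n.
  move=> [/= [n _ Fnx] [k _ Gky]]; exists (maxn n k) => //; split.
  - by move: x Fnx; exact/subsetPset/ndF/leq_maxl.
  - by move: y Gky; exact/subsetPset/ndG/leq_maxr.
move=> n; have [mF Fn] := Foo n; have [mG Gn] := Goo n; split.
  rewrite -[X in measurable X]setTI; apply: measurable_cV_uncons => //.
  exact: measurableX.
rewrite /lebesgue_cons /pushforward -comp_preimage.
rewrite (_ : cV_uncons \o cV_cons = id); last exact/funext/cV_consK.
by rewrite preimage_id product_measure1E// lte_mul_pinfty// ge0_fin_numE.
Qed.

HB.instance Definition _ := Measure_isSigmaFinite.Build _ _ _ lebesgue_cons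
  lebesgue_cons_sigma_finite.

End lebesgue_cons.

Fixpoint lebesgue_cV {R : realType} (d : nat) :
    {sigma_finite_measure set 'cV[R]_d -> \bar R} :=
  match d with
  | 0%N => \d_(0 : 'cV[R]_0)
  | d'.+1 => lebesgue_cons (lebesgue_cV d')
  end.

Lemma measurable_box {R : realType} d (A : 'I_d -> set R) :
  (forall i, measurable (A i)) ->
  measurable [set v : 'cV[R]_d | forall i, A i (v i 0)].
Proof.
move=> mA; rewrite (_ : mkset _ =
    \bigcap_(i in setT) ((fun v : 'cV[R]_d => v i 0) @^-1` A i)).
  apply: fin_bigcap_measurable => [|i _]; first exact: finite_finset.
  by rewrite -[X in measurable X]setTI; exact: (@measurable_entry R d 1 i 0 measurableT (A i) (mA i)).
by apply/seteqP; split=> v /= vA i => [_|]; exact: vA.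
Qed.

Lemma lebesgue_cV_box {R : realType} d (A : 'I_d -> set R) :
  (forall i, measurable (A i)) ->
  lebesgue_cV d [set v | forall i, A i (v i 0)] =
  (\prod_(i < d) lebesgue_measure (A i))%E.
Proof.
elim: d A => [|d IH] A mA.
  by rewrite big_ord0 /= diracE mem_set// => -[].
have mA' i : measurable (A (lift ord0 i)) by exact: mA.
rewrite big_ord_recl -IH//=.
rewrite -[RHS](@product_measure1E _ _ _ _ _ lebesgue_measure (lebesgue_cV d));
  [|exact: mA|exact: (measurable_box mA')].
rewrite /lebesgue_cons /pushforward; congr (_ _).
have cons0 (p : measurableTypeR R * 'cV[R]_d) : cV_cons p 0 0 = p.1.
  by rewrite -[in RHS](cV_consK p).
have consS (p : measurableTypeR R * 'cV[R]_d) i :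
    cV_cons p (lift ord0 i) 0 = p.2 i 0.
  have -> : lift ord0 i = rshift 1 i by exact/val_inj.
  exact: (@col_mxEd _ 1 d).
apply/seteqP; split=> p /=.
  by move=> Ap; split=> [|i]; rewrite -?cons0 -?consS.
move=> [Ap1 Ap2] i; case: (unliftP ord0 i) => [j|] ->.
  by rewrite consS.
by rewrite cons0.
Qed.

Section vectors.
Context {R : realType} {d : nat}.
Implicit Types (u v : 'cV[R]_d) (M : 'M[R]_d).

Definition dot u v : R := \sum_i u i 0 * v i 0.

(* The library's norm `|v| on 'cV[R]_d is the sup norm. *)
Definition enorm v : R := Num.sqrt (\sum_i v i 0 ^+ 2).

Definition sym_posdef M : Prop :=
  M^T = M /\ forall v, v != 0 -> 0 < (v^T *m M *m v) 0 0.

(* The unique symmetric positive definite square root of a symmetric positive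
   definite matrix; junk value 0 if M has no such root. *)
Definition sqrtmx M : 'M[R]_d :=
  xget 0 [set L | sym_posdef L /\ L *m L = M].

End vectors.

Section c1_domains.
Context {R : realType} {d : nat}.
Implicit Types (A D : set 'cV[R]_d) (g : 'cV[R]_d -> R) (x v n : 'cV[R]_d).

Definition boundary (T : topologicalType) (A : set T) : set T :=
  closure A `\` A°.

Definition c1_function g : Prop :=
  (forall x, differentiable g x) /\ (forall v, continuous ('D_v g)).

Definition gradient g x : 'cV[R]_d := \col_i 'D_(delta_mx i 0) g x.

(* For a unit vector v, the graph over the hyperplane orthogonal to v of the
   restriction of g to that hyperplane is the zero set of [height v g]. *)
Definition height v g (y : 'cV[R]_d) : R := dot v y - g (y - dot v y *: v).

(* Near x the boundary of A is a C^1 graph, with the interior of A lying on one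
   side of it; v points out of A. *)
Definition c1_graph_at A x v g : Prop :=
  [/\ enorm v = 1, c1_function g &
      \forall y \near x, (A° y <-> height v g y < 0) /\
                         (boundary A y <-> height v g y = 0)].

Definition c1_domain D : Prop :=
  [/\ open D, connected D, D !=set0 &
      forall x, boundary D x -> exists v g, c1_graph_at D x v g].

(* In orthonormal coordinates (y', y_d) with last axis v, the vector below is
   (- grad g, 1) / sqrt (1 + |grad g|^2) evaluated at the foot of x. *)
Definition outer_normal A x n : Prop :=
  exists v g, c1_graph_at A x v g /\
    n = (enorm (gradient (height v g) x))^-1 *: gradient (height v g) x.

Definition finite_union_of_c1_closures A : Prop :=
  exists (N : nat) (D : 'I_N -> set 'cV[R]_d),
    [/\ forall i, c1_domain (D i),
        trivIset setT (fun i => closure (D i)) &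
        A = \bigcup_i closure (D i)].

Definition uniformly_continuous_normals (I : Type) (A : I -> set 'cV[R]_d) :
    Prop :=
  (forall i, finite_union_of_c1_closures (A i)) /\
  exists n : I -> 'cV[R]_d -> 'cV[R]_d,
    (forall i x, boundary (A i) x -> outer_normal (A i) x (n i x)) /\
    forall eps, 0 < eps -> exists2 delta, 0 < delta &
      forall i x y, boundary (A i) x -> boundary (A i) y ->
        enorm (x - y) <= delta -> enorm (n i x - n i y) <= eps.

End c1_domains.

Section densities.
Context {R : realType} {d : nat}.

Definition density (p : 'cV[R]_d -> R) : Prop :=
  [/\ measurable_fun setT p, forall x, 0 <= p x &
      (\int[lebesgue_cV d]_x (p x)%:E = 1)%E].

Definition dsupport (p : 'cV[R]_d -> R) : set 'cV[R]_d :=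
  closure [set x | p x != 0].

End densities.

Section assumptions.
Context {R : realType}.

(* Monotonicity is not required to be strict, here and for [qhat] below. The
   function may fail to be differentiable on a locally finite set. *)
Definition scaling_function (phi : R -> R) : Prop :=
  [/\ {homo phi : s t / s <= t},
      (forall s, 0 < phi s) /\ (forall y, 0 < y -> exists s, phi s = y),
      exists B : set R, (forall a b, finite_set (B `&` `[a, b])) /\
        (forall s, ~ B s -> derivable phi s 1) &
      exists h c kappa : R, [/\ 0 < h, 0 < c, 1 <= kappa &
        forall s h', 0 <= h' <= h -> derivable phi (s + h') 1 ->
          derive1 phi (s + h') <= c * Num.max 1 (phi s `^ kappa)]].

(* f' is the derivative of f as a function on A (one-sided at end points). *)
Definition has_derivative_on (A : set R) (f f' : R -> R) : Prop :=
  forall x, A x ->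
    (fun y => (f y - f x) / (y - x)) @ within A x^' --> f' x.

(* As 0^-1 = 0 in R, the bound for eps = 0 has to be given separately. *)
Definition proposal_density (d : nat) (q : 'cV[R]_d -> R) : Prop :=
  density q /\
  exists qhat dqhat : R -> R,
    [/\ forall z, q z = qhat (enorm z),
        forall x, 0 <= x -> 0 < qhat x,
        exists M, forall x, 0 <= x -> qhat x <= M,
        forall x y, 0 <= x -> x <= y -> qhat y <= qhat x &
        has_derivative_on `[0, +oo[ qhat dqhat] /\
    forall xi : R, 0 < xi < 1 ->
      exists eps' a b c1 c2 c3 : R,
        [/\ 0 < eps', 0 <= a < b & [/\ 0 < c1, 0 < c2 & 0 < c3]] /\
        forall eps, 0 <= eps <= eps' ->
          (forall x, a <= x <= b -> c1 <= xi * dqhat x - dqhat (x + eps)) /\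
          ((if eps == 0 then 0 else - c2 * expR (- c3 * eps^-1))%:E <=
           \int[lebesgue_measure]_(x in `[0%R, +oo[)
             (Num.min 0 (xi * dqhat x - dqhat (x + eps)))%:E)%E.

Definition step_sizes (eta : nat -> R) : Prop :=
  [/\ forall n, (2 <= n)%N -> 0 <= eta n,
      (\sum_(2 <= n <oo) (eta n)%:E = +oo)%E &
      (\sum_(2 <= n <oo) (eta n ^+ 2)%:E < +oo)%E].

End assumptions.

Section randomness.
Context {R : realType} {dO : measure_display} {Omega : measurableType dO}.
Variable P : probability Omega R.

Definition mutual_independence (I : eqType) (F : I -> set (set Omega)) : Prop :=
  forall (J : seq I) (E : I -> set Omega), uniq J ->
    (forall i, i \in J -> F i (E i)) ->
    P (\big[setI/setT]_(i <- J) E i) = (\prod_(i <- J) P (E i))%E.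

(* Only the variables with index n >= 2 are constrained. *)
Definition driving_noise (d : nat) (q : 'cV[R]_d -> R)
    (W : nat -> {RV P >-> 'cV[R]_d}) (U : nat -> {RV P >-> R}) : Prop :=
  [/\ forall n A, (2 <= n)%N -> measurable A ->
        P (W n @^-1` A) = (\int[lebesgue_cV d]_(z in A) (q z)%:E)%E,
      forall n A, (2 <= n)%N -> measurable A ->
        P (U n @^-1` A) = uniform_prob (@ltr01 R) A &
      mutual_independence (fun k : nat + nat =>
        match k with
        | inl n => preimage_set_system setT (W n.+2) measurable
        | inr n => preimage_set_system setT (U n.+2) measurable
        end)].

End randomness.

Section algorithms.
Context {R : realType} {d : nat} {Omega : Type}.
Variables (target : 'cV[R]_d -> R) (phi : R -> R) (eta : nat -> R).
Variable alpha_star : R.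
Variables (W : nat -> Omega -> 'cV[R]_d) (U : nat -> Omega -> R).
Implicit Types (X : nat -> Omega -> 'cV[R]_d) (S : nat -> Omega -> R).

(* Here and below, processes start at index 1; their value at 0 is junk.
   [C n] is the matrix shaping the proposal made from X_n. *)
Definition adaptive_scaling (C : nat -> Omega -> 'M[R]_d)
    (x1 : 'cV[R]_d) (s1 : R) X S : Prop :=
  [/\ 0 < target x1,
      forall w, X 1%N w = x1 /\ S 1%N w = s1 &
      forall n w, (2 <= n)%N ->
        let x := X n.-1 w in
        let y := x + phi (S n.-1 w) *: (C n.-1 w *m W n w) in
        let alpha := Num.min 1 (target y / target x) in
        X n w = (if U n w <= alpha then y else x) /\
        S n w = S n.-1 w + eta n * (alpha - alpha_star)].

Definition asm X : Prop :=
  exists (Sigma : 'M[R]_d) (x1 : 'cV[R]_d) (s1 : R) S,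
    sym_posdef Sigma /\
    adaptive_scaling (fun _ _ => sqrtmx Sigma) x1 s1 X S.

(* [eigenvalue] refers to row eigenvectors, which is immaterial as M is
   symmetric. *)
Definition mean_cov_set (zeta : R) (m : 'cV[R]_d) (M : 'M[R]_d) : Prop :=
  [/\ M^T = M, enorm m <= zeta &
      forall l, eigenvalue M l -> zeta^-1 <= l <= zeta].

Definition aswam X : Prop :=
  exists (zeta : R) (Sigma1 : 'M[R]_d) (x1 : 'cV[R]_d) (s1 : R) S
      (mu : nat -> Omega -> 'cV[R]_d) (Sigma : nat -> Omega -> 'M[R]_d),
    [/\ 1 <= zeta, sym_posdef Sigma1, mean_cov_set zeta x1 Sigma1,
        adaptive_scaling (fun n w => sqrtmx (Sigma n w)) x1 s1 X S &
        (forall w, mu 1%N w = x1 /\ Sigma 1%N w = Sigma1) /\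
        forall n w, (2 <= n)%N ->
          let m := mu n.-1 w in
          let M := Sigma n.-1 w in
          let m' := (1 - eta n) *: m + eta n *: X n w in
          let M' := (1 - eta n) *: M
                    + eta n *: ((X n w - m) *m (X n w - m)^T) in
          (mu n w, Sigma n w) =
          if `[< mean_cov_set zeta m' M' >] then (m', M') else (m, M)].

End algorithms.

(* Main.v *)
(** For an invertible matrix L let P_L be the Metropolis kernel with proposals
    x + L w, where w has density q. Each P_L leaves pi invariant, and as long as
    a |v| <= |L v| <= b |v| it satisfies a Doeblin condition whose constant
    depends on a and b only; moreover the iterates of P_L are Lipschitz in L,
    because q is radial and decreasing.

    The mean acceptance rate of P_L exceeds alpha^* (< 1/2) when L is small and
    L, L^-1 are comparable: near a point of the support, the C^1 boundary makes
    the support contain a cone slightly thinner than a half-space, which has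
    nearly half of the symmetric mass of q, and the support is compact. It is
    below alpha^* when L is large. Hence the squared distance of S_n to a large
    interval is a supermartingale up to the summable errors eta_n^2, so that S_n
    is almost surely bounded.

    On that event the shape matrices L_n stay in a compact set and vary slowly.
    With g = sum_(j < m) P_L^j f one has f = P_L^m f + (g - P_L g), so the averages
    of f(X_k) are, up to (1 - delta)^m, averages of bounded martingale increments
    plus telescoping terms plus terms controlled by L_(k+1) - L_k. *)

Require Import Defs.
From HB Require Import structures.
From mathcomp Require Import all_boot all_order all_algebra.
From mathcomp Require Import all_classical all_reals all_analysis.
From mathcomp Require Import measurable_realfun.
From mathcomp Require Import spectral complex.
From mathcomp Require Import ring lra.

Set Implicit Arguments.
Unset Strict Implicit.
Unset Printing Implicit Defensive.

Import Order.TTheory GRing.Theory Num.Theory.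
Import numFieldNormedType.Exports.

Local Open Scope classical_set_scope.
Local Open Scope ring_scope.

(** * Lebesgue measure on column vectors *)

(** The Doeblin constant depends on the path through the bound on [S], so ergodicity is not uniform
    over the sample space. For a fixed truncation m, however, the Poisson increments are at most m B
    in absolute value whatever the scale does. Their law of large numbers therefore holds on the
    whole space for all m at once, and the bound on [S] enters afterwards, path by path.
    Conditioning on the past means integrating one step of the chain against an arbitrary bounded
    function of the past noise. This makes the increments orthogonal, and second moments along the
    squares give a strong law. It also bounds the mean of the Lyapunov function stopped at a level,
    and Markov's inequality then bounds the exit probability. Both the Doeblin condition and the
    Lipschitz bound are minorizations, so a linear map enters through a lower bound on its Jacobian:
    translation invariance gives a constant factor c, and comparing balls gives c >= b^-d. For the
    Lipschitz bound, the laws of w and N w, with N close to the identity, share a minorant of mass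
    (1 + e)^(-2 d). *)

Local Notation pushm := measure_function_pushforward__canonical__measure_function_Measure.

Section euclidean_lebesgue.
Context {R : realType}.

Definition box d (A : 'I_d -> set R) : set 'cV[R]_d :=
  [set v | forall i, A i (v i 0)].

Lemma lebesgue_measureD (t : R) (A : set R) : measurable A ->
  pushforward lebesgue_measure (fun x : measurableTypeR R => (x + t : measurableTypeR R)) A
    = lebesgue_measure A.
Proof.
move=> mA.
have mf : measurable_fun setT (fun x : measurableTypeR R => (x + t : measurableTypeR R)).
  exact: measurable_funD.
apply/esym; apply: (@lebesgue_measure_unique R
   (pushm lebesgue_measure mf)) => //=.
move=> _ [[a b]] _ <-; rewrite /pushforward /=.
rewrite (_ : _ @^-1` _ = `]a - t, b - t]%classic); last first.
  by apply/seteqP; split => x /=; rewrite !in_itv/= ltrBlDr lerBrDr.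
rewrite !lebesgue_measure_itv/= !lte_fin ltrD2r.
by case: ifPn => // _; rewrite !EFinB; congr (_%:E); lra.
Qed.

Lemma box_setI_closed d : setI_closed [set B | exists2 A : 'I_d -> set R,
  (forall i, measurable (A i)) & B = box A].
Proof.
move=> _ _ [A mA ->] [B mB ->]; exists (fun i => A i `&` B i).
  by move=> i; exact: measurableI.
apply/seteqP; split => v /=; first by move=> [a b] i; split; [exact: a|exact: b].
by move=> h; split => i; case: (h i).
Qed.

(** The preimages under single entries that generate the sigma-algebra are not stable under
    intersection. Boxes are, as the uniqueness theorem for measures requires. *)
Lemma cV_measurable_box d : @measurable _ 'cV[R]_d = <<s [set B | exists2 A : 'I_d -> set R,
  (forall i, measurable (A i)) & B = box A] >>.
Proof.
apply/seteqP; split; last first.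
  apply: smallest_sub; first exact: sigma_algebra_measurable.
  by move=> _ [A mA ->]; exact: measurable_box.
apply: smallest_sub; first exact: smallest_sigma_algebra.
move=> _ [[i j] _ [B mB <-]]; apply: sub_sigma_algebra.
exists (fun k => if k == i then B else setT).
  by move=> k; case: ifP.
apply/seteqP; split => v /=.
  by move=> [_ Bv] k; case: ifPn => // /eqP ->; move: Bv; rewrite ord1.
by move=> /(_ i); rewrite eqxx ord1.
Qed.

Definition cube d (s : R) : set 'cV[R]_d := box (fun _ : 'I_d => `[- s, s]%classic : set R).

Arguments cube : clear implicits.

Lemma measurable_cube d s : measurable (cube d s).
Proof. by apply: measurable_box => i. Qed.

Lemma cubeP d s (v : 'cV[R]_d) : cube d s v <-> forall i, `|v i 0| <= s.
Proof.
by split => h i; have := h i; rewrite /= in_itv/= ler_norml.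
Qed.

Lemma prod_lebesgue_cube d (s : R) : 0 <= s ->
  (\prod_(i < d) lebesgue_measure (`[(- s)%R, s]%classic : set R) = ((2 * s) ^+ d)%:E)%E.
Proof.
move=> s0.
transitivity (\prod_(i < d) (2 * s)%:E)%E.
  apply: eq_bigr => i _; rewrite lebesgue_measure_itv/= lte_fin.
  by case: ifPn => [_|]; [rewrite -EFinD|rewrite -leNgt => h]; congr (_%:E); lra.
by rewrite prodEFin prodr_const card_ord.
Qed.

Lemma lebesgue_cube d (s : R) : 0 <= s -> lebesgue_cV d (cube d s) = ((2 * s) ^+ d)%:E.
Proof. by move=> s0; rewrite lebesgue_cV_box// prod_lebesgue_cube. Qed.

Lemma bigcup_cube d : \bigcup_n cube d n%:R = setT.
Proof.
apply/seteqP; split => // v _.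
exists (Num.bound (\sum_i `|v i 0|)) => //; apply/cubeP => i.
apply: ltW; apply: le_lt_trans (archi_boundP _); last exact: sumr_ge0.
by rewrite (bigD1 i)//= lerDl sumr_ge0.
Qed.

(** Boxes form a generating pi-system, and the cubes, of finite measure, exhaust the space. This
    reduces invariance under translations and reflection to one coordinate. *)
Lemma measure_eq_box d (m1 m2 : {measure set 'cV[R]_d -> \bar R}) :
  (forall A, (forall i, measurable (A i)) ->
    m1 (box A) = (\prod_(i < d) lebesgue_measure (A i))%E) ->
  (forall A, (forall i, measurable (A i)) ->
    m2 (box A) = (\prod_(i < d) lebesgue_measure (A i))%E) ->
  forall B, measurable B -> m1 B = m2 B.
Proof.
move=> h1 h2 B mB.
apply: (measure_unique _ (fun n => cube d n%:R) (cV_measurable_box d) (@box_setI_closed d)) => //.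
- by move=> n; exists (fun=> `[- n%:R, n%:R]%classic).
- exact: bigcup_cube.
- by move=> _ [A mA ->]; rewrite h1// h2.
- by move=> n; rewrite h1// prod_lebesgue_cube// ltry.
Qed.

Section measurable_mx_operations.
Context d0 (T : measurableType d0).

Lemma measurable_mxij m n (f : T -> 'M[R]_(m, n)) i j :
  measurable_fun setT f -> measurable_fun setT (fun t => f t i j).
Proof. by move=> mf; apply: (measurableT_comp (measurable_entry i j) mf). Qed.

Lemma measurable_mxD m n (f g : T -> 'M[R]_(m, n)) :
  measurable_fun setT f -> measurable_fun setT g ->
  measurable_fun setT (fun t => f t + g t).
Proof.
move=> mf mg; apply: measurable_fun_mx => i j; under eq_fun do rewrite mxE.
by apply: measurable_funD; exact: measurable_mxij.
Qed.

Lemma measurable_mxN m n (f : T -> 'M[R]_(m, n)) :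
  measurable_fun setT f -> measurable_fun setT (fun t => - f t).
Proof.
move=> mf; apply: measurable_fun_mx => i j; under eq_fun do rewrite mxE.
by apply: measurable_funN; exact: measurable_mxij.
Qed.

Lemma measurable_mxB m n (f g : T -> 'M[R]_(m, n)) :
  measurable_fun setT f -> measurable_fun setT g ->
  measurable_fun setT (fun t => f t - g t).
Proof. by move=> mf mg; apply: measurable_mxD => //; exact: measurable_mxN. Qed.

Lemma measurable_mxZ m n (a : T -> R) (f : T -> 'M[R]_(m, n)) :
  measurable_fun setT a -> measurable_fun setT f ->
  measurable_fun setT (fun t => a t *: f t).
Proof.
move=> ma mf; apply: measurable_fun_mx => i j; under eq_fun do rewrite mxE.
by apply: measurable_funM => //; exact: measurable_mxij.
Qed.

Lemma measurable_mxM m n p (f : T -> 'M[R]_(m, n)) (g : T -> 'M[R]_(n, p)) :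
  measurable_fun setT f -> measurable_fun setT g ->
  measurable_fun setT (fun t => f t *m g t).
Proof.
move=> mf mg; apply: measurable_fun_mx => i j; under eq_fun do rewrite mxE.
by apply: measurable_sum => k; apply: measurable_funM; exact: measurable_mxij.
Qed.

Lemma measurable_mxT m n (f : T -> 'M[R]_(m, n)) :
  measurable_fun setT f -> measurable_fun setT (fun t => (f t)^T).
Proof.
move=> mf; apply: measurable_fun_mx => i j; under eq_fun do rewrite mxE.
exact: measurable_mxij.
Qed.

End measurable_mx_operations.

Lemma measurable_addv d (v : 'cV[R]_d) : measurable_fun setT (fun u : 'cV[R]_d => u + v).
Proof. exact: measurable_mxD. Qed.

Lemma measurable_oppv d : measurable_fun setT (fun u : 'cV[R]_d => - u).
Proof. exact: measurable_mxN. Qed.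

Lemma measurable_mulmx d (L : 'M[R]_d) : measurable_fun setT (fun u : 'cV[R]_d => L *m u).
Proof. exact: measurable_mxM. Qed.

Lemma lebesgue_cVD d (v : 'cV[R]_d) (A : set 'cV[R]_d) : measurable A ->
  lebesgue_cV d ((fun u => u + v) @^-1` A) = lebesgue_cV d A.
Proof.
move=> mA.
pose m1 := pushm (lebesgue_cV d) (measurable_addv v).
apply: (@measure_eq_box d m1 (lebesgue_cV d) _ _ A mA) => B mB; last exact: lebesgue_cV_box.
rewrite /= /pushforward.
rewrite (_ : _ @^-1` _ = box (fun i => (fun x => x + v i 0) @^-1` (B i))); last first.
  by apply/seteqP; split => u /= h i; have := h i; rewrite mxE.
rewrite lebesgue_cV_box; last first.
  move=> i; rewrite -[X in measurable X]setTI.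
  by apply: (_ : measurable_fun _ _) => //; exact: measurable_funD.
by apply: eq_bigr => i _; exact: lebesgue_measureD.
Qed.

Lemma lebesgue_cVN d (A : set 'cV[R]_d) : measurable A ->
  lebesgue_cV d ((fun u => - u) @^-1` A) = lebesgue_cV d A.
Proof.
move=> mA.
pose m1 := pushm (lebesgue_cV d) (@measurable_oppv d).
apply: (@measure_eq_box d m1 (lebesgue_cV d) _ _ A mA) => B mB; last exact: lebesgue_cV_box.
rewrite /= /pushforward.
rewrite (_ : _ @^-1` _ = box (fun i => -%R @^-1` (B i))); last first.
  by apply/seteqP; split => u /= h i; have := h i; rewrite mxE.
rewrite lebesgue_cV_box; last first.
  move=> i; rewrite -[X in measurable X]setTI.
  by apply: (_ : measurable_fun _ _) => //; exact: oppr_measurable.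
by apply: eq_bigr => i _; exact: lebesgue_measureN.
Qed.

Lemma ge0_integralD_translate d (v : 'cV[R]_d) (f : 'cV[R]_d -> \bar R) :
  measurable_fun setT f -> (forall x, 0 <= f x)%E ->
  (\int[lebesgue_cV d]_x f (x + v)%R = \int[lebesgue_cV d]_x f x)%E.
Proof.
move=> mf f0.
rewrite -(@ge0_integral_pushforward _ _ _ _ R _ (measurable_addv v) (lebesgue_cV d) setT f)//.
apply: (@eq_measure_integral _ _ _ setT (lebesgue_cV d) (pushm _ (measurable_addv v))) => A mA _.
exact: lebesgue_cVD.
Qed.

(* Fubini for the indicator of {(x, y) | A x, B (x + y)}; nu plays the role of an arbitrary Haar measure. *)
Lemma haar_swap d (nu : {sigma_finite_measure set 'cV[R]_d -> \bar R}) (A B : set 'cV[R]_d) :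
  (forall v (C : set 'cV[R]_d), measurable C -> nu ((fun u => (u + v)%R) @^-1` C) = nu C) ->
  measurable A -> measurable B ->
  (lebesgue_cV d A * nu B = lebesgue_cV d B * nu ((fun u => (- u)%R) @^-1` A))%E.
Proof.
move=> nuD mA mB.
pose g1 (p : 'cV[R]_d * 'cV[R]_d) : \bar R := (\1_A p.1 * \1_B (p.2 + p.1))%:E.
pose g2 (p : 'cV[R]_d * 'cV[R]_d) : \bar R := (\1_B p.1 * \1_A (p.1 - p.2))%:E.
have mg1 : measurable_fun setT g1.
  apply/measurable_EFinP; apply: measurable_funM.
    by apply: measurableT_comp => //; exact: measurable_indic.
  apply: measurableT_comp; first exact: measurable_indic.
  exact: measurable_mxD.
have mg2 : measurable_fun setT g2.
  apply/measurable_EFinP; apply: measurable_funM.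
    by apply: measurableT_comp => //; exact: measurable_indic.
  apply: measurableT_comp; first exact: measurable_indic.
  exact: measurable_mxB.
have -> : (lebesgue_cV d A * nu B = \int[lebesgue_cV d]_x \int[nu]_y g1 (x, y))%E.
  rewrite -[in LHS](setIT A) -(@integral_indic _ _ _ (lebesgue_cV d) setT)//.
  rewrite -ge0_integralZr//; last exact/measurable_EFinP/measurable_indic.
  apply: eq_integral => x _; rewrite /g1/=.
  under eq_integral do rewrite EFinM.
  rewrite ge0_integralZl//; last first.
  - apply/measurable_EFinP; apply: measurableT_comp; first exact: measurable_indic.
    exact: measurable_addv.
  congr (_ * _)%E.
  transitivity (\int[nu]_y (\1_((fun y => (y + x)%R) @^-1` B) y)%:E)%E => //.
  rewrite integral_indic//; first by rewrite setIT; exact/esym/nuD.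
  by rewrite -[X in measurable X]setTI; exact: measurable_addv.
rewrite (fubini_tonelli g1)//=; last first.
  by move=> p; rewrite lee_fin mulr_ge0.
(* For fixed y the substitution x -> x + y, which preserves Lebesgue measure, turns [g2] into
   [g1]. *)
transitivity (\int[nu]_y \int[lebesgue_cV d]_x g2 (x, y))%E.
  apply: eq_integral => y _.
  rewrite -(@ge0_integralD_translate _ y (fun x => g2 (x, y)))//; last 2 first.
  - exact: measurableT_comp.
  - by move=> x; rewrite lee_fin mulr_ge0.
  by apply: eq_integral => x _; rewrite /g1 /g2/= addrK mulrC addrC.
rewrite -(fubini_tonelli g2)//=; last first.
  by move=> p; rewrite lee_fin mulr_ge0.
have mNA : measurable ((fun u => - u) @^-1` A).
  by rewrite -[X in measurable X]setTI; exact: measurable_oppv.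
rewrite -[X in (lebesgue_cV d X * _)%E](setIT B) -(@integral_indic _ _ _ (lebesgue_cV d) setT)//.
rewrite -ge0_integralZr//; last exact/measurable_EFinP/measurable_indic.
apply: eq_integral => x _; rewrite /g2/=.
under eq_integral do rewrite EFinM.
rewrite ge0_integralZl//; last first.
- apply/measurable_EFinP; apply: measurableT_comp; first exact: measurable_indic.
  exact: measurable_mxB.
congr (_ * _)%E.
transitivity (\int[nu]_y (\1_((fun y => (y - x)%R) @^-1` ((fun u => (- u)%R) @^-1` A)) y)%:E)%E.
  apply: eq_integral => y _; rewrite -(opprB y x) !indicE; congr (_%:R%:E).
rewrite integral_indic//; first by rewrite setIT; exact: nuD.
by rewrite -[X in measurable X]setTI; exact: measurable_addv.
Qed.


Section lebesgue_lin.
Context d (L : 'M[R]_d) (uL : L \in unitmx).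

(** The proof of invertibility is an argument so that the sigma-finite structure, which depends on
    it, can be attached to the term [lebesgue_lin uL]. *)
Definition lebesgue_lin & L \in unitmx : set 'cV[R]_d -> \bar R :=
  pushforward (lebesgue_cV d) (fun u => L *m u).

HB.instance Definition _ := Measure.copy (lebesgue_lin uL)
  (pushm (lebesgue_cV d) (measurable_mulmx L)).

Lemma lebesgue_linE A :
  lebesgue_lin uL A = lebesgue_cV d ((fun u => L *m u) @^-1` A).
Proof. by []. Qed.

Lemma lebesgue_lin_sigma_finite : sigma_finite setT (lebesgue_lin uL).
Proof.
exists (fun n => (fun u => invmx L *m u) @^-1` cube d n%:R).
  by rewrite -(preimage_bigcup setT) bigcup_cube preimage_setT.
move=> n; split.
  by rewrite -[X in measurable X]setTI; apply: measurable_mulmx => //; exact: measurable_cube.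
rewrite lebesgue_linE -comp_preimage (_ : _ \o _ = id).
  by rewrite preimage_id lebesgue_cube// ltry.
by apply/funext => u /=; rewrite mulKmx.
Qed.

HB.instance Definition _ := Measure_isSigmaFinite.Build _ _ _ (lebesgue_lin uL)
  lebesgue_lin_sigma_finite.

End lebesgue_lin.

Lemma lebesgue_linP d (L : 'M[R]_d) : L \in unitmx ->
  exists2 c : R, 0 <= c & forall A : set 'cV[R]_d, measurable A ->
    lebesgue_cV d ((fun u => L *m u) @^-1` A) = (c%:E * lebesgue_cV d A)%E.
Proof.
move=> uL.
pose nu : {sigma_finite_measure set _ -> \bar R} := lebesgue_lin uL.
have nuD v (C : set 'cV[R]_d) : measurable C -> nu ((fun u => (u + v)%R) @^-1` C) = nu C.
  move=> mC; rewrite /nu/= lebesgue_linE.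
  rewrite [LHS](_ : _ = lebesgue_cV d ((fun u => u + invmx L *m v) @^-1` ((fun u => L *m u) @^-1` C))).
    rewrite lebesgue_cVD// -[X in measurable X]setTI; exact: measurable_mulmx.
  congr (lebesgue_cV d _); apply/seteqP; split => u /=; rewrite mulmxDr mulKVmx//.
pose A := cube d 1.
have mA : measurable A by exact: measurable_cube.
have AN : (fun u => (- u)%R) @^-1` A = A.
  by apply/seteqP; split => u /= /cubeP h; apply/cubeP => i; move: (h i); rewrite mxE normrN.
have lA : lebesgue_cV d A = ((2 ^+ d)%:E)%E by rewrite lebesgue_cube// mulr1.
have A0 : (0 < 2 ^+ d :> R)%R by rewrite exprn_gt0.
have h (B : set _) (mB : measurable B) := haar_swap nuD mA mB.
have fin : (nu A < +oo)%E.
  (* [r] bounds every entry of [invmx L *m u] on the unit cube. The preimage of [cube d r] under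
     [invmx L] contains [A], and its [nu]-measure is the Lebesgue measure of [cube d r], which is
     finite. *)
  pose r := \sum_i \sum_j `|invmx L i j|.
  have sub : A `<=` (fun u => invmx L *m u) @^-1` cube d r.
    move=> u /cubeP Au; apply/cubeP => i; rewrite mxE.
    apply: le_trans (ler_norm_sum _ _ _) _.
    apply: (@le_trans _ _ (\sum_j `|invmx L i j|)); last first.
      by rewrite /r [leRHS](bigD1 i)//= lerDl; do 2 apply: sumr_ge0 => ? _.
    by apply: ler_sum => j _; rewrite normrM ler_piMr.
  have mG : measurable ((fun u => invmx L *m u) @^-1` cube d r).
    by rewrite -[X in measurable X]setTI; apply: measurable_mulmx => //; exact: measurable_cube.
  apply: le_lt_trans (le_measure nu _ _ sub) _; rewrite ?inE//.
  rewrite /nu/= lebesgue_linE -comp_preimage (_ : _ \o _ = id).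
    by rewrite preimage_id lebesgue_cube ?ltry// /r; do 2 apply: sumr_ge0 => ? _.
  by apply/funext => u /=; rewrite mulKmx.
have nuA0 : (0 <= nu A)%E by [].
exists (fine (nu A) / 2 ^+ d).
  by rewrite divr_ge0// ?fine_ge0// ltW.
move=> B mB; have := h B mB; rewrite AN lA => e.
have -> : lebesgue_cV d ((fun u => L *m u) @^-1` B) = nu B by [].
rewrite mulrC EFinM fineK ?ge0_fin_numE// -muleA [X in (_ * X)%E]muleC -e muleA -EFinM.
by rewrite mulVf ?mul1e// gt_eqF.
Qed.

End euclidean_lebesgue.
Arguments cube {R} d s.

(** * Measurability of relatively open sets of matrices *)

Lemma rat_approx {R : realType} (x r : R) : 0 < r -> exists q : rat, `|x - ratr q| < r.
Proof.
move=> r0; have : x - r < x + r by lra.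
move=> /rat_in_itvoo[q]; rewrite in_itv/= => /andP[h1 h2].
by exists q; rewrite ltr_norml; apply/andP; split; lra.
Qed.

Lemma normr_close {R : realType} (a b c r e : R) :
  `|a - c| < r -> `|b - c| < r -> 2 * r < e -> `|a - b| < e.
Proof.
move=> h1 h2 h; rewrite (_ : a - b = (a - c) - (b - c)); last by ring.
by apply: le_lt_trans (ler_normB _ _) _; lra.
Qed.

Section relatively_open.
Context {R : realType} (m n : nat).
Implicit Types (S A : set 'M[R]_(m, n)) (M : 'M[R]_(m, n)).

(** Sup-norm balls with rational centres and radii 1 / (k + 1): a base of the topology whose index
    set is countable. *)
Definition rat_ball (qk : 'M[rat]_(m, n) * nat) : set 'M[R]_(m, n) :=
  [set M | forall i j, `|M i j - ratr (qk.1 i j)| < qk.2.+1%:R^-1].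

Lemma measurable_rat_ball qk : measurable (rat_ball qk).
Proof.
rewrite (_ : rat_ball qk = \bigcap_(ij in setT)
  ((fun M : 'M[R]_(m, n) => `|M ij.1 ij.2 - ratr (qk.1 ij.1 ij.2)|) @^-1` `]-oo, qk.2.+1%:R^-1[)).
  apply: fin_bigcap_measurable => [|ij _]; first exact: finite_finset.
  rewrite -[X in measurable X]setTI.
  have h : measurable_fun setT (fun M : 'M[R]_(m, n) => `|M ij.1 ij.2 - ratr (qk.1 ij.1 ij.2)|).
    apply: measurableT_comp => //; apply: measurable_funB => //; exact: measurable_entry.
  by apply: h.
apply/seteqP; split => M /=.
  by move=> h ij _; rewrite /= in_itv/=; exact: h.
by move=> h i j; have := h (i, j) I; rewrite /= in_itv.
Qed.

(** Second countability: A is cut out of S by the countably many rational balls whose trace on S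
    lies in A. Working relative to S matters for [sqrtmx], which is controlled only on a set of
    positive definite matrices. *)
Lemma relatively_open_measurable S A : measurable S ->
  (forall M, S M -> A M -> exists2 e : R, 0 < e & forall M', S M' ->
    (forall i j, `|M' i j - M i j| < e) -> A M') ->
  measurable (S `&` A).
Proof.
move=> mS oA.
rewrite (_ : S `&` A = S `&` \bigcup_(qk in [set qk | S `&` rat_ball qk `<=` A]) rat_ball qk); last first.
  apply/seteqP; split => [M [SM AM]|M [SM [qk /= h qM]]]; split => //; last by apply: h.
  have [e e0 he] := oA M SM AM.
  (* A rational ball has diameter at most 2 / (k + 1), which has to stay below [e]. *)
  pose k := Num.bound (2 / e).
  have ke : 2 * k.+1%:R^-1 < e.
    rewrite ltr_pdivrMr// mulrC -ltr_pdivrMr//.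
    apply: lt_le_trans (_ : k%:R <= _); last by rewrite ler_nat.
    by apply: archi_boundP; rewrite divr_ge0// ltW.
  have k0 : 0 < k.+1%:R^-1 :> R by rewrite invr_gt0.
  have hq i j := rat_approx (M i j) k0.
  pose q : 'M[rat]_(m, n) := \matrix_(i, j) projT1 (cid (hq i j)).
  have qP i j : `|M i j - ratr (q i j)| < k.+1%:R^-1 by rewrite mxE; case: cid.
  exists (q, k) => //= M' [SM' M'q]; apply: he => // i j.
  exact: normr_close (M'q i j) (qP i j) ke.
apply: measurableI => //; rewrite bigcup_mkcond; apply: countable_bigcupT_measurable => // qk.
by case: ifP => _ //; exact: measurable_rat_ball.
Qed.

Lemma relatively_continuous_measurable S (f : 'M[R]_(m, n) -> R) : measurable S ->
  (forall M, S M -> forall e : R, 0 < e -> exists2 r : R, 0 < r & forall M', S M' ->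
    (forall i j, `|M' i j - M i j| < r) -> `|f M' - f M| < e) ->
  measurable_fun S f.
Proof.
move=> mS cf; apply: (measurability _ (RGenOInfty.measurableE R)) => //.
move=> _ [_ [a ->] <-]; apply: relatively_open_measurable => // M SM.
rewrite /= in_itv/= andbT => afM.
have [|r r0 hr] := cf M SM (f M - a); first by rewrite subr_gt0.
exists r => // M' SM' h; have := hr M' SM' h; rewrite in_itv/= andbT ltr_norml.
by move=> /andP[+ _]; lra.
Qed.

End relatively_open.

(** * Integration against a density *)

Section density_integral.
Context {R : realType} {dT : measure_display} {T : measurableType dT}.
Local Open Scope ereal_scope.
Import HBNNSimple.

(** Checked on simple functions, where it is additivity together with [nuE] on level sets, then
    passed to the limit by monotone convergence on both sides. *)
Lemma ge0_integral_density (mu nu : {measure set T -> \bar R}) (p : T -> R) :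
  measurable_fun setT p -> (forall x, 0 <= p x)%R ->
  (forall A, measurable A -> nu A = \int[mu]_(x in A) (p x)%:E) ->
  forall f : T -> \bar R, measurable_fun setT f -> (forall x, 0 <= f x) ->
  \int[nu]_x f x = \int[mu]_x (f x * (p x)%:E).
Proof.
move=> mp p0 nuE f mf f0.
pose f_ := nnsfun_approx measurableT mf.
have fcvg x : limn (fun n => (f_ n x)%:E) = f x.
  by apply/cvg_lim => //; apply: cvg_nnsfun_approx.
have mf_ n : measurable_fun setT (fun x => (f_ n x)%:E) by exact/measurable_EFinP.
have nd x n m : (n <= m)%N -> (f_ n x)%:E <= (f_ m x)%:E.
  by move=> nm; rewrite lee_fin; exact/lefP/nd_nnsfun_approx.
transitivity (limn (fun n => \int[nu]_x (f_ n x)%:E)).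
  rewrite -monotone_convergence//.
  - by apply: eq_integral => x _; rewrite fcvg.
  - by move=> n x _; rewrite lee_fin.
  - by move=> x _ m n mn; exact: nd.
transitivity (limn (fun n => \int[mu]_x ((f_ n x)%:E * (p x)%:E))); last first.
  rewrite -monotone_convergence//.
  - apply: eq_integral => x _; apply/cvg_lim => //.
    by apply: cvgeZr => //; apply: cvg_nnsfun_approx.
  - move=> n; apply: emeasurable_funM => //; exact/measurable_EFinP.
  - by move=> n x _; rewrite mule_ge0// lee_fin.
  - by move=> x _ m n mn; rewrite lee_wpmul2r ?lee_fin//; exact: nd.
congr (limn _); apply/funext => n.
have mpre k : measurable (f_ n @^-1` [set k]).
  by rewrite -[X in measurable X]setTI; exact: measurable_funP.
transitivity (\sum_(k \in range (f_ n)) (k%:E * nu (f_ n @^-1` [set k]))).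
  under eq_integral do rewrite fimfunE -fsumEFin//.
  rewrite ge0_integral_fsum//; last 2 first.
  - by move=> y; exact/measurable_EFinP/measurable_funM.
  - by move=> y x _; rewrite nnfun_muleindic_ge0.
  apply: eq_fsbigr => r _; rewrite integralZl_indic_nnsfun// integral_indic//=.
  by rewrite setIT.
transitivity (\int[mu]_x (\sum_(k \in range (f_ n))
    ((k * \1_(f_ n @^-1` [set k]) x)%:E * (p x)%:E))); last first.
  apply: eq_integral => x _; rewrite [in RHS]fimfunE -fsumEFin// ge0_mule_fsuml//.
  by move=> r; exact: nnfun_muleindic_ge0.
rewrite ge0_integral_fsum//; last 2 first.
- move=> y; apply: emeasurable_funM; first exact/measurable_EFinP/measurable_funM.
  exact/measurable_EFinP.
- by move=> y x _; rewrite mule_ge0 ?nnfun_muleindic_ge0// lee_fin.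
apply: eq_fsbigr => r; rewrite inE => -[t _ rE].
have r0 : (0 <= r)%R by rewrite -rE.
under [RHS]eq_integral do rewrite EFinM -muleA.
rewrite ge0_integralZl//; last 2 first.
- apply: emeasurable_funM; first exact/measurable_EFinP.
  exact/measurable_EFinP.
- by move=> x _; rewrite mule_ge0 ?lee_fin.
congr (_ * _); rewrite nuE// integral_mkcond; apply: eq_integral => x _.
rewrite patchE indicE; case: ifP => _; first by rewrite mul1e.
by rewrite mul0e.
Qed.

End density_integral.

(** * Bounded measurable functions *)

(** Under a probability measure such functions are integrable, so linearity, monotonicity and Fubini
    for the real-valued integral need no further integrability conditions. *)
Definition bmf {R : realType} {dT : measure_display} {T : measurableType dT} (f : T -> R) :=
  measurable_fun setT f /\ exists M, forall x, `|f x| <= M.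

Section bounded_measurable_functions.
Context {R : realType} {dT : measure_display} {T : measurableType dT}.
Implicit Types (f g : T -> R).

Lemma bmf_meas f : bmf f -> measurable_fun setT f.
Proof. by case. Qed.

Lemma bmf_cst (c : R) : bmf (fun _ : T => c).
Proof. by split => //; exists `|c|. Qed.

Lemma bmfD f g : bmf f -> bmf g -> bmf (fun x => f x + g x).
Proof.
move=> [mf [M hM]] [mg [N hN]]; split; first exact: measurable_funD.
by exists (M + N) => x; rewrite (le_trans (ler_normD _ _))// lerD.
Qed.

Lemma bmfM f g : bmf f -> bmf g -> bmf (fun x => f x * g x).
Proof.
move=> [mf [M hM]] [mg [N hN]]; split; first exact: measurable_funM.
by exists (M * N) => x; rewrite normrM ler_pM.
Qed.

Lemma bmfN f : bmf f -> bmf (fun x => - f x).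
Proof.
move=> [mf [M hM]]; split; first exact: measurable_funN.
by exists M => x; rewrite normrN.
Qed.

Lemma bmfB f g : bmf f -> bmf g -> bmf (fun x => f x - g x).
Proof. by move=> bf bg; apply: bmfD => //; exact: bmfN. Qed.

Lemma bmfZ (c : R) f : bmf f -> bmf (fun x => c * f x).
Proof. by move=> bf; apply: bmfM => //; exact: bmf_cst. Qed.

Lemma bmfX n f : bmf f -> bmf (fun x => f x ^+ n).
Proof.
move=> bf; elim: n => [|n IH]; first exact: bmf_cst.
by under eq_fun do rewrite exprS; exact: bmfM.
Qed.

Lemma bmf_sum I (s : seq I) (F : I -> T -> R) :
  (forall i, bmf (F i)) -> bmf (fun x => \sum_(i <- s) F i x).
Proof.
move=> bF; elim: s => [|i s IH].
  by under eq_fun do rewrite big_nil; exact: bmf_cst.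
by under eq_fun do rewrite big_cons; exact: bmfD.
Qed.

Lemma bmf_indic (A : set T) : measurable A -> bmf (\1_A : T -> R).
Proof.
move=> mA; split; first exact: measurable_indic.
by exists 1 => x; rewrite indicE; case: (_ \in _); rewrite ?normr1 ?normr0.
Qed.

Lemma bmf_comp dT' (T' : measurableType dT') (h : T' -> T) f :
  measurable_fun setT h -> bmf f -> bmf (fun x => f (h x)).
Proof.
move=> mh [mf [M hM]]; split; last by exists M => x.
exact: measurableT_comp.
Qed.

Lemma bmf_ge0 (M : R) f : measurable_fun setT f -> (forall x, 0 <= f x <= M) -> bmf f.
Proof.
move=> mf h; split=> //; exists M => x; have /andP[? ?] := h x.
by rewrite ger0_norm.
Qed.

Variable P : probability T R.

Lemma bmf_integrable f : bmf f -> P.-integrable setT (EFin \o f).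
Proof.
move=> [mf [M hM]]; apply: measurable_bounded_integrable => //.
  by apply: (@le_lt_trans _ _ 1%E); [exact: (probability_le1 P measurableT)|exact: ltry].
exists `|M|; split; first by rewrite num_real.
move=> r hr x _ /=; apply: le_trans (hM x) _.
by apply: le_trans (ler_norm _) _; exact: ltW.
Qed.

Lemma RintegralE f : bmf f -> (\int[P]_x (f x)%:E)%E = (\int[P]_x f x)%:E.
Proof.
move=> bf; rewrite /Rintegral fineK//.
by apply: integrable_fin_num => //; exact: bmf_integrable.
Qed.

Lemma ERD f g : bmf f -> bmf g -> \int[P]_x (f x + g x) = \int[P]_x f x + \int[P]_x g x.
Proof. by move=> bf bg; apply: RintegralD => //; exact: bmf_integrable. Qed.

Lemma ERB f g : bmf f -> bmf g -> \int[P]_x (f x - g x) = \int[P]_x f x - \int[P]_x g x.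
Proof. by move=> bf bg; apply: RintegralB => //; exact: bmf_integrable. Qed.

Lemma ERZl (c : R) f : bmf f -> \int[P]_x (c * f x) = c * \int[P]_x f x.
Proof. by move=> bf; apply: RintegralZl => //; exact: bmf_integrable. Qed.

Lemma ER_cst (c : R) : \int[P]_x c = c.
Proof. by rewrite Rintegral_cst// [X in _ * X](congr1 fine (probability_setT P)) mulr1. Qed.

Lemma ER_le f g : bmf f -> bmf g -> (forall x, f x <= g x) -> \int[P]_x f x <= \int[P]_x g x.
Proof. by move=> bf bg fg; apply: le_Rintegral => //; exact: bmf_integrable. Qed.

Lemma ER_ge0 f : (forall x, 0 <= f x) -> 0 <= \int[P]_x f x.
Proof. by move=> f0; apply: Rintegral_ge0. Qed.

Lemma ER_normr_le (M : R) f : measurable_fun setT f -> (forall x, `|f x| <= M) ->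
  `|\int[P]_x f x| <= M.
Proof.
move=> mf h; have bf : bmf f by split => //; exists M.
rewrite ler_norml; apply/andP; split.
  rewrite -(ER_cst (- M)); apply: ER_le => //; first exact: bmf_cst.
  by move=> x; have := h x; rewrite ler_norml => /andP[].
rewrite -(ER_cst M); apply: ER_le => //; first exact: bmf_cst.
by move=> x; have := h x; rewrite ler_norml => /andP[].
Qed.

Lemma ER_sum I (s : seq I) (F : I -> T -> R) : (forall i, bmf (F i)) ->
  \int[P]_x (\sum_(i <- s) F i x) = \sum_(i <- s) \int[P]_x F i x.
Proof.
move=> bF; elim: s => [|i s IH].
  by rewrite big_nil -[RHS]ER_cst; apply: eq_Rintegral => x _; rewrite big_nil.
rewrite big_cons -IH -ERD//; last exact: bmf_sum.
by apply: eq_Rintegral => x _; rewrite big_cons.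
Qed.

Lemma ER_indic (A : set T) : measurable A -> \int[P]_x (\1_A x : R) = fine (P A).
Proof. by move=> mA; rewrite /Rintegral integral_indic// setIT. Qed.

End bounded_measurable_functions.

Lemma ER_transfer {R : realType} dT (T : measurableType dT) dT' (T' : measurableType dT')
    (P : probability T R) (Q : probability T' R) (X : T -> T')
    (f : T' -> R) : measurable_fun setT X ->
  (forall A, measurable A -> Q A = P (X @^-1` A)) ->
  bmf f -> \int[Q]_x f x = \int[P]_x f (X x).
Proof.
move=> mX QE bf; have bfX : bmf (fun x => f (X x)) := bmf_comp mX bf.
apply: EFin_inj; rewrite -!RintegralE//.
have h : P.-integrable (X @^-1` setT) ((EFin \o f) \o X).
  by rewrite preimage_setT; exact: bmf_integrable.
have := integral_pushforward mX _ h measurableT; rewrite preimage_setT => <-.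
  by apply: (@eq_measure_integral _ _ _ setT (pushm P mX)) => A mA _; apply: QE.
by apply/measurable_EFinP; exact: bmf_meas.
Qed.

(** * Fubini and independence for bounded functions *)

Section bounded_fubini.
Context {R : realType} {d1 d2 : measure_display} {T1 : measurableType d1}
  {T2 : measurableType d2} (P1 : probability T1 R) (P2 : probability T2 R).
Variables (f : T1 * T2 -> R) (bf : bmf f).

Lemma bmf_pair1 x : bmf (fun y => f (x, y)).
Proof. by apply: (bmf_comp (h := fun y => (x, y))) bf; exact: measurable_fun_pair. Qed.

Lemma bmf_pair2 y : bmf (fun x => f (x, y)).
Proof. by apply: (bmf_comp (h := fun x => (x, y))) bf; exact: measurable_fun_pair. Qed.

Let integrable_prod : (P1 \x P2)%E.-integrable setT (EFin \o f).
Proof.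
case: bf => mf [M hM]; apply: measurable_bounded_integrable => //.
  have e : (P1 \x P2)%E setT = 1%E.
    transitivity (P1 setT * P2 setT)%E; last first.
      by rewrite (probability_setT P1) (probability_setT P2) mule1.
    by rewrite -setXTT; exact: product_measure1E.
  apply: le_lt_trans (ltry 1); rewrite le_eqVlt; apply/orP; left; apply/eqP; exact: e.
exists `|M|; split; first by rewrite num_real.
move=> r hr x _ /=; apply: le_trans (hM x) _.
by apply: le_trans (ler_norm _) _; exact: ltW.
Qed.

Lemma bmf_fubini1 : bmf (fun x => \int[P2]_y f (x, y)).
Proof.
split.
  apply/measurable_EFinP.
  rewrite (_ : _ \o _ = fubini_F P2 (EFin \o f)); first exact: (measurable_fubini_F integrable_prod).
  by apply/funext => x /=; rewrite -RintegralE//; exact: bmf_pair1.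
case: bf => mf [M hM]; exists M => x; apply: ER_normr_le => //.
exact: bmf_meas (bmf_pair1 x).
Qed.

Lemma bmf_fubini2 : bmf (fun y => \int[P1]_x f (x, y)).
Proof.
split.
  apply/measurable_EFinP.
  rewrite (_ : _ \o _ = fubini_G P1 (EFin \o f)); first exact: (measurable_fubini_G integrable_prod).
  by apply/funext => x /=; rewrite -RintegralE//; exact: bmf_pair2.
case: bf => mf [M hM]; exists M => x; apply: ER_normr_le => //.
exact: bmf_meas (bmf_pair2 x).
Qed.

Lemma ER_prod1 : \int[(P1 \x P2)%E]_z f z = \int[P1]_x \int[P2]_y f (x, y).
Proof.
rewrite [LHS]/Rintegral -(integral12_prod_meas1 integrable_prod).
congr fine; apply: eq_integral => x _; rewrite -RintegralE//; exact: bmf_pair1.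
Qed.

Lemma ER_prod2 : \int[(P1 \x P2)%E]_z f z = \int[P2]_y \int[P1]_x f (x, y).
Proof.
rewrite [LHS]/Rintegral -(integral21_prod_meas1 integrable_prod).
congr fine; apply: eq_integral => x _; rewrite -RintegralE//; exact: bmf_pair2.
Qed.

Lemma ER_fubini : \int[P1]_x \int[P2]_y f (x, y) = \int[P2]_y \int[P1]_x f (x, y).
Proof. by rewrite -ER_prod1 ER_prod2. Qed.

(** The hypothesis on rectangles identifies the joint law of [X] and [Y] with the product measure;
    the rest is Fubini. *)
Lemma ER_independent dO (O : measurableType dO) (P : probability O R)
    (X : O -> T1) (Y : O -> T2) :
  measurable_fun setT X -> measurable_fun setT Y ->
  (forall A B, measurable A -> measurable B ->
    P (X @^-1` A `&` Y @^-1` B) = P1 A * P2 B)%E ->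
  \int[P]_w f (X w, Y w) = \int[P1]_x \int[P2]_y f (x, y).
Proof.
move=> mX mY ind.
have mXY : measurable_fun setT (fun w => (X w, Y w)) by exact: measurable_fun_pair.
rewrite -ER_prod1.
have bfXY : bmf (fun w => f (X w, Y w)) := bmf_comp mXY bf.
rewrite [RHS]/Rintegral; apply: EFin_inj; rewrite -RintegralE//.
rewrite fineK; last exact: integrable_fin_num.
have h : P.-integrable ((fun w => (X w, Y w)) @^-1` setT) ((EFin \o f) \o (fun w => (X w, Y w))).
  by rewrite preimage_setT; exact: bmf_integrable.
have := integral_pushforward mXY _ h measurableT; rewrite preimage_setT => <-; last first.
  by apply/measurable_EFinP; exact: bmf_meas.
apply/esym; apply: (@eq_measure_integral _ _ _ setT (pushm P mXY)) => A mA _.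
apply: (@product_measure_unique _ _ _ _ _ P1 P2 (pushm P mXY) _ A mA) => B C mB mC.
exact: ind.
Qed.

End bounded_fubini.

(** * Euclidean norm, quadratic forms and square roots of matrices *)

Section euclidean_norm.
Context {R : realType} {d : nat}.
Implicit Types (u v : 'cV[R]_d).

Lemma dotE u v : dot u v = (u^T *m v) 0 0.
Proof. by rewrite mxE; apply: eq_bigr => i _; rewrite mxE. Qed.

Lemma dotC u v : dot u v = dot v u.
Proof. by apply: eq_bigr => i _; rewrite mulrC. Qed.

Lemma dotDl u v w : dot (u + v) w = dot u w + dot v w.
Proof. by rewrite !dotE linearD mulmxDl mxE. Qed.

Lemma dotDr u v w : dot w (u + v) = dot w u + dot w v.
Proof. by rewrite dotC dotDl !(dotC w). Qed.

Lemma dotZl a u v : dot (a *: u) v = a * dot u v.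
Proof. by rewrite !dotE linearZ -scalemxAl mxE. Qed.

Lemma dotZr a u v : dot u (a *: v) = a * dot u v.
Proof. by rewrite dotC dotZl dotC. Qed.

Lemma dotNl u v : dot (- u) v = - dot u v.
Proof. by rewrite -scaleN1r dotZl mulN1r. Qed.

Lemma dotNr u v : dot u (- v) = - dot u v.
Proof. by rewrite dotC dotNl dotC. Qed.

Lemma dotvv u : dot u u = \sum_i u i 0 ^+ 2.
Proof. by apply: eq_bigr => i _; rewrite expr2. Qed.

Lemma dotvv_ge0 u : 0 <= dot u u.
Proof. by rewrite dotvv sumr_ge0// => i _; rewrite sqr_ge0. Qed.

Lemma enorm_ge0 v : 0 <= enorm v.
Proof. exact: sqrtr_ge0. Qed.

Lemma enorm2 v : enorm v ^+ 2 = dot v v.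
Proof. by rewrite /enorm -dotvv sqr_sqrtr// dotvv_ge0. Qed.

Lemma enorm_le a v : 0 <= a -> (enorm v <= a) = (dot v v <= a ^+ 2).
Proof. by move=> a0; rewrite -enorm2 ler_sqr ?nnegrE ?enorm_ge0. Qed.

Lemma le_enorm a v : 0 <= a -> (a <= enorm v) = (a ^+ 2 <= dot v v).
Proof. by move=> a0; rewrite -enorm2 ler_sqr ?nnegrE ?enorm_ge0. Qed.

Lemma enormZ a v : enorm (a *: v) = `|a| * enorm v.
Proof.
apply/eqP; rewrite -(eqrXn2 (n := 2)) ?mulr_ge0 ?enorm_ge0//.
by rewrite exprMn !enorm2 dotZl dotZr mulrA -expr2 real_normK ?num_real.
Qed.

Lemma enormN v : enorm (- v) = enorm v.
Proof. by rewrite -scaleN1r enormZ normrN1 mul1r. Qed.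

Lemma enorm0 : enorm (0 : 'cV[R]_d) = 0.
Proof. by rewrite -(scale0r 0) enormZ normr0 mul0r. Qed.

Lemma normr_entry_le_enorm v i : `|v i 0| <= enorm v.
Proof.
rewrite le_enorm// real_normK ?num_real// dotvv (bigD1 i)//= lerDl.
by apply: sumr_ge0 => j _; rewrite sqr_ge0.
Qed.

Lemma enorm_eq0 v : (enorm v == 0) = (v == 0).
Proof.
apply/eqP/eqP => [v0|->]; last exact: enorm0.
apply/matrixP => i j; rewrite ord1 mxE; apply/eqP.
by rewrite -normr_le0 -v0 normr_entry_le_enorm.
Qed.

Lemma enorm_gt0 v : (0 < enorm v) = (v != 0).
Proof. by rewrite lt_def enorm_ge0 andbT enorm_eq0. Qed.

Lemma ler_dot u v : dot u v <= enorm u * enorm v.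
Proof.
have [->|u0] := eqVneq u 0; first by rewrite dotE linear0 mul0mx mxE enorm0 mul0r.
have [->|v0] := eqVneq v 0; first by rewrite dotE mulmx0 mxE enorm0 mulr0.
have un : 0 < enorm u by rewrite enorm_gt0.
have vn : 0 < enorm v by rewrite enorm_gt0.
have := dotvv_ge0 (enorm v *: u - enorm u *: v).
rewrite dotDl !dotDr !dotNl !dotNr !dotZl !dotZr -!enorm2 (dotC v u) => h.
suff : 0 <= 2 * (enorm u * enorm v) * (enorm u * enorm v - dot u v).
  by rewrite pmulr_rge0 ?subr_ge0// !mulr_gt0.
by apply: le_trans h _; rewrite le_eqVlt; apply/orP; left; apply/eqP; ring.
Qed.

Lemma ler_normr_dot u v : `|dot u v| <= enorm u * enorm v.
Proof. by rewrite ler_norml lerNl -dotNl -[in X in X && _](enormN u) !ler_dot. Qed.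

Lemma ler_enormD u v : enorm (u + v) <= enorm u + enorm v.
Proof.
rewrite enorm_le ?addr_ge0 ?enorm_ge0// dotDl !dotDr sqrrD !enorm2 (dotC v u).
by have := ler_dot u v; lra.
Qed.

Lemma ler_enormB u v : enorm (u - v) <= enorm u + enorm v.
Proof. by rewrite -[in leRHS](enormN v) ler_enormD. Qed.

Lemma enorm_le_sum v : enorm v <= \sum_i `|v i 0|.
Proof.
have h0 : 0 <= \sum_i `|v i 0| by exact: sumr_ge0.
rewrite enorm_le// expr2 mulr_suml; apply: ler_sum => i _.
apply: le_trans (ler_norm _) _; rewrite normrM ler_wpM2l//.
by rewrite (bigD1 i)//= lerDl sumr_ge0.
Qed.

(** An upper bound for the Euclidean operator norm that is a plain sum over the entries, hence easy
    to control along the covariance updates. *)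
Definition entry_norm m n (A : 'M[R]_(m, n)) : R := \sum_i \sum_j `|A i j|.

Lemma entry_norm_ge0 m n (A : 'M[R]_(m, n)) : 0 <= entry_norm A.
Proof. by apply: sumr_ge0 => i _; apply: sumr_ge0. Qed.

Lemma enorm_mulmx_le (A : 'M[R]_d) v : enorm (A *m v) <= entry_norm A * enorm v.
Proof.
apply: le_trans (enorm_le_sum _) _; rewrite mulr_suml; apply: ler_sum => i _.
rewrite mxE; apply: le_trans (ler_norm_sum _ _ _) _.
rewrite mulr_suml; apply: ler_sum => j _.
by rewrite normrM ler_wpM2l// normr_entry_le_enorm.
Qed.

End euclidean_norm.

(** * Spectral bounds and square roots of symmetric matrices *)

Section spectral.
Context {R : realType}.

Definition qform n (M : 'M[R]_n) (v : 'cV[R]_n) : R := (v^T *m M *m v) 0 0.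

Lemma qformE n (M : 'M[R]_n) v : qform M v = dot v (M *m v).
Proof. by rewrite dotE mulmxA. Qed.

(* The weights are the squared moduli of the coordinates of v in a complex
   orthonormal basis of eigenvectors. *)
Lemma spectral_quad n (M : 'M[R]_n.+1) : M^T = M ->
  exists (X : 'I_n.+1 -> R) (c : 'cV[R]_n.+1 -> 'I_n.+1 -> R),
    [/\ forall i, eigenvalue M (X i), forall v i, 0 <= c v i,
        forall v, enorm v ^+ 2 = \sum_i c v i &
        forall v p, qform (horner_mx M p) v = \sum_i p.[X i] * c v i].
Proof.
move=> Msym.
(* Over R[i] a real symmetric matrix is hermitian, so it has a unitary diagonalization with real
   eigenvalues. *)
pose toC : {rmorphism R -> R[i]} := real_complex R.
pose MC := map_mx toC M.
have MCsym : MC \is symmetricmx.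
  by apply/is_hermitianmxP; rewrite expr0 scale1r map_mx_id// map_trmx Msym.
have MCreal : MC \is a mxOver Num.real.
  by apply/mxOverP => i j; rewrite mxE; apply/complex_realP; exists (M i j).
have MCherm := realsym_hermsym MCsym MCreal.
have := hermitian_spectral_diag_real MCherm.
have /orthomx_spectralP := hermitian_normalmx MCherm.
set U := spectralmx MC; set D := spectral_diag MC => MCE Dreal.
have Uu : U \in unitmx := spectral_unit MC.
pose X i := complex.Re (D 0 i).
have XE i : D 0 i = toC (X i).
  by rewrite /toC/= RRe_real//; exact: (mxOverP Dreal).
pose z (v : 'cV[R]_n.+1) i := (U *m map_mx toC v) i 0.
pose c v i := complex.Re (z v i) ^+ 2 + complex.Im (z v i) ^+ 2.
suff cE v p : qform (horner_mx M p) v = \sum_i p.[X i] * c v i.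
  exists X, c; split => //.
  + move=> i; rewrite eigenvalue_root_char -(fmorph_root toC) map_char_poly.
  rewrite -/MC -eigenvalue_root_char -XE.
  apply/eigenvalueP; exists (row i U).
    rewrite MCE !mulmxA -row_mul mulmxV// rowE mulmx1.
    rewrite -rowE row_diag_mx -scalemxAl -rowE//.
  apply/eqP => /(congr1 (fun r => r *m invmx U)); rewrite -row_mul mulmxV// mul0mx.
  move=> /matrixP/(_ 0 i); rewrite !mxE eqxx => /eqP; rewrite oner_eq0//.
  + by move=> v i; rewrite addr_ge0// sqr_ge0.
  + move=> v; have := cE v 1; rewrite /qform rmorph1 mulmx1 -dotE -enorm2 => ->.
    by under eq_bigr do rewrite hornerC mul1r.
apply: (@complexI R).
  rewrite -[LHS]/(toC _) -[RHS]/(toC _).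
  transitivity ((map_mx toC (v^T *m horner_mx M p *m v)) 0 0); first by rewrite [RHS]mxE.
  rewrite !map_mxM map_horner_mx -/MC MCE horner_mx_uconjC//.
  rewrite horner_mx_diag invmx_unitary ?spectral_unitarymx//.
  pose vC := map_mx toC v.
  have vCr : vC = map_mx Num.conj vC.
    by apply/matrixP => i j; rewrite !mxE; apply/esym/CrealP/complex_realP; exists (v i j).
  pose w := U *m vC.
  have -> : map_mx toC v^T = map_mx Num.conj (vC^T).
    by rewrite -!map_trmx -vCr.
  rewrite !mulmxA -map_mxM -trmx_mul -/vC -/w -!mulmxA mulmxA -/w.
  rewrite mxE rmorph_sum; apply: eq_bigr => i _.
  rewrite mul_mx_diag !mxE XE horner_map rmorphM.
  rewrite mulrAC mulrC; congr (_ * _).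
  rewrite -/(w i 0) mulrC -normCK -add_Re2_Im2.
  by rewrite /c /z mxE.
Qed.


Lemma normr_qform_le n (M : 'M[R]_n) v : `|qform M v| <= entry_norm M * enorm v ^+ 2.
Proof.
rewrite qformE; apply: le_trans (ler_normr_dot _ _) _.
by rewrite mulrC expr2 mulrA ler_wpM2r ?enorm_ge0// enorm_mulmx_le.
Qed.

Lemma sym_eigenvalueP n (M : 'M[R]_n) l : M^T = M -> eigenvalue M l ->
  exists2 v : 'cV[R]_n, v != 0 & M *m v = l *: v.
Proof.
move=> Msym /eigenvalueP[r Mr r0]; exists r^T.
  by apply: contra_neq r0 => h; rewrite -[r]trmxK h trmx0.
by rewrite -{1}Msym -trmx_mul Mr linearZ.
Qed.

Lemma qform_bounds n (M : 'M[R]_n.+1) a b : M^T = M ->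
  (forall l, eigenvalue M l -> a <= l <= b) ->
  forall v, a * enorm v ^+ 2 <= qform M v <= b * enorm v ^+ 2.
Proof.
move=> Msym ab v; have [X [c [eX c0 cS cE]]] := spectral_quad Msym.
have -> : qform M v = \sum_i X i * c v i.
  by have := cE v 'X; rewrite horner_mx_X => ->; under eq_bigr do rewrite hornerX.
rewrite cS !mulr_sumr; apply/andP; split; apply: ler_sum => i _.
  by rewrite ler_wpM2r//; case/andP: (ab _ (eX i)).
by rewrite ler_wpM2r//; case/andP: (ab _ (eX i)).
Qed.

Lemma enorm_mulmx_eigenvalue n (M : 'M[R]_n.+1) b : M^T = M -> 0 <= b ->
  (forall l, eigenvalue M l -> `|l| <= b) ->
  forall v, enorm (M *m v) <= b * enorm v.
Proof.
move=> Msym b0 hb v; have [X [c [eX c0 cS cE]]] := spectral_quad Msym.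
rewrite enorm_le ?mulr_ge0 ?enorm_ge0// exprMn.
have -> : dot (M *m v) (M *m v) = \sum_i X i ^+ 2 * c v i.
  have := cE v 'X^2; rewrite rmorphXn/= horner_mx_X expr2 => e.
  rewrite dotE trmx_mul Msym mulmxA -[_ *m M *m M]mulmxA [LHS]e.
  by under eq_bigr do rewrite hornerXn.
rewrite cS mulr_sumr; apply: ler_sum => i _; rewrite ler_wpM2r//.
by rewrite -(real_normK (num_real (X i))) ler_sqr ?nnegrE// hb.
Qed.

Lemma dot_mulmx_sym n (A : 'M[R]_n) u w : A^T = A -> dot u (A *m w) = dot (A *m u) w.
Proof. by move=> As; rewrite !dotE trmx_mul As mulmxA. Qed.

(** Polarization: expanding the form at u + v leaves 2 [dot u (M *m v)] = 0, and on basis vectors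
    this is an entry of M. *)
Lemma sym_qform0 n (M : 'M[R]_n) : M^T = M -> (forall v, qform M v = 0) -> M = 0.
Proof.
move=> Msym M0.
suff h (u v : 'cV[R]_n) : dot u (M *m v) = 0.
  apply/matrixP => i j; have := h (delta_mx i 0) (delta_mx j 0).
  by rewrite dotE trmx_delta mulmxA -rowE -colE !mxE.
have := M0 (u + v); rewrite qformE mulmxDr !dotDl !dotDr -!qformE !M0.
by rewrite [X in _ + (X + _)](dot_mulmx_sym _ _ Msym) (dotC (M *m v)); lra.
Qed.

(** Newton interpolation: the product over the earlier nodes corrects the value at the new one. It
    serves to write the square root of a matrix as a polynomial in that matrix. *)
Lemma poly_interpolation (xs : seq R) (g : R -> R) :
  exists p : {poly R}, forall x, x \in xs -> p.[x] = g x.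
Proof.
elim: xs => [|x xs [p ph]]; first by exists 0.
have [xin|xnin] := boolP (x \in xs).
  by exists p => y; rewrite inE => /orP[/eqP ->|]; exact: ph.
pose w := \prod_(y <- xs) ('X - y%:P).
have wx : w.[x] != 0 by rewrite -rootE root_prod_XsubC.
exists (p + ((g x - p.[x]) / w.[x]) *: w) => y; rewrite inE !hornerE.
move=> /orP[/eqP ->|yin]; first by rewrite divfK// addrC subrK.
have -> : w.[y] = 0 by apply/eqP; rewrite -rootE root_prod_XsubC.
by rewrite mulr0 addr0 ph.
Qed.

Lemma horner_mx_sym n (M : 'M[R]_n.+1) p : M^T = M -> (horner_mx M p)^T = horner_mx M p.
Proof.
move=> Msym; elim/poly_ind: p => [|p c IH]; first by rewrite rmorph0 trmx0.
rewrite rmorphD rmorphM/= horner_mx_X horner_mx_C linearD/= tr_scalar_mx.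
congr (_ + _); rewrite trmx_mul IH Msym.
by have := congr1 (horner_mx M) (mulrC 'X p); rewrite !rmorphM/= horner_mx_X.
Qed.

Lemma sym_posdef_qform n (M : 'M[R]_n) v : sym_posdef M -> v != 0 -> 0 < qform M v.
Proof. by move=> [_]; exact. Qed.

Lemma sym_posdef_eigenvalue n (M : 'M[R]_n) l : sym_posdef M -> eigenvalue M l -> 0 < l.
Proof.
move=> Mp /(sym_eigenvalueP (proj1 Mp))[v v0 Mv].
have := sym_posdef_qform Mp v0; rewrite qformE Mv dotZr -enorm2 pmulr_lgt0//.
by rewrite exprn_gt0// enorm_gt0.
Qed.

(** The root is p(M), where p interpolates the square root at the eigenvalues. A polynomial in M is
    symmetric, and [spectral_quad] reads its quadratic form off the values at the eigenvalues, so
    positivity and p(M)^2 = M are checked there. *)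
Lemma sqrtmx_exists n (M : 'M[R]_n.+1) : sym_posdef M ->
  exists L, sym_posdef L /\ L *m L = M.
Proof.
move=> Mp; have Msym := proj1 Mp.
have [X [c [eX c0 cS cE]]] := spectral_quad Msym.
have X0 i : 0 < X i := sym_posdef_eigenvalue Mp (eX i).
have [p pE] := poly_interpolation [seq X i | i <- enum 'I_n.+1] Num.sqrt.
have pX i : p.[X i] = Num.sqrt (X i).
  by apply: pE; apply/mapP; exists i => //; rewrite mem_enum.
exists (horner_mx M p); split.
  split; first exact: horner_mx_sym.
  move=> v v0; rewrite -/(qform _ _) cE.
  have pc0 i : true -> 0 <= p.[X i] * c v i by rewrite pX mulr_ge0// sqrtr_ge0.
  rewrite lt_def (sumr_ge0 _ pc0) andbT.
  apply: contraNneq v0 => /(psumr_eq0P pc0) h.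
  rewrite -enorm_eq0 -sqrf_eq0 cS big1// => i _; have /eqP := h i isT.
  by rewrite mulf_eq0 pX gt_eqF ?sqrtr_gt0//= => /eqP.
apply/eqP; rewrite -subr_eq0; apply/eqP; apply: sym_qform0.
  by rewrite linearB/= trmx_mul horner_mx_sym// Msym.
move=> v.
have -> : horner_mx M p *m horner_mx M p - M = horner_mx M (p * p - 'X).
  by rewrite rmorphB rmorphM/= horner_mx_X.
rewrite cE big1// => i _; rewrite !hornerE pX -expr2 sqr_sqrtr ?subrr ?mul0r//.
exact: ltW.
Qed.

Lemma sqrtmxP n (M : 'M[R]_n.+1) : sym_posdef M ->
  sym_posdef (sqrtmx M) /\ sqrtmx M *m sqrtmx M = M.
Proof.
by move=> /sqrtmx_exists[L hL]; rewrite /sqrtmx; case: xgetP => [_ _ //|/(_ L)].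
Qed.

Lemma sym_mulmx_unit n (L : 'M[R]_n) a : 0 < a ->
  (forall v, a * enorm v <= enorm (L *m v)) -> L \in unitmx.
Proof.
move=> a0 aL; rewrite -unitmx_tr -row_free_unit -kermx_eq0; apply/rowV0P => r.
move=> /sub_kermxP/(congr1 trmx); rewrite trmx_mul trmxK trmx0 => Lr.
apply: trmx_inj; rewrite trmx0; apply/eqP; rewrite -enorm_eq0 eq_le enorm_ge0 andbT.
by have := aL r^T; rewrite Lr enorm0 pmulr_rle0.
Qed.

(* For an eigenvector v of L - L' with eigenvalue l,
   qform (L L - L' L') v = l (qform L v + qform L' v). *)
Lemma sqrt_lipschitz n (L L' : 'M[R]_n.+1) a : L^T = L -> L'^T = L' -> 0 < a ->
  (forall v, a * enorm v ^+ 2 <= qform L v) ->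
  (forall v, a * enorm v ^+ 2 <= qform L' v) ->
  forall v, enorm ((L - L') *m v) <=
    entry_norm (L *m L - L' *m L') / (2 * a) * enorm v.
Proof.
(* [L - L'] is symmetric, so a bound on its eigenvalues bounds its norm. *)
move=> Ls Ls' a0 aL aL'; apply: enorm_mulmx_eigenvalue.
- by rewrite linearB/= Ls Ls'.
- by rewrite divr_ge0 ?entry_norm_ge0// mulr_ge0// ltW.
move=> l /sym_eigenvalueP[|v v0 Dv]; first by rewrite linearB/= Ls Ls'.
have vn : 0 < enorm v ^+ 2 by rewrite exprn_gt0// enorm_gt0.
have Dv' : L *m v = L' *m v + l *: v by rewrite -Dv mulmxBl addrC subrK.
have e : qform (L *m L - L' *m L') v = l * (qform L v + qform L' v).
  rewrite !qformE mulmxBl dotDr dotNr -!mulmxA (dot_mulmx_sym v (L *m v) Ls) (dot_mulmx_sym v (L' *m v) Ls').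
  rewrite Dv' !dotDl !dotDr !dotZl !dotZr -!enorm2 (dotC (L' *m v) v).
  by ring.
have := normr_qform_le (L *m L - L' *m L') v.
rewrite e normrM [X in _ * X]ger0_norm; last first.
  by rewrite addr_ge0//; [apply: le_trans (aL v)|apply: le_trans (aL' v)];
    rewrite mulr_ge0// ltW.
move=> h; rewrite ler_pdivlMr ?mulr_gt0//.
rewrite -(ler_pM2r vn); apply: le_trans h.
rewrite -mulrA ler_wpM2l//.
by have := aL v; have := aL' v; lra.
Qed.

Section sqrt_bounds.
Context n (M : 'M[R]_n.+1) (a b : R).
Hypotheses (Msym : M^T = M) (a0 : 0 < a)
  (ab : forall v, a * enorm v ^+ 2 <= qform M v <= b * enorm v ^+ 2).

Lemma qform_bounds_posdef : sym_posdef M.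
Proof.
split=> // v v0; rewrite -/(qform M v).
have /andP[+ _] := ab v; apply: lt_le_trans.
by rewrite mulr_gt0// exprn_gt0// enorm_gt0.
Qed.

Let L := sqrtmx M.
Let Lp : sym_posdef L := proj1 (sqrtmxP qform_bounds_posdef).
Let LL : L *m L = M := proj2 (sqrtmxP qform_bounds_posdef).

Let enormL v : enorm (L *m v) ^+ 2 = qform M v.
Proof.
by rewrite enorm2 qformE -LL !dotE trmx_mul (proj1 Lp) !mulmxA.
Qed.

Lemma sqrtmx_sym : (sqrtmx M)^T = sqrtmx M.
Proof. exact: (proj1 Lp). Qed.

Lemma sqrtmx_enorm_ge v : Num.sqrt a * enorm v <= enorm (sqrtmx M *m v).
Proof.
rewrite -ler_sqr ?nnegrE ?mulr_ge0 ?enorm_ge0 ?sqrtr_ge0//.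
by rewrite exprMn (sqr_sqrtr (ltW a0)) -/L enormL; case/andP: (ab v).
Qed.

Lemma sqrtmx_enorm_le v : enorm (sqrtmx M *m v) <= Num.sqrt b * enorm v.
Proof.
(* [Num.sqrt b] is 0 for negative b; this case is excluded unless v = 0, since the bounds at a
   nonzero v force 0 <= a <= b. *)
have b0 : 0 <= b \/ enorm v = 0.
  have [v0|v0] := eqVneq v 0; first by right; rewrite v0 enorm0.
  left; have vn : 0 < enorm v ^+ 2 by rewrite exprn_gt0// enorm_gt0.
  have /andP[h1 h2] := ab v.
  by rewrite -(ler_pM2r vn) mul0r; apply: le_trans h2; apply: le_trans h1; rewrite mulr_ge0// ltW.
case: b0 => [b0|/eqP]; last first.
  by rewrite enorm_eq0 => /eqP ->; rewrite mulmx0 enorm0 mulr0.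
rewrite -ler_sqr ?nnegrE ?mulr_ge0 ?enorm_ge0 ?sqrtr_ge0//.
by rewrite exprMn (sqr_sqrtr b0) -/L enormL; case/andP: (ab v).
Qed.

(** An eigenvector u of the positive definite root, with eigenvalue l, satisfies |L u| = l |u|. The
    two norm bounds thus pin l between sqrt a and sqrt b, and bounds on eigenvalues are bounds on
    the form. *)
Lemma sqrtmx_qform_ge v : Num.sqrt a * enorm v ^+ 2 <= qform (sqrtmx M) v.
Proof.
suff /(_ v)/andP[] : forall v, Num.sqrt a * enorm v ^+ 2 <= qform L v <=
   (Num.sqrt b) * enorm v ^+ 2 by [].
apply: qform_bounds => [|l eL]; first exact: (proj1 Lp).
have l0 := sym_posdef_eigenvalue Lp eL.
have [u u0 Lu] := sym_eigenvalueP (proj1 Lp) eL.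
have un : 0 < enorm u by rewrite enorm_gt0.
have := sqrtmx_enorm_ge u; have := sqrtmx_enorm_le u.
by rewrite -/L Lu enormZ (gtr0_norm l0) !ler_pM2r// => -> ->.
Qed.

End sqrt_bounds.

Lemma sqrtmx_lipschitz n (M M' : 'M[R]_n.+1) a b : 0 < a -> M^T = M -> M'^T = M' ->
  (forall v, a * enorm v ^+ 2 <= qform M v <= b * enorm v ^+ 2) ->
  (forall v, a * enorm v ^+ 2 <= qform M' v <= b * enorm v ^+ 2) ->
  forall v, enorm ((sqrtmx M - sqrtmx M') *m v) <=
    entry_norm (M - M') / (2 * Num.sqrt a) * enorm v.
Proof.
move=> a0 Ms Ms' ab ab' v.
have := sqrt_lipschitz (sqrtmx_sym Ms a0 ab) (sqrtmx_sym Ms' a0 ab') _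
  (sqrtmx_qform_ge Ms a0 ab) (sqrtmx_qform_ge Ms' a0 ab') v.
rewrite sqrtr_gt0 (proj2 (sqrtmxP (qform_bounds_posdef Ms a0 ab))).
by rewrite (proj2 (sqrtmxP (qform_bounds_posdef Ms' a0 ab'))); exact.
Qed.

Lemma sym_posdef_bounds n (M : 'M[R]_n.+1) : sym_posdef M ->
  exists a b, 0 < a /\
    forall v, a * enorm v ^+ 2 <= qform M v <= b * enorm v ^+ 2.
Proof.
move=> Mp; have Msym := proj1 Mp.
have [X [c [eX c0 cS cE]]] := spectral_quad Msym.
have X0 i : 0 < X i := sym_posdef_eigenvalue Mp (eX i).
have s0 : 0 < \sum_i (X i)^-1.
  rewrite (bigD1 ord0)//= ltr_wpDr ?invr_gt0//.
  by apply: sumr_ge0 => i _; rewrite invr_ge0 ltW.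
(* Sums replace the extreme eigenvalues: each X i is at most the sum of all, and each 1 / X i is at
   most the sum of the inverses. *)
exists (\sum_i (X i)^-1)^-1, (\sum_i X i); split; first by rewrite invr_gt0.
move=> v; have -> : qform M v = \sum_i X i * c v i.
  by have := cE v 'X; rewrite horner_mx_X => ->; under eq_bigr do rewrite hornerX.
rewrite cS !mulr_sumr; apply/andP; split; apply: ler_sum => i _; rewrite ler_wpM2r//.
  rewrite -[leRHS]invrK lef_pV2 ?posrE ?invr_gt0//.
  by rewrite (bigD1 i)//= lerDl sumr_ge0// => j _; rewrite invr_ge0 ltW.
by rewrite (bigD1 i)//= lerDl sumr_ge0// => j _; rewrite ltW.
Qed.

End spectral.

(** * Linear changes of variables and balls *)

Section linear_change_of_variables.
Context {R : realType} {d : nat}.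
Implicit Types (L : 'M[R]_d) (A : set 'cV[R]_d).

Lemma ge0_integral_lin L (c : R) : 0 <= c ->
  (forall A, measurable A ->
    lebesgue_cV d ((fun u => L *m u) @^-1` A) = (c%:E * lebesgue_cV d A)%E) ->
  forall f : 'cV[R]_d -> \bar R, measurable_fun setT f -> (forall x, 0 <= f x)%E ->
  (\int[lebesgue_cV d]_x f (L *m x)%R = c%:E * \int[lebesgue_cV d]_x f x)%E.
Proof.
move=> c0 hc f mf f0.
transitivity (\int[pushm (lebesgue_cV d) (measurable_mulmx L)]_x f x)%E.
  by rewrite (@ge0_integral_pushforward _ _ _ _ R _ (measurable_mulmx L) (lebesgue_cV d) setT f).
rewrite -(ge0_integral_mscale (lebesgue_cV d) measurableT (NngNum c0))//.
by apply: (@eq_measure_integral _ _ _ setT) => A mA _; exact: hc.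
Qed.

Lemma measurable_enorm : measurable_fun setT (@enorm R d).
Proof.
have -> : @enorm R d = Num.sqrt \o (fun v => \sum_i v i 0 ^+ 2) by [].
apply: measurableT_comp; first exact: continuous_measurable_fun (@sqrt_continuous R).
apply: measurable_sum => i; apply: measurable_funX; exact: measurable_entry.
Qed.

Definition eball (r : R) : set 'cV[R]_d := [set v | enorm v <= r].

Lemma measurable_eball r : measurable (eball r).
Proof.
rewrite (_ : eball r = (@enorm R d) @^-1` `]-oo, r]); last first.
  by apply/seteqP; split => v /=; rewrite in_itv.
by rewrite -[X in measurable X]setTI; exact: measurable_enorm.
Qed.

Lemma lebesgue_eball_fin r : (lebesgue_cV d (eball r) < +oo)%E.
Proof.
apply: (@le_lt_trans _ _ (lebesgue_cV d (cube d `|r|))); last first.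
  by rewrite lebesgue_cube// ltry.
apply: le_measure; rewrite ?inE; [exact: measurable_eball|exact: measurable_cube|].
move=> v /= vr; apply/cubeP => i; apply: le_trans (normr_entry_le_enorm _ _) _.
by apply: le_trans vr _; exact: ler_norm.
Qed.

Lemma lebesgue_eball_gt0 r : 0 < r -> (0 < lebesgue_cV d (eball r))%E.
Proof.
move=> r0; pose s := r / d.+1%:R.
have s0 : 0 < s by rewrite divr_gt0.
apply: (@lt_le_trans _ _ (lebesgue_cV d (cube d s))).
  by rewrite lebesgue_cube ?ltW// lte_fin exprn_gt0// mulr_gt0.
apply: le_measure; rewrite ?inE; [exact: measurable_cube|exact: measurable_eball|].
move=> v /cubeP vs; rewrite /eball /=; apply: le_trans (enorm_le_sum _) _.
apply: le_trans (ler_sum _ (fun i _ => vs i)) _.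
rewrite sumr_const card_ord -mulr_natr /s -mulrA ler_piMr ?ltW// mulrC.
by rewrite ltr_pdivrMr// mul1r ltr_nat.
Qed.

(** The factor provided by [lebesgue_linP] is found by testing on the unit cube, whose preimage is
    the cube of half-width 1 / s. *)
Lemma lebesgue_scale (s : R) A : 0 < s -> measurable A ->
  lebesgue_cV d ((fun u => s *: u) @^-1` A) = ((s ^- d)%:E * lebesgue_cV d A)%E.
Proof.
move=> s0 mA.
have us : (s%:M : 'M[R]_d) \in unitmx by rewrite unitmxE det_scalar unitrX// unitfE gt_eqF.
have [c c0 hc] := lebesgue_linP us.
have e B : (fun u : 'cV[R]_d => s%:M *m u) @^-1` B = (fun u => s *: u) @^-1` B.
  by apply/seteqP; split => u /=; rewrite mul_scalar_mx.
rewrite -e hc//; congr (_%:E * _)%E.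
have mc : measurable (cube d (1 : R)) by exact: measurable_cube.
have := hc _ mc; rewrite e.
rewrite (_ : _ @^-1` _ = cube d s^-1); last first.
  apply/seteqP; split => u /cubeP h; apply/cubeP => i; have := h i.
    by rewrite mxE normrM gtr0_norm// mulrC -ler_pdivlMr// mul1r.
  by rewrite mxE normrM gtr0_norm// [in X in _ -> X]mulrC -ler_pdivlMr// mul1r.
rewrite !lebesgue_cube ?invr_ge0 ?ltW// -EFinM => -[].
rewrite mulr1 exprMn mulrC => /(congr1 (fun x => x / 2 ^+ d)).
by rewrite mulfK ?mulfK ?expf_neq0// exprVn.
Qed.

(* Comparison of the image of a ball with smaller balls bounds the Jacobian. *)
Lemma lin_factor_ge L (c b : R) : 0 <= c -> 0 < b ->
  (forall A, measurable A ->
    lebesgue_cV d ((fun u => L *m u) @^-1` A) = (c%:E * lebesgue_cV d A)%E) ->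
  (forall v, enorm (L *m v) <= b * enorm v) -> b ^- d <= c.
Proof.
move=> c0 b0 hc Lb.
have h : ((b ^- d)%:E * lebesgue_cV d (eball 1) <= c%:E * lebesgue_cV d (eball 1))%E.
  rewrite -lebesgue_scale//; last exact: measurable_eball.
  rewrite -hc; last exact: measurable_eball.
  apply: le_measure; rewrite ?inE.
  - rewrite -[X in measurable X]setTI; apply: measurable_mxZ => //; exact: measurable_eball.
  - rewrite -[X in measurable X]setTI; apply: measurable_mulmx => //; exact: measurable_eball.
  - move=> v; rewrite /eball/= enormZ gtr0_norm// => h; exact: le_trans (Lb v) h.
have f1 := lebesgue_eball_fin 1; have p1 := lebesgue_eball_gt0 ltr01.
have fn : lebesgue_cV d (eball 1) \is a fin_num by rewrite ge0_fin_numE.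
move: h p1; rewrite -(fineK fn) -!EFinM lee_fin lte_fin => h p1.
by rewrite -(ler_pM2r p1).
Qed.

Lemma invmx_enorm_le L a : 0 < a -> (forall v, a * enorm v <= enorm (L *m v)) ->
  L \in unitmx -> forall v, enorm (invmx L *m v) <= a^-1 * enorm v.
Proof.
move=> a0 aL uL v; rewrite mulrC ler_pdivlMr// mulrC.
by apply: le_trans (aL _) _; rewrite mulKVmx.
Qed.

End linear_change_of_variables.

(** Equivalent to (1 - n e) (1 + e)^n <= 1, which follows by induction from (1 - (n + 1) e) (1 + e)
    <= 1 - n e. *)
Lemma bernoulli_inv {R : realType} (e : R) n : 0 <= e -> 1 - n%:R * e <= (1 + e) ^- n.
Proof.
move=> e0; have p : 0 < (1 + e) ^+ n by rewrite exprn_gt0// ltr_wpDr.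
rewrite -[leRHS]mul1r ler_pdivlMr//; elim: n {p} => [|n IH].
  by rewrite expr0 mul0r subr0 mulr1.
apply: le_trans IH; rewrite exprS mulrA ler_wpM2r ?exprn_ge0 ?addr_ge0//.
have := mulr_ge0 e0 e0; have n0 : 0 <= n%:R :> R by [].
move=> ee; have := mulr_ge0 n0 ee; rewrite -[n.+1]addn1 natrD.
by move=> h; nra.
Qed.

(** * Metropolis kernels *)

Lemma measurable_invr_ge0 {R : realType} {dT} {T : measurableType dT} (f : T -> R) :
  measurable_fun setT f -> (forall x, 0 <= f x) -> measurable_fun setT (fun x => (f x)^-1).
Proof.
move=> mf f0; rewrite (_ : (fun x => _) = (@powR R ^~ (-1)) \o f); last first.
  by apply/funext => x /=; rewrite powR_inv1.
by apply: measurableT_comp => //; exact: measurable_powR.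
Qed.

Section metropolis_kernel.
Context {R : realType} {d : nat}.
Variables (target : 'cV[R]_d -> R).

Definition acc (x y : 'cV[R]_d) : R := Num.min 1 (target y / target x).

Hypotheses (mtarget : measurable_fun setT target) (target_ge0 : forall x, 0 <= target x).

Lemma acc_ge0 x y : 0 <= acc x y.
Proof. by rewrite /acc le_min ler01 divr_ge0. Qed.

Lemma acc_le1 x y : acc x y <= 1.
Proof. by rewrite /acc ge_min lexx. Qed.

Lemma acc_out x y : target y = 0 -> acc x y = 0.
Proof. by move=> ty; rewrite /acc ty mul0r minElt ltr10. Qed.

Lemma bmf_acc : bmf (fun p : 'cV[R]_d * 'cV[R]_d => acc p.1 p.2).
Proof.
apply: (bmf_ge0 (M := 1)) => [|p]; last by rewrite acc_ge0 acc_le1.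
apply: measurable_minr => //; apply: measurable_funM.
  by apply: measurableT_comp => //; exact: measurable_snd.
by apply: measurable_invr_ge0 => //; apply: measurableT_comp => //; exact: measurable_fst.
Qed.

(** The right-hand side is symmetric in x and y, which is detailed balance. If [target x = 0], both
    sides vanish because [target y] is nonnegative. *)
Lemma target_acc x y : target x * acc x y = Num.min (target x) (target y).
Proof.
have [t0|t0] := eqVneq (target x) 0.
  by rewrite t0 mul0r minEle target_ge0.
have tp : 0 < target x by rewrite lt_def t0 target_ge0.
rewrite /acc !minElt ltr_pdivlMr// mul1r.
by case: ifPn; [rewrite mulr1|rewrite mulrCA divff// mulr1].
Qed.

Variable Q : probability 'cV[R]_d R.

(** The kernel acts on functions of the pair (L, x) and leaves L fixed; joint measurability is
    needed later, when L is itself a function of the past. The uniform variable is already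
    integrated out, [acc] being the probability of acceptance. *)
Definition mh_integrand (h : 'M[R]_d * 'cV[R]_d -> R)
    (p : ('M[R]_d * 'cV[R]_d) * 'cV[R]_d) : R :=
  let y := p.1.2 + p.1.1 *m p.2 in
  (1 - acc p.1.2 y) * h p.1 + acc p.1.2 y * h (p.1.1, y).

Definition mh (h : 'M[R]_d * 'cV[R]_d -> R) (p : 'M[R]_d * 'cV[R]_d) : R :=
  \int[Q]_w mh_integrand h (p, w).

Lemma measurable_proposal : measurable_fun setT
  (fun p : ('M[R]_d * 'cV[R]_d) * 'cV[R]_d => p.1.2 + p.1.1 *m p.2).
Proof.
apply: measurable_mxD.
  exact: (measurableT_comp measurable_snd measurable_fst).
apply: measurable_mxM; last exact: measurable_snd.
exact: (measurableT_comp measurable_fst measurable_fst).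
Qed.

Let bmf_acc_prop : bmf (fun p : ('M[R]_d * 'cV[R]_d) * 'cV[R]_d =>
  acc p.1.2 (p.1.2 + p.1.1 *m p.2)).
Proof.
apply: (bmf_comp (h := fun p : ('M[R]_d * 'cV[R]_d) * 'cV[R]_d => (p.1.2, p.1.2 + p.1.1 *m p.2))) bmf_acc.
apply: measurable_fun_pair; last exact: measurable_proposal.
exact: (measurableT_comp measurable_snd measurable_fst).
Qed.

Lemma bmf_mh_integrand h : bmf h -> bmf (mh_integrand h).
Proof.
move=> bh; apply: bmfD; apply: bmfM.
- by apply: bmfB => //; exact: bmf_cst.
- exact: (bmf_comp measurable_fst bh).
- exact: bmf_acc_prop.
- apply: (bmf_comp (h := fun p : ('M[R]_d * 'cV[R]_d) * 'cV[R]_d => (p.1.1, p.1.2 + p.1.1 *m p.2))) bh.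
  apply: measurable_fun_pair; last exact: measurable_proposal.
  exact: (measurableT_comp measurable_fst measurable_fst).
Qed.

(* The Dirac measure fills an argument of [bmf_fubini1] that plays no role. *)
Lemma bmf_mh h : bmf h -> bmf (mh h).
Proof. by move=> bh; apply: (bmf_fubini1 (\d_((0 : 'M[R]_d), (0 : 'cV[R]_d))) Q (bmf_mh_integrand bh)). Qed.

Lemma bmf_mh_integrand1 h p : bmf h -> bmf (fun w => mh_integrand h (p, w)).
Proof. by move=> bh; exact: (bmf_pair1 (bmf_mh_integrand bh)). Qed.

Lemma mh_integrand_bounds h (lo hi : R) p : (forall p, lo <= h p <= hi) ->
  lo <= mh_integrand h p <= hi.
Proof.
move=> hb; rewrite /mh_integrand; set y := p.1.2 + p.1.1 *m p.2.
have a0 := acc_ge0 p.1.2 y; have a1 := acc_le1 p.1.2 y.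
have /andP[h1 h2] := hb p.1; have /andP[h3 h4] := hb (p.1.1, y).
rewrite (_ : _ + _ = h p.1 + acc p.1.2 y * (h (p.1.1, y) - h p.1)); last by ring.
move: (acc p.1.2 y) (h p.1) (h (p.1.1, y)) a0 a1 h1 h2 h3 h4 => a u v a0 a1 u1 u2 v1 v2.
by apply/andP; split; nra.
Qed.

Lemma mh_bounds h (lo hi : R) p : bmf h -> (forall p, lo <= h p <= hi) ->
  lo <= mh h p <= hi.
Proof.
move=> bh hb; have hb' w := mh_integrand_bounds (p, w) hb.
apply/andP; split.
  rewrite -(ER_cst Q lo); apply: ER_le; [exact: bmf_cst|exact: bmf_mh_integrand1|].
  by move=> w; have /andP[] := hb' w.
rewrite -(ER_cst Q hi); apply: ER_le; [exact: bmf_mh_integrand1|exact: bmf_cst|].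
by move=> w; have /andP[] := hb' w.
Qed.

Lemma mh_sub h B p : bmf h -> mh (fun p => B - h p) p = B - mh h p.
Proof.
move=> bh; rewrite /mh -[in RHS](ER_cst Q B) -ERB; [|exact: bmf_cst|exact: bmf_mh_integrand1].
by apply: eq_Rintegral => w _; rewrite /mh_integrand/=; ring.
Qed.

Lemma mhD h g p : bmf h -> bmf g -> mh (fun p => h p + g p) p = mh h p + mh g p.
Proof.
move=> bh bg; rewrite /mh -ERD; [|exact: bmf_mh_integrand1|exact: bmf_mh_integrand1].
by apply: eq_Rintegral => w _; rewrite /mh_integrand/=; ring.
Qed.

Fixpoint mh_iter (f : 'cV[R]_d -> R) (j : nat) : 'M[R]_d * 'cV[R]_d -> R :=
  if j is j'.+1 then mh (mh_iter f j') else fun p => f p.2.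

Lemma bmf_mh_iter f j : bmf f -> bmf (mh_iter f j).
Proof.
move=> bf; elim: j => [|j IH] /=; last exact: bmf_mh.
exact: (bmf_comp measurable_snd bf).
Qed.

Lemma mh_iter_bounds f (lo hi : R) j p : bmf f -> (forall x, lo <= f x <= hi) ->
  lo <= mh_iter f j p <= hi.
Proof.
move=> bf fb; elim: j p => [|j IH] p /=; first exact: fb.
by apply: mh_bounds => //; exact: bmf_mh_iter.
Qed.

End metropolis_kernel.

(** * Invariance, minorization and ergodicity of the Metropolis kernels *)

Section ergodicity.
Context {R : realType} {d : nat}.
Variables (target q : 'cV[R]_d -> R) (qhat : R -> R) (Q Pi : probability 'cV[R]_d R).
Variables (m M D : R).
Hypotheses (mtarget : measurable_fun setT target) (target_ge0 : forall x, 0 <= target x)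
  (PiE : forall A, measurable A -> Pi A = (\int[lebesgue_cV d]_(x in A) (target x)%:E)%E)
  (mq : measurable_fun setT q) (q_ge0 : forall x, 0 <= q x)
  (QE : forall A, measurable A -> Q A = (\int[lebesgue_cV d]_(x in A) (q x)%:E)%E)
  (qE : forall z, q z = qhat (enorm z))
  (qhat_gt0 : forall x, 0 <= x -> 0 < qhat x)
  (qhat_decr : forall x y, 0 <= x -> x <= y -> qhat y <= qhat x)
  (m_gt0 : 0 < m) (target_bounds : forall x, target x != 0 -> m <= target x <= M)
  (diam_le : forall x y, target x != 0 -> target y != 0 -> enorm (x - y) <= D).
Local Notation acc := (acc target).
Local Notation lam := (lebesgue_cV d).
Implicit Types (G : 'cV[R]_d -> R).

Lemma ER_Q G : bmf G -> (forall x, 0 <= G x) ->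
  ((\int[Q]_x G x)%R%:E = \int[lam]_x ((G x)%:E * (q x)%:E))%E.
Proof.
move=> bG G0; rewrite -RintegralE//; apply: (ge0_integral_density mq q_ge0 QE).
  by apply/measurable_EFinP; exact: bmf_meas.
by move=> x; rewrite lee_fin.
Qed.

Lemma ER_Pi G : bmf G -> (forall x, 0 <= G x) ->
  ((\int[Pi]_x G x)%R%:E = \int[lam]_x ((G x)%:E * (target x)%:E))%E.
Proof.
move=> bG G0; rewrite -RintegralE//; apply: (ge0_integral_density mtarget target_ge0 PiE).
  by apply/measurable_EFinP; exact: bmf_meas.
by move=> x; rewrite lee_fin.
Qed.

Lemma ge0_integralN (f : 'cV[R]_d -> \bar R) : measurable_fun setT f -> (forall x, 0 <= f x)%E ->
  (\int[lam]_x f (- x)%R = \int[lam]_x f x)%E.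
Proof.
move=> mf f0.
rewrite -(@ge0_integral_pushforward _ _ _ _ R _ (@measurable_oppv R d) lam setT f)//.
by apply: (@eq_measure_integral _ _ _ setT lam (pushm _ (@measurable_oppv R d))) => A mA _; exact: lebesgue_cVN.
Qed.

Lemma ER_Q_sym G : bmf G -> (forall x, 0 <= G x) -> \int[Q]_w G (- w) = \int[Q]_w G w.
Proof.
move=> bG G0; apply: EFin_inj; rewrite !ER_Q//; last first.
  by apply: (bmf_comp (h := fun w : 'cV[R]_d => - w)) bG; exact: measurable_oppv.
rewrite -[RHS]ge0_integralN.
- by apply: eq_integral => x _; rewrite !qE enormN.
- by apply: emeasurable_funM; apply/measurable_EFinP => //; exact: bmf_meas.
- by move=> x; rewrite mule_ge0// lee_fin.
Qed.

Let bmf_shift G (v : 'cV[R]_d) : bmf G -> bmf (fun x : 'cV[R]_d => G (x + v)).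
Proof. by move=> bG; apply: (bmf_comp (h := fun x : 'cV[R]_d => x + v)) bG; exact: measurable_addv. Qed.

Let bmf_acc_shift (v : 'cV[R]_d) : bmf (fun x : 'cV[R]_d => acc x (x + v)).
Proof.
apply: (bmf_comp (h := fun x : 'cV[R]_d => (x, x + v))) (bmf_acc mtarget target_ge0).
by apply: measurable_fun_pair => //; exact: measurable_addv.
Qed.

(* Detailed balance: [target x * acc x y] is symmetric in x and y. *)
Lemma detailed_balance h v : bmf h -> (forall x, 0 <= h x) ->
  \int[Pi]_x (acc x (x + v) * h (x + v)) = \int[Pi]_x (acc x (x - v) * h x).
Proof.
move=> bh h0; apply: EFin_inj; rewrite !ER_Pi.
- rewrite -(ge0_integralD_translate (- v)); last 2 first.
  + apply: emeasurable_funM; apply/measurable_EFinP => //.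
    by apply: bmf_meas; apply: bmfM; [exact: bmf_acc_shift|exact: bmf_shift].
  + by move=> x; rewrite mule_ge0// lee_fin// mulr_ge0 ?acc_ge0.
  apply: eq_integral => x _; rewrite -!EFinM; congr (_%:E).
  have e : target (x - v) * acc (x - v) x = target x * acc x (x - v).
    by rewrite !target_acc// minC.
  by rewrite subrK mulrAC [acc (x - v) x * _]mulrC e [in RHS]mulrAC [in RHS](mulrC (acc _ _)).
- by apply: bmfM => //; exact: bmf_acc_shift.
- by move=> x; rewrite mulr_ge0 ?acc_ge0.
- by apply: bmfM; [exact: bmf_acc_shift|exact: bmf_shift].
- by move=> x; rewrite mulr_ge0 ?acc_ge0.
Qed.

(** Integrate over x first, for a fixed step w: detailed balance matches the gain along L w with the
    loss along - L w, and Q is symmetric. *)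
Lemma mh_invariant h L : bmf h -> (forall p, 0 <= h p) ->
  \int[Pi]_x mh target Q h (L, x) = \int[Pi]_x h (L, x).
Proof.
move=> bh h0.
(* [f] is the gain from arriving at x + L w, and [g] below is the loss from leaving x. *)
pose f (p : 'cV[R]_d * 'cV[R]_d) := acc p.1 (p.1 + L *m p.2) * h (L, p.1 + L *m p.2).
pose g (p : 'cV[R]_d * 'cV[R]_d) := acc p.1 (p.1 + L *m p.2) * h (L, p.1).
have mp : measurable_fun setT (fun p : 'cV[R]_d * 'cV[R]_d => p.1 + L *m p.2).
  apply: measurable_mxD; first exact: measurable_fst.
  by apply: measurable_mxM; [exact: measurable_cst|exact: measurable_snd].
have ba : bmf (fun p : 'cV[R]_d * 'cV[R]_d => acc p.1 (p.1 + L *m p.2)).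
  apply: (bmf_comp (h := fun p : 'cV[R]_d * 'cV[R]_d => (p.1, p.1 + L *m p.2))) (bmf_acc mtarget target_ge0).
  by apply: measurable_fun_pair => //; exact: measurable_fst.
have bhL : bmf (fun x => h (L, x)) := bmf_pair1 bh L.
have bf : bmf f.
  by apply: bmfM => //; exact: (bmf_comp mp bhL).
have bg : bmf g.
  by apply: bmfM => //; exact: (bmf_comp measurable_fst bhL).
have mhE x : mh target Q h (L, x) = h (L, x) + (\int[Q]_w f (x, w) - \int[Q]_w g (x, w)).
  rewrite -ERB; [|exact: bmf_pair1 bf x|exact: bmf_pair1 bg x].
  rewrite -[X in _ = X + _](ER_cst Q) -ERD; [|exact: bmf_cst|]; last first.
    by apply: bmfB; [exact: bmf_pair1 bf x|exact: bmf_pair1 bg x].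
  by apply: eq_Rintegral => w _; rewrite /mh_integrand /f /g/=; ring.
rewrite (eq_Rintegral _ (g := fun x => h (L, x) + (\int[Q]_w f (x, w) - \int[Q]_w g (x, w)))); last first.
  by move=> x _; exact: mhE.
have bF := bmf_fubini1 Pi Q bf; have bG := bmf_fubini1 Pi Q bg.
rewrite (ERD Pi bhL (bmfB bF bG)) (ERB Pi bF bG).
suff -> : \int[Pi]_x \int[Q]_w f (x, w) = \int[Pi]_x \int[Q]_w g (x, w) by rewrite subrr addr0.
rewrite (ER_fubini Pi Q bf) (ER_fubini Pi Q bg) -(ER_Q_sym (bmf_fubini2 Pi Q bg)); last first.
  by move=> w; apply: ER_ge0 => x; rewrite mulr_ge0 ?acc_ge0.
apply: eq_Rintegral => w _; rewrite /f /g /= (detailed_balance (L *m w) bhL)//.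
by apply: eq_Rintegral => x _; rewrite mulmxN.
Qed.

Lemma mh_iter_invariant f j L : bmf f -> (forall x, 0 <= f x) ->
  \int[Pi]_x mh_iter target Q f j (L, x) = \int[Pi]_x f x.
Proof.
move=> bf f0; elim: j => [|j IH] //=; rewrite mh_invariant ?IH//; first exact: bmf_mh_iter.
move=> p; have [B hB] := proj2 bf.
have fb x : 0 <= f x <= B by rewrite f0 (le_trans (ler_norm _) (hB x)).
by have /andP[] := mh_iter_bounds mtarget target_ge0 Q j p bf fb.
Qed.

Lemma target_gt0 x : target x != 0 -> 0 < target x.
Proof. by move=> tx; have /andP[+ _] := target_bounds tx; exact: lt_le_trans. Qed.

Lemma acc_ge_support x y : target x != 0 -> target y != 0 -> m / M <= acc x y.
Proof.
move=> tx ty; have /andP[mx xM] := target_bounds tx; have /andP[my yM] := target_bounds ty.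
have x0 := target_gt0 tx; have M0 : 0 < M := lt_le_trans x0 xM.
rewrite /acc le_min ler_pdivrMr// mul1r (le_trans mx xM)/=.
rewrite ler_pdivlMr// mulrAC ler_pdivrMr//.
by apply: ler_pM => //; exact: ltW.
Qed.

Lemma D_ge0 x : target x != 0 -> 0 <= D.
Proof. by move=> tx; have := diam_le tx tx; rewrite subrr enorm0. Qed.

(** The factors are, in order: a lower bound for [acc] between points of the support; a lower bound
    for q on the steps that stay within distance D; a lower bound for the Jacobian of w -> L w; and
    1 / M, which turns Lebesgue measure into Pi because [target] is at most M. *)
Definition minorization (a b : R) : R := m / M * qhat (D / a) * b ^- d / M.

Lemma minorization_gt0 a b x : 0 < a -> 0 < b -> target x != 0 -> 0 < minorization a b.
Proof.
move=> a0 b0 tx; have /andP[mx xM] := target_bounds tx.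
have M0 : 0 < M := lt_le_trans (target_gt0 tx) xM.
have qD0 : 0 < qhat (D / a) by rewrite qhat_gt0// divr_ge0 ?(D_ge0 tx)// ltW.
by rewrite /minorization !mulr_gt0 ?invr_gt0 ?exprn_gt0.
Qed.

(** Substitute y = x + L w. If y is in the support then |L w| <= D, so |w| <= D / a and q w >= qhat
    (D / a); elsewhere the minorant [F] vanishes because it contains the factor [target y]. *)
Lemma doeblin L a b x G : 0 < a -> 0 < b ->
  (forall v, a * enorm v <= enorm (L *m v)) ->
  (forall v, enorm (L *m v) <= b * enorm v) ->
  target x != 0 -> bmf G -> (forall y, 0 <= G y) ->
  minorization a b * \int[Pi]_y G y <=
    \int[Q]_w (acc x (x + L *m w) * G (x + L *m w)).
Proof.
move=> a0 b0 aL bL tx bG G0.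
have /andP[mx xM] := target_bounds tx; have x0 := target_gt0 tx.
have M0 : 0 < M := lt_le_trans x0 xM.
have min0 := minorization_gt0 a0 b0 tx.
have uL := sym_mulmx_unit a0 aL.
have [c c0 hc] := lebesgue_linP uL.
have cb := lin_factor_ge c0 b0 hc bL.
have qD0 : 0 < qhat (D / a) by rewrite qhat_gt0// divr_ge0 ?(D_ge0 tx)// ltW.
pose H w := acc x (x + L *m w) * G (x + L *m w).
have mprop : measurable_fun setT (fun w : 'cV[R]_d => x + L *m w).
  by apply: measurable_mxD => //; exact: measurable_mulmx.
have bH : bmf H.
  apply: bmfM; last exact: (bmf_comp mprop bG).
  apply: (bmf_comp (h := fun w : 'cV[R]_d => (x, x + L *m w))) (bmf_acc mtarget target_ge0).
  exact: measurable_fun_pair.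
pose F y : \bar R := (m / M * qhat (D / a) / M * (G y * target y))%:E.
have k0 : 0 <= m / M * qhat (D / a) / M.
  by rewrite !(mulr_ge0, divr_ge0) ?invr_ge0 ?ltW.
have F0 y : (0 <= F y)%E by rewrite lee_fin mulr_ge0// mulr_ge0.
have mF : measurable_fun setT F.
  by apply/measurable_EFinP; apply: measurable_funM => //; apply: measurable_funM => //; exact: bmf_meas.
rewrite -lee_fin ER_Q//; last by move=> w; rewrite mulr_ge0 ?acc_ge0.
apply: (@le_trans _ _ (\int[lam]_w F (x + L *m w)%R)%E).
  rewrite (ge0_integral_lin c0 hc (f := fun u => F (x + u)%R))//; last first.
    by apply: (measurableT_comp mF); apply: measurable_mxD.
  under eq_integral do rewrite addrC.
  rewrite ge0_integralD_translate// EFinM ER_Pi//.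
  rewrite -ge0_integralZl//; last 3 first.
  - by apply: emeasurable_funM; apply/measurable_EFinP => //; exact: bmf_meas.
  - by move=> y _; rewrite -EFinM lee_fin mulr_ge0.
  - by rewrite lee_fin ltW.
  rewrite -ge0_integralZl//.
  apply: ge0_le_integral => //.
  - move=> y _; rewrite -!EFinM lee_fin mulr_ge0//; first exact: ltW.
    by rewrite mulr_ge0.
  - apply: emeasurable_funM => //.
    by apply: emeasurable_funM; apply/measurable_EFinP => //; exact: bmf_meas.
  - by apply: emeasurable_funM.
  - move=> y _; rewrite -!EFinM lee_fin /minorization.
    rewrite [leLHS](_ : _ = b ^- d * (m / M * qhat (D / a) / M * (G y * target y))); last by ring.
    by rewrite ler_wpM2r// mulr_ge0// mulr_ge0.
apply: ge0_le_integral => //.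
- exact: measurableT_comp.
- by apply: emeasurable_funM; apply/measurable_EFinP => //; exact: bmf_meas.
move=> w _; rewrite -EFinM lee_fin /H; set y := x + L *m w.
have [ty|ty] := eqVneq (target y) 0.
  by rewrite ty !mulr0 !mulr_ge0 ?acc_ge0.
have /andP[my yM] := target_bounds ty.
have wD : enorm w <= D / a.
  rewrite ler_pdivlMr// mulrC; apply: le_trans (aL w) _.
  by rewrite (_ : L *m w = y - x) ?diam_le// /y addrC addKr.
have qw : qhat (D / a) <= q w by rewrite qE qhat_decr// enorm_ge0.
have ay := acc_ge_support tx ty.
rewrite [leLHS](_ : _ = (m / M) * (G y * (target y / M)) * qhat (D / a)); last by ring.
have mM : 0 <= m / M by rewrite ltW// divr_gt0.
have tM : 0 <= target y / M by rewrite divr_ge0// ltW.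
apply: ler_pM => //; [by rewrite mulr_ge0// mulr_ge0|exact: ltW|].
apply: ler_pM => //; first by rewrite mulr_ge0.
by rewrite ler_piMr// ler_pdivrMr// mul1r.
Qed.

Lemma Q_density_minorant (e : R) G : 0 <= e -> bmf G -> (forall x, 0 <= G x) ->
  (\int[lam]_x ((G x)%:E * ((1 + e) ^- d * q ((1 + e) *: x))%:E) <= (\int[Q]_x G x)%:E)%E.
Proof.
move=> e0 bG G0; rewrite ER_Q//.
have s1 : 1 <= 1 + e by rewrite lerDl.
have s0 : 0 < 1 + e by exact: lt_le_trans s1.
have mG : measurable_fun setT (EFin \o G) by apply/measurable_EFinP; exact: bmf_meas.
apply: ge0_le_integral => //.
- by move=> x _; rewrite -EFinM lee_fin mulr_ge0// mulr_ge0// invr_ge0 exprn_ge0// ltW.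
- apply: emeasurable_funM => //; apply/measurable_EFinP; apply: measurable_funM => //.
  by apply: measurableT_comp => //; exact: measurable_mxZ.
- by apply: emeasurable_funM => //; apply/measurable_EFinP.
- move=> x _; rewrite -!EFinM lee_fin ler_wpM2l//.
  apply: (@le_trans _ _ (q ((1 + e) *: x))).
    by rewrite ler_piMl// invf_le1 ?exprn_gt0// exprn_ege1.
  by rewrite !qE qhat_decr ?enorm_ge0// enormZ ger0_norm ?(ltW s0)// ler_peMl// enorm_ge0.
Qed.

(** The law of N w has density c q(N^-1 x), where c >= (1 + e)^-d by comparison of balls, and |N^-1
    x| <= (1 + e) |x|; the radial profile is decreasing. *)
Lemma Q_lin_minorant (e : R) (N : 'M[R]_d) G : 0 <= e ->
  (forall v, enorm (N *m v) <= (1 + e) * enorm v) ->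
  (forall v, enorm v <= (1 + e) * enorm (N *m v)) ->
  bmf G -> (forall x, 0 <= G x) ->
  (\int[lam]_x ((G x)%:E * ((1 + e) ^- d * q ((1 + e) *: x))%:E) <=
    (\int[Q]_x G (N *m x)%R)%:E)%E.
Proof.
move=> e0 Nle Nge bG G0.
have s1 : 1 <= 1 + e by rewrite lerDl.
have s0 : 0 < 1 + e by exact: lt_le_trans s1.
have bGN : bmf (fun x => G (N *m x)) := bmf_comp (measurable_mulmx N) bG.
rewrite ER_Q//.
have uN : N \in unitmx.
  apply: (@sym_mulmx_unit _ _ _ (1 + e)^-1) => [|v]; first by rewrite invr_gt0.
  by rewrite mulrC ler_pdivrMr// mulrC.
have [c c0 hc] := lebesgue_linP uN.
have cge := lin_factor_ge c0 s0 hc Nle.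
have mG : measurable_fun setT (EFin \o G) by apply/measurable_EFinP; exact: bmf_meas.
have mqN : measurable_fun setT (fun x => q (invmx N *m x)).
  by apply: measurableT_comp => //; exact: measurable_mulmx.
pose F y := ((G y)%:E * (q (invmx N *m y)%R)%:E)%E.
have mF : measurable_fun setT F by apply: emeasurable_funM => //; exact/measurable_EFinP.
have F0 y : (0 <= F y)%E by rewrite /F -EFinM lee_fin mulr_ge0.
rewrite [leRHS](_ : _ = (\int[lam]_x F (N *m x)%R)%E); last first.
  by apply: eq_integral => x _; rewrite /F mulKmx.
rewrite (ge0_integral_lin c0 hc mF F0) -ge0_integralZl//.
apply: ge0_le_integral => //.
- by move=> x _; rewrite -EFinM lee_fin mulr_ge0// mulr_ge0// invr_ge0 exprn_ge0// ltW.
- apply: emeasurable_funM => //; apply/measurable_EFinP; apply: measurable_funM => //.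
  by apply: measurableT_comp => //; exact: measurable_mxZ.
- exact: emeasurable_funM.
- move=> x _; rewrite /F -!EFinM lee_fin [leRHS]mulrCA ler_wpM2l//.
  apply: ler_pM => //; first by rewrite invr_ge0 exprn_ge0// ltW.
  rewrite !qE qhat_decr ?enorm_ge0// enormZ ger0_norm ?(ltW s0)//.
  by apply: le_trans (Nge _) _; rewrite mulKVmx.
Qed.

(** One factor (1 + e)^-d is explicit in the density, the other is the Jacobian of the dilation. *)
Lemma minorant_mass (e B : R) : 0 <= e -> 0 <= B ->
  (\int[lam]_x (B%:E * ((1 + e) ^- d * q ((1 + e) *: x))%:E) =
    (B * (1 + e) ^- (2 * d))%:E)%E.
Proof.
move=> e0 B0.
have s0 : 0 < 1 + e by apply: lt_le_trans ltr01 _; rewrite lerDl.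
have si : 0 <= (1 + e) ^- d by rewrite invr_ge0 exprn_ge0// ltW.
have mqs : measurable_fun setT (fun x : 'cV[R]_d => q ((1 + e) *: x)).
  by apply: measurableT_comp => //; exact: measurable_mxZ.
transitivity (\int[lam]_x ((B * (1 + e) ^- d)%:E * (q ((1 + e) *: x)%R)%:E))%E.
  by apply: eq_integral => x _; rewrite -!EFinM mulrA.
rewrite ge0_integralZl//; last 3 first.
- exact/measurable_EFinP.
- by move=> x _; rewrite lee_fin.
- by rewrite lee_fin mulr_ge0.
have us : ((1 + e)%:M : 'M[R]_d) \in unitmx by rewrite unitmxE det_scalar unitrX// unitfE gt_eqF.
have hc A : measurable A -> lam ((fun u => (1 + e)%:M *m u) @^-1` A) = (((1 + e) ^- d)%:E * lam A)%E.
  move=> mA; rewrite -lebesgue_scale//; congr (lam _).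
  by apply/seteqP; split => u /=; rewrite mul_scalar_mx.
have -> : (\int[lam]_x (q ((1 + e) *: x))%:E = \int[lam]_x (EFin \o q) ((1 + e)%:M *m x)%R)%E.
  by apply: eq_integral => x _ /=; rewrite mul_scalar_mx.
rewrite (ge0_integral_lin si hc); last 2 first.
- exact/measurable_EFinP.
- by move=> x; rewrite lee_fin.
rewrite [X in (_ * (_ * X))%E](_ : _ = 1%E); last first.
  by rewrite -(probability_setT Q) QE.
by rewrite mule1 -EFinM mul2n -addnn exprD invfM mulrA.
Qed.

(* Both laws dominate the measure with density (1 + e)^-d q ((1 + e) x). *)
Lemma Q_lin_close (e B : R) (N : 'M[R]_d) G : 0 <= e ->
  (forall v, enorm (N *m v) <= (1 + e) * enorm v) ->
  (forall v, enorm v <= (1 + e) * enorm (N *m v)) ->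
  measurable_fun setT G -> (forall x, 0 <= G x <= B) ->
  `|\int[Q]_x G x - \int[Q]_x G (N *m x)| <= B * ((2 * d)%:R * e).
Proof.
move=> e0 Nle Nge mG GB.
have bG : bmf G := bmf_ge0 mG GB.
have B0 : 0 <= B by have /andP[h1 h2] := GB 0; exact: le_trans h2.
have G0 x : 0 <= G x by have /andP[] := GB x.
(* The minorant is applied to both G and B - G. Its integrals Z and Z' confine the two expectations
   to the interval [Z, B - Z'], whose length is B (1 - (1 + e)^(-2 d)). *)
pose G' x := B - G x.
have bG' : bmf G' by apply: bmfB => //; exact: bmf_cst.
have G'0 x : 0 <= G' x by rewrite subr_ge0; have /andP[] := GB x.
have mN := measurable_mulmx N.
have bGN : bmf (fun x => G (N *m x)) := bmf_comp mN bG.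
have h1 := Q_density_minorant e0 bG G0; have h1' := Q_density_minorant e0 bG' G'0.
have h2 := Q_lin_minorant e0 Nle Nge bG G0; have h2' := Q_lin_minorant e0 Nle Nge bG' G'0.
pose Z := (\int[lam]_x ((G x)%:E * ((1 + e) ^- d * q ((1 + e) *: x))%:E))%E.
pose Z' := (\int[lam]_x ((G' x)%:E * ((1 + e) ^- d * q ((1 + e) *: x))%:E))%E.
have si : 0 <= (1 + e) ^- d.
  by rewrite invr_ge0 exprn_ge0// addr_ge0.
have ms : measurable_fun setT (fun x : 'cV[R]_d => (((1 + e) ^- d * q ((1 + e) *: x))%:E)).
  apply/measurable_EFinP; apply: measurable_funM => //.
  by apply: measurableT_comp => //; exact: measurable_mxZ.
have ZZ' : (Z + Z' = (B * (1 + e) ^- (2 * d))%:E)%E.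
  rewrite -(minorant_mass e0 B0) /Z /Z' -ge0_integralD//; last 4 first.
  - by move=> x _; rewrite -EFinM lee_fin mulr_ge0// mulr_ge0.
  - by apply: emeasurable_funM => //; apply/measurable_EFinP; exact: bmf_meas.
  - by move=> x _; rewrite -EFinM lee_fin mulr_ge0// mulr_ge0.
  - by apply: emeasurable_funM => //; apply/measurable_EFinP; exact: bmf_meas.
  apply: eq_integral => x _; rewrite -ge0_muleDl ?lee_fin// -EFinD.
  by congr (_%:E * _)%E; rewrite /G'; ring.
have Z0 : (0 <= Z)%E.
  by apply: integral_ge0 => x _; rewrite -EFinM lee_fin mulr_ge0// mulr_ge0.
have Z'0 : (0 <= Z')%E.
  by apply: integral_ge0 => x _; rewrite -EFinM lee_fin mulr_ge0// mulr_ge0.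
have Zf : Z \is a fin_num by rewrite ge0_fin_numE//; apply: le_lt_trans h1 (ltry _).
have Z'f : Z' \is a fin_num by rewrite ge0_fin_numE//; apply: le_lt_trans h1' (ltry _).
rewrite -/Z -(fineK Zf) lee_fin in h1; rewrite -/Z -(fineK Zf) lee_fin in h2.
rewrite -/Z' -(fineK Z'f) lee_fin in h1'; rewrite -/Z' -(fineK Z'f) lee_fin in h2'.
move: ZZ'; rewrite -(fineK Zf) -(fineK Z'f) -EFinD => -[ZZ'].
have e1 : \int[Q]_x G' x = B - \int[Q]_x G x.
  by rewrite /G' ERB ?ER_cst//; exact: bmf_cst.
have e2 : \int[Q]_x G' (N *m x) = B - \int[Q]_x G (N *m x).
  by rewrite /G' ERB ?ER_cst//; exact: bmf_cst.
rewrite e1 in h1'; rewrite e2 in h2'.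
have h := bernoulli_inv (2 * d) e0.
have : B * (1 - (2 * d)%:R * e) <= B * (1 + e) ^- (2 * d) by rewrite ler_wpM2l.
rewrite -ZZ' mulrBr mulr1 => h3.
by rewrite ler_norml; apply/andP; split; lra.
Qed.

(** Apply [Q_lin_close] to N = L^-1 L' and to G composed with L. As L^-1 and L'^-1 have norm at most
    1 / a, N and its inverse differ from the identity by at most e = k / a. *)
Lemma Q_lin_close2 (a k B : R) (L L' : 'M[R]_d) G : 0 < a -> 0 <= k ->
  (forall v, a * enorm v <= enorm (L *m v)) ->
  (forall v, a * enorm v <= enorm (L' *m v)) ->
  (forall v, enorm ((L' - L) *m v) <= k * enorm v) ->
  measurable_fun setT G -> (forall x, 0 <= G x <= B) ->
  `|\int[Q]_x G (L *m x) - \int[Q]_x G (L' *m x)| <= B * ((2 * d)%:R * (k / a)).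
Proof.
move=> a0 k0 aL aL' kLL' mG GB.
have uL := sym_mulmx_unit a0 aL; have uL' := sym_mulmx_unit a0 aL'.
have := @Q_lin_close (k / a) B (invmx L *m L') (fun x => G (L *m x)) _ _ _ _ _.
under [X in _ -> _ -> _ -> _ -> _ -> `|_ - X| <= _]eq_Rintegral do rewrite mulmxA mulKVmx//.
apply => //.
- by rewrite divr_ge0// ltW.
- move=> v; rewrite (_ : _ *m v = v + invmx L *m ((L' - L) *m v)); last first.
    by rewrite mulmxBl mulmxBr mulmxA mulKmx// addrC subrK.
  apply: le_trans (ler_enormD _ _) _; rewrite mulrDl mul1r lerD2l.
  apply: le_trans (invmx_enorm_le a0 aL uL _) _.
  by rewrite [k / a]mulrC -mulrA ler_wpM2l// invr_ge0 ltW.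
- move=> v; set w := _ *m v.
  have -> : v = w - invmx L' *m ((L' - L) *m w).
    by rewrite mulmxBl mulmxBr mulKmx// /w -[invmx L *m L' *m v]mulmxA mulKVmx// mulKmx// opprB addrCA subrr addr0.
  apply: le_trans (ler_enormB _ _) _; rewrite mulrDl mul1r lerD2l.
  apply: le_trans (invmx_enorm_le a0 aL' uL' _) _.
  by rewrite [k / a]mulrC -mulrA ler_wpM2l// invr_ge0 ltW.
- by apply: measurableT_comp => //; exact: measurable_mulmx.
Qed.

Section fixed_proposal.
Variables (a b : R) (L : 'M[R]_d).
Hypotheses (a0 : 0 < a) (b0 : 0 < b)
  (aL : forall v, a * enorm v <= enorm (L *m v))
  (bL : forall v, enorm (L *m v) <= b * enorm v).
Local Notation delta := (minorization a b).

(** On the support h - lo is nonnegative, and the accepted moves alone, by [doeblin], contribute at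
    least delta times its mean under Pi. *)
Lemma mh_ge h lo x : bmf h -> target x != 0 ->
  (forall y, target y != 0 -> lo <= h (L, y)) ->
  lo + delta * (\int[Pi]_y h (L, y) - lo) <= mh target Q h (L, x).
Proof.
move=> bh tx loh; have bhL : bmf (fun y => h (L, y)) := bmf_pair1 bh L.
(* The truncation at 0 makes [G] nonnegative off the support too, as [doeblin] asks; proposals
   landing there are rejected. *)
pose G y := Num.max (h (L, y) - lo) 0.
have bG : bmf G.
  have bhlo : bmf (fun y => h (L, y) - lo) by apply: bmfB => //; exact: bmf_cst.
  have [mh0 [C hC]] := bhlo; split; first exact: measurable_maxr.
  exists C => y; rewrite /G maxEle; case: ifP => _; last exact: hC.
  by rewrite normr0; apply: le_trans (hC y).
have G0 y : 0 <= G y by rewrite /G le_max lexx orbT.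
have dG := doeblin a0 b0 aL bL tx bG G0.
have dp := minorization_gt0 a0 b0 tx.
have G1 : \int[Pi]_y h (L, y) - lo <= \int[Pi]_y G y.
  rewrite -[X in _ - X](ER_cst Pi) -ERB//; last exact: bmf_cst.
  apply: ER_le => //; first by apply: bmfB => //; exact: bmf_cst.
  by move=> y; rewrite /G le_max lexx.
apply: (@le_trans _ _ (lo + \int[Q]_w (acc x (x + L *m w) * G (x + L *m w)))).
  by rewrite lerD2l; apply: le_trans dG; rewrite ler_wpM2l// ltW.
have bH : bmf (fun w => acc x (x + L *m w) * G (x + L *m w)).
  have mprop : measurable_fun setT (fun w : 'cV[R]_d => x + L *m w).
    by apply: measurable_mxD => //; exact: measurable_mulmx.
  apply: bmfM; last exact: (bmf_comp mprop bG).
  apply: (bmf_comp (h := fun w : 'cV[R]_d => (x, x + L *m w))) (bmf_acc mtarget target_ge0).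
  exact: measurable_fun_pair.
rewrite -[X in X + _](ER_cst Q) -ERD//; last exact: bmf_cst.
apply: ER_le; [by apply: bmfD => //; exact: bmf_cst|exact: bmf_mh_integrand1|].
move=> w; rewrite /mh_integrand/=; set y := x + L *m w.
have al0 := acc_ge0 target_ge0 x y; have al1 := acc_le1 target x y.
have hx := loh x tx.
have [ty|ty] := eqVneq (target y) 0.
  by rewrite acc_out// !mul0r subr0 mul1r !addr0.
have hy := loh y ty.
rewrite /G maxEge subr_ge0 hy.
by move: (acc x y) al0 al1 => u u0 u1; nra.
Qed.

Lemma mh_le h hi x : bmf h -> target x != 0 ->
  (forall y, target y != 0 -> h (L, y) <= hi) ->
  mh target Q h (L, x) <= hi - delta * (hi - \int[Pi]_y h (L, y)).
Proof.
move=> bh tx hih; have bhL : bmf (fun y => h (L, y)) := bmf_pair1 bh L.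
have bh' : bmf (fun p => 0 - h p) by apply: bmfB => //; exact: bmf_cst.
have := mh_ge (lo := - hi) bh' tx.
rewrite mh_sub// ERB//; last exact: bmf_cst.
rewrite ER_cst => H; have {}H : - hi + delta * (0 - \int[Pi]_y h (L, y) - - hi) <= 0 - mh target Q h (L, x).
  by apply: H => y ty; rewrite sub0r lerN2 hih.
rewrite mulrBr; rewrite !mulrBr mulr0 mulrN in H.
by lra.
Qed.

Lemma minorization_le1 x : target x != 0 -> delta <= 1.
Proof.
move=> tx; have := doeblin a0 b0 aL bL tx (bmf_cst 1) (fun=> ler01).
rewrite ER_cst mulr1 => /le_trans; apply.
rewrite -[leRHS](ER_cst Q); apply: ER_le; last first.
- by move=> w; rewrite mulr1 acc_le1.
- exact: bmf_cst.
apply: bmfM; last exact: bmf_cst.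
apply: (bmf_comp (h := fun w : 'cV[R]_d => (x, x + L *m w))) (bmf_acc mtarget target_ge0).
apply: measurable_fun_pair => //.
by apply: measurable_mxD => //; exact: measurable_mulmx.
Qed.

Lemma mh_iter_ergodic (f : 'cV[R]_d -> R) B j x : measurable_fun setT f -> (forall x, 0 <= f x <= B) ->
  target x != 0 ->
  `|mh_iter target Q f j (L, x) - \int[Pi]_y f y| <= (1 - delta) ^+ j * B.
Proof.
move=> mf fB tx; have bf := bmf_ge0 mf fB.
have f0 y : 0 <= f y by have /andP[] := fB y.
have d1 : 0 <= 1 - delta by rewrite subr_ge0 (minorization_le1 tx).
(* Induction on an interval [lo, hi] containing the mean and all values of the iterate on the
   support. One step moves both ends toward the mean by the fraction delta, so the length shrinks by
   the factor 1 - delta. *)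
suff [lo [hi [lohi pilo pihi h]]] : exists lo hi, [/\ hi - lo <= (1 - delta) ^+ j * B,
    lo <= \int[Pi]_y f y, \int[Pi]_y f y <= hi &
    forall y, target y != 0 -> lo <= mh_iter target Q f j (L, y) <= hi].
  have /andP[h1 h2] := h x tx; rewrite ler_norml; apply/andP; split; lra.
elim: j => [|j [lo [hi [lohi pilo pihi h]]]].
  exists 0, B; split.
  - by rewrite subr0 expr0 mul1r.
  - exact: ER_ge0.
  - rewrite -[leRHS](ER_cst Pi); apply: ER_le => //; first exact: bmf_cst.
    by move=> y; have /andP[] := fB y.
  - by move=> y _ /=; exact: fB.
have bh := bmf_mh_iter mtarget target_ge0 Q j bf.
have inv := mh_iter_invariant j L bf f0.
have dp := minorization_gt0 a0 b0 tx.
exists (lo + delta * (\int[Pi]_y f y - lo)), (hi - delta * (hi - \int[Pi]_y f y)); split.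
- rewrite exprS -mulrA; apply: le_trans (ler_wpM2l d1 lohi).
  by move: (delta) (\int[Pi]_y f y) => u v; lra.
- have := mulr_ge0 d1; rewrite -subr_ge0 in pilo.
  by move=> /(_ _ pilo); move: (delta) (\int[Pi]_y f y) => u v; lra.
- have := mulr_ge0 d1; rewrite -subr_ge0 in pihi.
  by move=> /(_ _ pihi); move: (delta) (\int[Pi]_y f y) => u v; lra.
- move=> y ty; rewrite -inv; apply/andP; split.
    by apply: mh_ge => // z tz; have /andP[] := h z tz.
  by apply: mh_le => // z tz; have /andP[] := h z tz.
Qed.

End fixed_proposal.

(** Each application of the kernel adds one error from [Q_lin_close2], and, being an average, it
    does not amplify the errors already made. *)
Lemma mh_iter_lipschitz (f : 'cV[R]_d -> R) B j (a k : R) (L L' : 'M[R]_d) x : 0 < a -> 0 <= k ->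
  (forall v, a * enorm v <= enorm (L *m v)) ->
  (forall v, a * enorm v <= enorm (L' *m v)) ->
  (forall v, enorm ((L' - L) *m v) <= k * enorm v) ->
  measurable_fun setT f -> (forall x, 0 <= f x <= B) ->
  `|mh_iter target Q f j (L, x) - mh_iter target Q f j (L', x)| <=
    j%:R * (B * ((2 * d)%:R * (k / a))).
Proof.
move=> a0 k0 aL aL' kL mf fB; have bf := bmf_ge0 mf fB.
set c := B * _; have c0 : 0 <= c.
  have B0 : 0 <= B by have /andP[h1 h2] := fB 0; exact: le_trans h2.
  by rewrite /c !mulr_ge0// invr_ge0 ltW.
elim: j x => [|j IH] x; first by rewrite subrr normr0 mul0r.
pose h := mh_iter target Q f j.
have bh : bmf h := bmf_mh_iter mtarget target_ge0 Q j bf.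
have hB p := mh_iter_bounds mtarget target_ge0 Q j p bf fB.
pose F u := (1 - acc x (x + u)) * h (L', x) + acc x (x + u) * h (L', x + u).
have bax : bmf (fun u => acc x (x + u)).
  apply: (bmf_comp (h := fun u : 'cV[R]_d => (x, x + u))) (bmf_acc mtarget target_ge0).
  by apply: measurable_fun_pair => //; apply: measurable_mxD.
have mF : measurable_fun setT F.
  apply: bmf_meas; apply: bmfD; apply: bmfM => //.
  - by apply: bmfB => //; exact: bmf_cst.
  - exact: bmf_cst.
  - apply: (bmf_comp (h := fun u : 'cV[R]_d => x + u)) (bmf_pair1 bh L').
    exact: measurable_mxD.
have FB u : 0 <= F u <= B.
  rewrite /F; have := acc_ge0 target_ge0 x (x + u); have := acc_le1 target x (x + u).
  have /andP[h1 h2] := hB (L', x); have /andP[h3 h4] := hB (L', x + u).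
  rewrite -/h in h1 h2 h3 h4.
  rewrite (_ : _ + _ = h (L', x) + acc x (x + u) * (h (L', x + u) - h (L', x))); last by ring.
  move: (acc x (x + u)) (h (L', x)) (h (L', x + u)) h1 h2 h3 h4 => v s t *.
  by apply/andP; split; nra.
have bF : bmf F := bmf_ge0 mF FB.
rewrite /= -/h.
have e' : mh target Q h (L', x) = \int[Q]_w F (L' *m w) by [].
have bFL : bmf (fun w => F (L *m w)) := bmf_comp (measurable_mulmx L) bF.
(* First the inner iterate is changed from L to L' while proposals are still made with L, then the
   proposals are changed. *)
rewrite (_ : _ - _ = (mh target Q h (L, x) - \int[Q]_w F (L *m w)) +
  (\int[Q]_w F (L *m w) - \int[Q]_w F (L' *m w))); last by rewrite e'; ring.
apply: le_trans (ler_normD _ _) _.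
rewrite -[j.+1]addn1 natrD mulrDl mul1r; apply: lerD; last exact: Q_lin_close2.
rewrite /mh -ERB//; last exact: bmf_mh_integrand1.
apply: ER_normr_le.
  by apply: bmf_meas; apply: bmfB => //; exact: bmf_mh_integrand1.
move=> w; rewrite /mh_integrand /F/=; set y := x + L *m w.
have al0 := acc_ge0 target_ge0 x y; have al1 := acc_le1 target x y.
have := IH x; have := IH y; rewrite -!/(h _) => hy hx.
rewrite (_ : _ - _ = (1 - acc x y) * (h (L, x) - h (L', x)) + acc x y * (h (L, y) - h (L', y))); last by ring.
apply: le_trans (ler_normD _ _) _; rewrite !normrM (ger0_norm al0).
rewrite ger0_norm ?subr_ge0//.
move: (acc x y) (`|h (L, x) - _|) (`|h (L, y) - _|) (j%:R * c) al0 al1 hx hy => u v w' t *.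
by nra.
Qed.

End ergodicity.

(** * Acceptance rates *)

Section radial_density.
Context {R : realType} {d : nat}.
Variables (q : 'cV[R]_d -> R) (qhat : R -> R) (Q : probability 'cV[R]_d R).
Hypotheses (d_gt0 : (0 < d)%N) (mq : measurable_fun setT q) (q_ge0 : forall x, 0 <= q x)
  (QE : forall A, measurable A -> Q A = (\int[lebesgue_cV d]_(x in A) (q x)%:E)%E)
  (qE : forall z, q z = qhat (enorm z))
  (qhat_gt0 : forall x, 0 <= x -> 0 < qhat x)
  (qhat_decr : forall x y, 0 <= x -> x <= y -> qhat y <= qhat x).
Local Notation lam := (lebesgue_cV d).
Implicit Types (A : set 'cV[R]_d) (u v w : 'cV[R]_d).

Lemma Q_le_lebesgue A : measurable A -> (Q A <= (qhat 0)%:E * lam A)%E.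
Proof.
move=> mA; rewrite QE// -integral_cst//; apply: ge0_le_integral => //.
- by move=> x _; rewrite lee_fin.
- by apply/measurable_EFinP; apply: measurable_funTS.
- by move=> x _; rewrite lee_fin qE qhat_decr// enorm_ge0.
Qed.

Lemma Q_eball_small (eta : R) : 0 < eta -> exists2 r, 0 < r & (Q (eball r) <= eta%:E)%E.
Proof.
move=> e0; have q0 := qhat_gt0 (lexx 0).
(* Since d > 0, r <= 1/2 gives (2 r)^d <= 2 r; the second bound then makes qhat(0) (2 r)^d at most
   eta. *)
pose r := Num.min 2^-1 (eta / (2 * qhat 0)).
have r0 : 0 < r by rewrite lt_min invr_gt0// ltr0n/= divr_gt0// mulr_gt0.
exists r => //; apply: le_trans (Q_le_lebesgue (measurable_eball r)) _.
apply: (@le_trans _ _ ((qhat 0)%:E * lam (cube d r))%E).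
  apply: lee_wpmul2l; first by rewrite lee_fin ltW.
  apply: le_measure; rewrite ?inE; [exact: measurable_eball|exact: measurable_cube|].
  by move=> v /= vr; apply/cubeP => i; apply: le_trans (normr_entry_le_enorm _ _) _.
rewrite (lebesgue_cube d (ltW r0)) -EFinM lee_fin.
have r1 : 2 * r <= 1.
  by rewrite mulrC -ler_pdivlMr// mul1r /r ge_min lexx.
have r2 : 2 * r * qhat 0 <= eta.
  rewrite mulrAC -ler_pdivlMl ?mulr_gt0// mulrC /r ge_min lexx orbT//.
apply: le_trans r2; rewrite mulrC ler_wpM2r ?(ltW q0)//.
case: d d_gt0 => // n _; rewrite exprS ler_piMr// ?mulr_ge0 ?(ltW r0)//.
by rewrite exprn_ile1// mulr_ge0// ltW.
Qed.

Lemma Q_eball_large (eta : R) : 0 < eta ->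
  exists2 r, 0 < r & ((1 - eta)%:E <= Q (eball r))%E.
Proof.
move=> e0; pose F n := eball n%:R : set 'cV[R]_d.
have U : \bigcup_n F n = setT.
  apply/seteqP; split => // v _; exists (Num.bound (enorm v)) => //.
  by rewrite /F /eball/= ltW// archi_boundP// enorm_ge0.
have : (Q \o F) x @[x --> \oo] --> Q (\bigcup_n F n).
  apply: nondecreasing_cvg_mu.
  - by move=> n; exact: measurable_eball.
  - by rewrite U.
  - move=> n m nm; apply/subsetPset => v; rewrite /F /eball/= => h.
    by apply: le_trans h _; rewrite ler_nat.
rewrite U probability_setT => cv.
have : \forall n \near \oo, ((1 - eta)%:E < Q (F n))%E.
  have := cv [set y | ((1 - eta)%:E < y)%E]; apply.
  by apply: (@nbhs_open_ereal_gt _ 1 (fun x => x - eta)); rewrite ltrBlDr ltrDl.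
move=> [n _ /(_ n.+1)/=]; rewrite leqnSn => /(_ isT) h.
by exists n.+1%:R => //; exact: ltW.
Qed.

Definition slab u (s r : R) : set 'cV[R]_d := [set w | `|dot u w| <= s /\ enorm w <= r].

Lemma measurable_dot u : measurable_fun setT (dot u).
Proof.
apply: measurable_sum => i; apply: measurable_funM => //; exact: measurable_entry.
Qed.

Lemma measurable_slab u s r : measurable (slab u s r).
Proof.
rewrite (_ : slab u s r = (fun w => `|dot u w|) @^-1` `]-oo, s] `&` eball r); last first.
  by apply/seteqP; split => w; rewrite /slab /eball /= in_itv/=.
apply: measurableI; last exact: measurable_eball.
rewrite -[X in measurable X]setTI.
have h : measurable_fun setT (fun w => `|dot u w|).
  by apply: measurableT_comp => //; exact: measurable_dot.
by apply: h.
Qed.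

Lemma big_coordinate u : exists i, enorm u <= d%:R * `|u i 0|.
Proof.
have [i _ hi] := @arg_maxP _ _ _ (Ordinal d_gt0) xpredT (fun i => `|u i 0|) isT.
exists i; apply: le_trans (enorm_le_sum _) _.
apply: le_trans (ler_sum _ (fun j _ => hi j isT)) _.
by rewrite sumr_const card_ord mulr_natl.
Qed.

(* The translates of the slab along a large coordinate of u are disjoint and
   stay in a fixed cube. *)
Lemma lebesgue_slab (N : nat) u s r : (0 < N)%N -> 0 < r -> 0 <= s ->
  2 * s * (d%:R * N%:R) < enorm u ->
  (N%:R%:E * lam (slab u s r) <= lam (cube d (r + 1)))%E.
Proof.
move=> N0 r0 s0 su; have [i ui] := big_coordinate u.
have Np : 0 < N%:R :> R by rewrite ltr0n.
have dp : 0 < d%:R :> R by rewrite ltr0n.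
pose e : 'cV[R]_d := delta_mx i 0.
have due (w : 'cV[R]_d) t : dot u (w + t *: e) = dot u w + t * u i 0.
  rewrite dotDr dotZr; congr (_ + _ * _); rewrite /dot (bigD1 i)//= big1 => [|j ji].
    by rewrite mxE !eqxx mulr1 addr0.
  by rewrite mxE (negPf ji) mulr0.
pose F (k : 'I_N) := (fun w => w + (k%:R / N%:R) *: e) @^-1` slab u s r.
have mF k : measurable (F k).
  rewrite -[X in measurable X]setTI; apply: measurable_addv => //; exact: measurable_slab.
have FE k : lam (F k) = lam (slab u s r) by apply: lebesgue_cVD; exact: measurable_slab.
have tF : trivIset setT F.
  apply/trivIsetP => k l _ _ kl; apply/seteqP; split => // w [].
  rewrite /F /slab /= !due => -[h1 _] [h2 _].
  have : `|(k%:R / N%:R - l%:R / N%:R) * u i 0| <= 2 * s.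
    rewrite (_ : _ * _ = (dot u w + k%:R / N%:R * u i 0) - (dot u w + l%:R / N%:R * u i 0)); last by ring.
    by apply: le_trans (ler_normB _ _) _; lra.
  rewrite leNgt => /negP; apply; rewrite normrM -mulrBl normrM normfV (gtr0_norm Np).
  have kl1 : 1 <= `|k%:R - l%:R : R|.
    move: kl; rewrite -(inj_eq val_inj)/= neq_ltn => /orP[] h.
      by rewrite distrC ger0_norm -natrB ?ler1n ?subn_gt0 ?ler0n// ltnW.
    by rewrite ger0_norm -natrB ?ler1n ?subn_gt0 ?ler0n// ltnW.
  apply: (@lt_le_trans _ _ (N%:R^-1 * `|u i 0|)); last first.
    by rewrite ler_wpM2r// ler_peMl// invr_ge0 ltW.
  rewrite [ltRHS]mulrC ltr_pdivlMr//.
  rewrite -(ltr_pM2l dp); apply: lt_le_trans ui.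
  by rewrite mulrCA.
have mU : measurable (\big[setU/set0]_(k < N) F k) by apply: bigsetU_measurable.
have -> : (N%:R%:E * lam (slab u s r) = lam (\big[setU/set0]_(k < N) F k))%E.
  transitivity (\sum_(k < N) lam (F k))%E; last exact/esym/measure_semi_additive_ord.
  rewrite (eq_bigr (fun=> lam (slab u s r))); last by move=> k _; exact: FE.
  by rewrite sumr_const card_ord mule_natl.
apply: le_measure; rewrite ?inE//; first exact: measurable_cube.
rewrite -bigcup_seq => w [k _]; rewrite /F /slab /= => -[_ h].
apply/cubeP => j; rewrite (_ : w j 0 = (w + (k%:R / N%:R) *: e) j 0 - (k%:R / N%:R) * e j 0); last first.
  by rewrite !mxE addrK.
apply: le_trans (ler_normB _ _) _; apply: lerD.
  by apply: le_trans (normr_entry_le_enorm _ _) _.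
rewrite normrM mulr_ile1//.
  by rewrite ger0_norm ?divr_ge0// ler_pdivrMr// mul1r ler_nat ltnW.
by rewrite mxE; case: (_ && _); rewrite ?normr1 ?normr0.
Qed.

Definition flat_cone u (k : R) : set 'cV[R]_d := [set w | `|dot u w| <= k * enorm u * enorm w].

(** A half-space for k = 0; for small k > 0 a slightly thinner cone around the direction - u. *)
Definition half_cone u (k : R) : set 'cV[R]_d := [set w | dot u w <= - (k * enorm u * enorm w)].

Lemma measurable_flat_cone u k : measurable (flat_cone u k).
Proof.
rewrite (_ : flat_cone u k = (fun w => `|dot u w| - k * enorm u * enorm w) @^-1` `]-oo, 0]); last first.
  by apply/seteqP; split => w; rewrite /flat_cone /= in_itv/= subr_le0.
rewrite -[X in measurable X]setTI.
have h : measurable_fun setT (fun w => `|dot u w| - k * enorm u * enorm w).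
  apply: measurable_funB; first by apply: measurableT_comp => //; exact: measurable_dot.
  by apply: measurable_funM => //; exact: measurable_enorm.
by apply: h.
Qed.

Lemma measurable_half_cone u k : measurable (half_cone u k).
Proof.
rewrite (_ : half_cone u k = (fun w => dot u w + k * enorm u * enorm w) @^-1` `]-oo, 0]); last first.
  by apply/seteqP; split => w; rewrite /half_cone /= in_itv/= -lerBrDr sub0r.
rewrite -[X in measurable X]setTI.
have h : measurable_fun setT (fun w => dot u w + k * enorm u * enorm w).
  apply: measurable_funD; first exact: measurable_dot.
  by apply: measurable_funM => //; exact: measurable_enorm.
by apply: h.
Qed.

(** Inside a large ball the flat cone lies in a thin slab, whose volume is small; outside the ball Q
    has little mass. The width scales with |u|, so [eps] can be chosen independently of u. *)
Lemma slab_small (eta : R) : 0 < eta -> exists2 eps : R, 0 < eps &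
  forall u, u != 0 -> (Q (flat_cone u eps) <= eta%:E)%E.
Proof.
move=> eta0; have q0 := qhat_gt0 (lexx 0).
have [|r r0 Qr] := @Q_eball_large (eta / 2); first by rewrite divr_gt0.
pose V := (2 * (r + 1)) ^+ d.
have V0 : 0 < V by rewrite exprn_gt0// mulr_gt0// addr_gt0.
(* N disjoint translates of the slab fit in a cube of volume [V], so the mass of the slab is at most
   qhat(0) V / N, which must not exceed eta / 2. *)
pose N := (Num.bound (2 * qhat 0 * V / eta)).+1.
have NV : qhat 0 * V <= eta / 2 * N%:R.
  have : 2 * qhat 0 * V / eta < N%:R.
    apply: lt_trans (archi_boundP _) _; last by rewrite ltr_nat.
    by rewrite divr_ge0 ?ltW// !mulr_gt0.
  by rewrite ltr_pdivrMr// => h; lra.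
have Np : 0 < N%:R :> R by rewrite ltr0n.
have dp : 0 < d%:R :> R by rewrite ltr0n.
(* With this choice 2 s d N equals |u| / 2, which is below |u| as [lebesgue_slab] requires. *)
pose eps := (4 * r * (d%:R * N%:R))^-1.
have eps0 : 0 < eps by rewrite invr_gt0 !mulr_gt0.
exists eps => // u u0; set s := eps * enorm u * r.
have un : 0 < enorm u by rewrite enorm_gt0.
have s0 : 0 <= s by rewrite !mulr_ge0 ?ltW.
have ss : 2 * s * (d%:R * N%:R) < enorm u.
  rewrite (_ : _ * _ = (2 * (r * (d%:R * N%:R)) * eps) * enorm u); last by rewrite /s; ring.
  have -> : 2 * (r * (d%:R * N%:R)) * eps = 2^-1.
    by rewrite /eps; field; rewrite !gt_eqF.
  by lra.
have me := @measurable_eball R d r.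
apply: (@le_trans _ _ (Q (slab u s r `|` ~` eball r))).
  apply: le_measure; rewrite ?inE//.
  - exact: measurable_flat_cone.
  - by apply: measurableU; [exact: measurable_slab|exact: measurableC].
  move=> w hw; have [wr|wr] := leP (enorm w) r; [left|right].
    by split=> //; apply: le_trans hw _; rewrite /s ler_wpM2l// mulr_ge0 ?ltW.
  by rewrite /eball /=; apply/negP; rewrite -ltNge.
apply: le_trans (measureU2 _ _ _) _; [exact: measurable_slab|exact: measurableC|].
have h1 : (Q (slab u s r) <= (eta / 2)%:E)%E.
  apply: le_trans (Q_le_lebesgue (measurable_slab u s r)) _.
  have := lebesgue_slab (ltn0Sn _ : (0 < N)%N) r0 s0 ss.
  rewrite lebesgue_cube ?addr_ge0 ?(ltW r0)// -/V => h.
  have lf : lam (slab u s r) \is a fin_num.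
    rewrite ge0_fin_numE//; apply: (@le_lt_trans _ _ (lam (eball r))); last exact: lebesgue_eball_fin.
    apply: le_measure; rewrite ?inE//; first exact: measurable_slab.
    by move=> w [].
  move: h; rewrite -(fineK lf) -!EFinM !lee_fin => h.
  rewrite -(ler_pM2r Np); apply: le_trans NV.
  by rewrite -mulrA ler_wpM2l ?(ltW q0)// mulrC.
have h2 : (Q (~` eball r) <= (eta / 2)%:E)%E.
  rewrite probability_setC//; move: Qr.
  rewrite -(fineK (fin_num_measure Q _ me)) -EFinB !lee_fin => Qr.
  by lra.
rewrite [leRHS](_ : _ = ((eta / 2)%:E + (eta / 2)%:E)%E); first exact: leeD.
by rewrite -EFinD -splitr.
Qed.

Lemma Q_opp A : measurable A -> Q ((fun w => - w) @^-1` A) = Q A.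
Proof.
move=> mA; have mNA : measurable ((fun w => - w) @^-1` A).
  by rewrite -[X in measurable X]setTI; exact: measurable_oppv.
rewrite -(fineK (fin_num_measure Q _ mNA)) -(fineK (fin_num_measure Q _ mA)).
congr EFin; rewrite -(ER_indic Q mNA) -(ER_indic Q mA).
apply: (ER_Q_sym mq q_ge0 QE qE (bmf_indic mA)) => x.
by rewrite indicE; exact: ler0n.
Qed.

(** The half cone, its reflection and the flat cone cover the space. The first two have equal mass
    by symmetry and the third has mass at most eta. *)
Lemma Q_half_cone (eta : R) : 0 < eta -> exists2 eps : R, 0 < eps &
  forall u, u != 0 -> (((1 - eta) / 2)%:E <= Q (half_cone u eps))%E.
Proof.
move=> /slab_small[eps eps0 slabQ]; exists eps => // u u0.
set H := half_cone u eps; have mH : measurable H by exact: measurable_half_cone.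
have mNH : measurable ((fun w => - w) @^-1` H).
  by rewrite -[X in measurable X]setTI; exact: measurable_oppv.
set S := flat_cone u eps; have mS : measurable S by exact: measurable_flat_cone.
have T : setT `<=` (H `|` (fun w => - w) @^-1` H) `|` S.
  move=> w _; rewrite /H /S /half_cone /flat_cone /= dotNr enormN lerN2.
  have [h|h] := leP (dot u w) (- (eps * enorm u * enorm w)); first by left; left.
  have [h'|h'] := leP (eps * enorm u * enorm w) (dot u w); first by left; right.
  by right; rewrite ler_norml !ltW.
have mHH := measurableU _ _ mH mNH.
have h : (1 <= Q (H `|` (fun w => (- w)%R) @^-1` H `|` S))%E.
  rewrite -(probability_setT Q); apply: le_measure; rewrite ?inE//.
  exact: measurableU.
have {h} := le_trans h (measureU2 Q mHH mS).
move=> /le_trans/(_ (leeD (measureU2 Q mH mNH) (slabQ _ u0))).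
move=> h; have : (1 <= Q H + Q H + eta%:E)%E by rewrite -{2}(Q_opp mH); exact: h.
by rewrite -(fineK (fin_num_measure Q _ mH)) -!EFinD !lee_fin; lra.
Qed.

End radial_density.

(** * Cones inside a set with C^1 boundary *)

Section c1_geometry.
Context {R : realType} {d : nat}.
Implicit Types (x y u v p : 'cV[R]_d) (g : 'cV[R]_d -> R).

Lemma nbhs_enorm_lt p (A : set 'cV[R]_d) : nbhs p A ->
  exists2 r, 0 < r & forall y, enorm (y - p) < r -> A y.
Proof.
move=> /nbhs_ballP[e /= e0 pA]; exists e => // y ype; apply: pA.
split => // i j; rewrite /ball/= ord1 distrC.
by apply: le_lt_trans ype; have := normr_entry_le_enorm (y - p) i; rewrite !mxE.
Qed.

Lemma near_enorm_lt p (r : R) : 0 < r -> \forall x \near p, enorm (x - p) < r.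
Proof.
move=> r0; pose e := r / d.+1%:R.
have e0 : 0 < e by rewrite divr_gt0.
apply/nbhs_ballP; exists e => //= x [_ xe].
apply: le_lt_trans (enorm_le_sum _) _.
apply: (@le_lt_trans _ _ (\sum_(i < d) e)).
  apply: ler_sum => i _; rewrite !mxE distrC ltW//; exact: xe.
rewrite sumr_const card_ord -mulr_natr /e mulrAC ltr_pdivrMr// ltr_pM2l// ltr_nat//.
Qed.

Lemma derive_gradient g x u : differentiable g x -> 'D_u g x = dot u (gradient g x).
Proof.
move=> dg; rewrite deriveE// [in LHS](matrix_sum_delta u) linear_sum.
apply: eq_bigr => i _; rewrite big_ord1 linearZ/= mxE deriveE//.
Qed.

Lemma mean_value g x y : (forall z, differentiable g z) ->
  exists2 t, t \in `]0, 1[%R & g y - g x = 'D_(y - x) g (x + t *: (y - x)).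
Proof.
move=> dg; pose f (t : R) := g (x + t *: (y - x)).
have df (t : R) : is_derive t 1 f ('D_(y - x) g (x + t *: (y - x))).
  pose z := x + t *: (y - x).
  have e : (fun h : R => h^-1 *: ((f \o shift t) (h *: 1) - f t)) =
           (fun h : R => h^-1 *: ((g \o shift z) (h *: (y - x)) - g z)).
    apply/funext => h; rewrite /f /z /=; congr (_ *: (g _ - _)).
    by rewrite (_ : h%:A = h); [rewrite scalerDl addrCA|exact: mulr1].
  apply: DeriveDef; first by rewrite /derivable e; exact: diff_derivable.
  by rewrite /derive e.
have [|t t01 ft] := @MVT R f (fun t => 'D_(y - x) g (x + t *: (y - x))) 0 1 ltr01 (fun t _ => df t).
  apply: derivable_within_continuous => t _; exact: (@ex_derive _ _ _ _ _ _ _ (df t)).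
exists t => //; move: ft; rewrite /f scale1r scale0r addr0 subr0 mulr1 => <-.
by rewrite (addrC x) subrK.
Qed.

(** Strict differentiability: both end points vary, because the cone condition must hold from every
    point near p. The mean value theorem places the gradient on the segment, where continuity keeps
    it close to the gradient at x0. *)
Lemma c1_strict g x0 (eps : R) : c1_function g -> 0 < eps -> exists2 r, 0 < r &
  forall x y, enorm (x - x0) < r -> enorm (y - x0) < r ->
    `|g y - g x - dot (y - x) (gradient g x0)| <= eps * enorm (y - x).
Proof.
move=> [dg cg] e0; pose e := eps / d.+1%:R.
have ep : 0 < e by rewrite divr_gt0.
have [r r0 hr] : exists2 r, 0 < r & forall z, enorm (z - x0) < r ->
    forall i, `|gradient g z i 0 - gradient g x0 i 0| < e.
  apply: (@nbhs_enorm_lt x0 [set z | forall i, `|gradient g z i 0 - gradient g x0 i 0| < e]).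
  apply: (@filter_forall _ _ (fun i z => `|gradient g z i 0 - gradient g x0 i 0| < e) (nbhs x0)) => i.
  have := cg (delta_mx i 0) x0 => /cvgrPdist_lt/(_ _ ep).
  by apply: filterS => z; rewrite distrC !mxE.
exists r => // x y xr yr; have [t] := mean_value x y dg; rewrite in_itv/= => /andP[t0 t1] ->.
set z := x + _; have zr : enorm (z - x0) < r.
  rewrite (_ : z - x0 = (1 - t) *: (x - x0) + t *: (y - x0)); last first.
    by rewrite /z; apply/matrixP => i j; rewrite !mxE; ring.
  apply: le_lt_trans (ler_enormD _ _) _; rewrite !enormZ (gtr0_norm t0) gtr0_norm ?subr_gt0//.
  by nra.
rewrite derive_gradient// -dotNr -dotDr.
apply: (@le_trans _ _ (\sum_i enorm (y - x) * e)).
  apply: le_trans (ler_norm_sum _ _ _) _; apply: ler_sum => i _.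
  rewrite normrM ler_pM//; first exact: normr_entry_le_enorm.
  by have := hr z zr i; rewrite !mxE => /ltW.
rewrite sumr_const card_ord -mulr_natr (_ : _ * _ = e * d%:R * enorm (y - x)); last by ring.
by rewrite ler_wpM2r ?enorm_ge0// /e mulrAC ler_pdivrMr// ler_pM2l// ler_nat.
Qed.

(** One axis [G] and one radius serve all base points x near p; this uniformity is what the
    compactness argument consumes. *)
Definition cone_at (A : set 'cV[R]_d) p (eps : R) := exists2 G : 'cV[R]_d, G != 0 &
  exists2 r, 0 < r & forall x y, enorm (x - p) < r -> enorm (y - p) < r -> A x ->
    dot G (y - x) <= - (eps * enorm G * enorm (y - x)) -> A y.

Lemma interior_cone_at (A : set 'cV[R]_d) p eps : (0 < d)%N -> nbhs p A -> cone_at A p eps.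
Proof.
move=> d0 /nbhs_enorm_lt[r r0 rA]; exists (delta_mx (Ordinal d0) 0).
  by apply/eqP => /matrixP/(_ (Ordinal d0) 0); rewrite !mxE !eqxx => /eqP; rewrite oner_eq0.
by exists r => // x y _ yr _ _; exact: rA.
Qed.

Lemma dot_unit v : enorm v = 1 -> dot v v = 1.
Proof. by move=> v1; rewrite -enorm2 v1 expr1n. Qed.

(* The gradient at p of [height v g] is G = v - c + (c . v) v, where c is the
   gradient of g at the foot of p, and G . v = 1. *)
Lemma graph_cone_at (A : set 'cV[R]_d) p v g eps : closed A -> c1_graph_at A p v g ->
  0 < eps -> cone_at A p eps.
Proof.
move=> Acl [v1 cg near_p] eps0; have vv := dot_unit v1.
pose T u := u - dot v u *: v.
pose c := gradient g (T p).
pose G := v - c + dot c v *: v.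
have Gv : dot G v = 1 by rewrite /G !dotDl dotNl dotZl vv; ring.
have G0 : G != 0.
  by apply/eqP => G0; move: Gv; rewrite G0 -(scale0r v) dotZl mul0r => /eqP; rewrite eq_sym oner_eq0.
have Gn : 0 < enorm G by rewrite enorm_gt0.
have TB x y : T y - T x = T (y - x).
  by rewrite /T dotDr dotNr; apply/matrixP => i j; rewrite !mxE; ring.
have Tn u : enorm (T u) <= 2 * enorm u.
  apply: le_trans (ler_enormB _ _) _; rewrite enormZ v1 mulr1 mulr_natl mulr2n lerD2l.
  by apply: le_trans (ler_normr_dot _ _) _; rewrite v1 mul1r.
have GT u : dot G u = dot v u - dot (T u) c.
  rewrite /G /T !dotDl dotNl dotZl dotNl dotZl (dotC c u) (dotC c v); ring.
exists G => //.
have [r1 r10 hr1] := nbhs_enorm_lt near_p.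
(* The projection satisfies |T u| <= 2 |u|, so strict differentiability is needed with half of eps
   |G|. *)
have ep2 : 0 < eps * enorm G / 2 by rewrite divr_gt0// mulr_gt0.
have [r2 r20 hr2] := c1_strict (T p) cg ep2.
exists (Num.min r1 (r2 / 2)); first by rewrite lt_min r10 divr_gt0.
move=> x y; rewrite !lt_min => /andP[xr1 xr2] /andP[yr1 yr2] Ax Gxy.
have Txr : enorm (T x - T p) < r2.
  by rewrite TB; apply: le_lt_trans (Tn _) _; rewrite mulrC -ltr_pdivlMr.
have Tyr : enorm (T y - T p) < r2.
  by rewrite TB; apply: le_lt_trans (Tn _) _; rewrite mulrC -ltr_pdivlMr.
have := hr2 _ _ Txr Tyr; rewrite TB -/c => gxy.
(* Near p, A is the set where the height is nonpositive: a point of A is interior or on the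
   boundary, and A is closed. *)
have hx : height v g x <= 0.
  have [ix bx] := hr1 x xr1.
  have [xi|xi] := pselect (A° x); first by apply: ltW; exact/ix.
  by rewrite le_eqVlt; apply/orP; left; apply/eqP/bx; split => //; exact: subset_closure.
have hy : height v g y <= 0.
  apply: le_trans hx; rewrite /height -/(T x) -/(T y).
  have e := GT (y - x).
  have e2 : dot v (y - x) = dot v y - dot v x by rewrite dotDr dotNr.
  have h := Tn (y - x).
  have : eps * enorm G / 2 * enorm (T (y - x)) <= eps * enorm G / 2 * (2 * enorm (y - x)).
    by rewrite ler_wpM2l// ltW.
  move: gxy; rewrite ler_norml => /andP[+ _].
  by lra.
have [iy by_] := hr1 y yr1.
apply: Acl; move: hy; rewrite le_eqVlt => /orP[/eqP/by_[]//|/iy yi].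
by apply: subset_closure; exact: interior_subset yi.
Qed.

Lemma c1_cone_at (A : set 'cV[R]_d) p eps : (0 < d)%N -> closed A ->
  (forall x, boundary A x -> exists n, outer_normal A x n) ->
  A p -> 0 < eps -> cone_at A p eps.
Proof.
move=> d0 Acl hn Ap eps0; have [pi|pi] := pselect (A° p).
  exact: interior_cone_at.
have [|n [v [g [gr _]]]] := hn p; first by split => //; exact: subset_closure.
exact: graph_cone_at gr eps0.
Qed.

End c1_geometry.

(** * Mean acceptance rates for large and for small proposals *)

Section acceptance_rate.
Context {R : realType} {d : nat}.
Variables (target q : 'cV[R]_d -> R) (qhat : R -> R) (Q : probability 'cV[R]_d R).
Variables (m D : R).
Hypotheses (d_gt0 : (0 < d)%N)
  (mtarget : measurable_fun setT target) (target_ge0 : forall x, 0 <= target x)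
  (mq : measurable_fun setT q) (q_ge0 : forall x, 0 <= q x)
  (QE : forall A, measurable A -> Q A = (\int[lebesgue_cV d]_(x in A) (q x)%:E)%E)
  (qE : forall z, q z = qhat (enorm z))
  (qhat_gt0 : forall x, 0 <= x -> 0 < qhat x)
  (qhat_decr : forall x y, 0 <= x -> x <= y -> qhat y <= qhat x)
  (m_gt0 : 0 < m) (target_ge : forall x, target x != 0 -> m <= target x)
  (diam_le : forall x y, target x != 0 -> target y != 0 -> enorm (x - y) <= D)
  (supportP : forall x, dsupport target x <-> target x != 0)
  (target_compact : compact (dsupport target))
  (target_continuous : {within dsupport target, continuous target})
  (normals : forall x, boundary (dsupport target) x -> exists n, outer_normal (dsupport target) x n).
Local Notation acc := (acc target).

Lemma bmf_acc_lin x (L : 'M[R]_d) : bmf (fun w => acc x (x + L *m w)).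
Proof.
apply: (bmf_comp (h := fun w : 'cV[R]_d => (x, x + L *m w))) (bmf_acc mtarget target_ge0).
apply: measurable_fun_pair => //.
by apply: measurable_mxD => //; exact: measurable_mulmx.
Qed.

(** When |w| > r, the choice of [a0] gives |L w| >= |D| + 1 > D, so the proposal leaves the support.
    The acceptance rate is thus at most the mass of a small ball. *)
Lemma acceptance_large (eta : R) : 0 < eta -> exists2 a0 : R, 0 < a0 &
  forall x (L : 'M[R]_d), target x != 0 -> (forall v, a0 * enorm v <= enorm (L *m v)) ->
    \int[Q]_w acc x (x + L *m w) <= eta.
Proof.
move=> eta0; have [r r0 Qr] := Q_eball_small d_gt0 mq q_ge0 QE qE qhat_gt0 qhat_decr eta0.
pose a0 := (`|D| + 1) / r.
have a00 : 0 < a0 by rewrite divr_gt0// ltr_wpDl.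
exists a0 => // x L tx aL.
have me := @measurable_eball R d r.
apply: (@le_trans _ _ (\int[Q]_w (\1_(eball r) w : R))).
  apply: ER_le; [exact: bmf_acc_lin|exact: bmf_indic|] => w.
  rewrite indicE; case: (boolP (w \in eball r)) => [_|]; first exact: acc_le1.
  rewrite notin_setE /eball /= => /negP; rewrite -ltNge => wr.
  have [ty|ty] := eqVneq (target (x + L *m w)) 0; first by rewrite acc_out.
  have := diam_le ty tx; rewrite addrC addKr => /(le_trans (aL w)) h.
  suff : D < a0 * enorm w by rewrite ltNge h.
  apply: (@lt_le_trans _ _ (`|D| + 1)); first by apply: le_lt_trans (ler_norm _) _; rewrite ltrDl.
  by rewrite /a0 mulrAC ler_pdivlMr// ler_wpM2l ?addr_ge0// ltW.
rewrite ER_indic// -lee_fin fineK//; exact: fin_num_measure.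
Qed.

Lemma target_near p (e : R) : target p != 0 -> 0 < e -> exists2 r, 0 < r &
  forall x, enorm (x - p) < r -> target x != 0 -> `|target x - target p| < e.
Proof.
move=> tp e0; apply: (@nbhs_enorm_lt _ _ p [set x | target x != 0 -> `|target x - target p| < e]).
have /subspace_continuousP/(_ p) := target_continuous.
move=> /(_ (proj2 (supportP p) tp))/cvgrPdist_lt/(_ _ e0).
rewrite near_withinE; apply: filterS => x h tx; rewrite distrC; apply: h.
exact/supportP.
Qed.

Lemma acc_near p (eta : R) : target p != 0 -> 0 < eta < 1 -> exists2 r, 0 < r &
  forall x y, enorm (x - p) < r -> enorm (y - p) < r -> target x != 0 -> target y != 0 ->
    1 - eta <= acc x y.
Proof.
move=> tp /andP[eta0 eta1]; have em : 0 < eta * m / 2 by rewrite divr_gt0// mulr_gt0.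
have [r r0 hr] := target_near tp em; exists r => // x y xr yr tx ty.
have := hr x xr tx; have := hr y yr ty; rewrite !ltr_norml => /andP[h1 h2] /andP[h3 h4].
have x0 : 0 < target x by apply: lt_le_trans m_gt0 _; exact: target_ge.
have mp := target_ge tp.
rewrite /acc le_min lerBlDr lerDl ltW//= ler_pdivlMr//.
have := ler_wpM2l (ltW eta0) mp; have := mulr_gt0 eta0 em.
have : (1 - eta) * target x <= (1 - eta) * (target p + eta * m / 2).
  by rewrite ler_wpM2l ?subr_ge0 ?ltW//; lra.
by lra.
Qed.

(** For symmetric L, [dot G (L *m w)] is [dot (L *m G) w], so w in a half cone about L G puts the
    proposal in the cone about G contained in the support. Distortion by L costs the factor kappa in
    the aperture, compensated in advance by taking the geometric cone with eps / kappa. *)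
Lemma local_acceptance p (kappa alpha : R) : target p != 0 -> 0 < kappa -> alpha < 2^-1 ->
  exists2 r0 : R, 0 < r0 & exists2 b0 : R, 0 < b0 &
  forall x, enorm (x - p) < r0 -> target x != 0 -> forall (L : 'M[R]_d) a b,
    L^T = L -> 0 < a -> b <= kappa * a -> b <= b0 ->
    (forall v, a * enorm v <= enorm (L *m v)) -> (forall v, enorm (L *m v) <= b * enorm v) ->
    alpha <= \int[Q]_w acc x (x + L *m w).
Proof.
(* Three losses of order eta occur: in the half cone, outside a large ball, and in the acceptance
   probability. The product (1 - eta) ((1 - eta) / 2 - eta) is at least 1/2 - 2 eta, hence at least
   alpha. *)
move=> tp k0 alpha2; pose eta := Num.min ((2^-1 - alpha) / 2) 2^-1.
have eta0 : 0 < eta by rewrite lt_min invr_gt0// ltr0n andbT divr_gt0// subr_gt0.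
have eta2 : eta <= 2^-1 by rewrite /eta ge_min lexx orbT.
have etaa : eta <= (2^-1 - alpha) / 2 by rewrite /eta ge_min lexx.
have [eps eps0 hcone] := Q_half_cone d_gt0 mq q_ge0 QE qE qhat_gt0 qhat_decr eta0.
have [r r0 Qr] := Q_eball_large Q eta0.
have [G G0 [r1 r10 hG]] : cone_at (dsupport target) p (eps / kappa).
  apply: c1_cone_at => //; [exact: closed_closure|exact/supportP|exact: divr_gt0].
have [|r2 r20 hacc] := acc_near (eta := eta) tp; first by rewrite eta0/=; lra.
pose rho := Num.min r1 r2; have rho0 : 0 < rho by rewrite lt_min r10.
exists (rho / 2); first exact: divr_gt0.
(* On the ball of radius r this gives |L w| <= rho / 2, so that x + L w stays within rho of p. *)
exists (rho / 2 / r); first by rewrite !divr_gt0.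
move=> x xp tx L a b LT a0 bka bb0 aL bL.
have Gn : 0 < enorm G by rewrite enorm_gt0.
pose u := L *m G.
have un : a * enorm G <= enorm u := aL G.
have u0 : u != 0 by rewrite -enorm_gt0; apply: lt_le_trans un; rewrite mulr_gt0.
have mH := measurable_half_cone u eps; have mE := @measurable_eball R d r.
pose B := half_cone u eps `&` eball r.
have mB : measurable B by exact: measurableI.
have QB : (1 - eta) / 2 - eta <= fine (Q B).
  have mEC : measurable (~` eball r : set 'cV[R]_d) by exact: measurableC.
  have h1 : (Q (half_cone u eps) <= Q B + Q (~` eball r))%E.
    apply: le_trans (measureU2 Q mB mEC); apply: le_measure; rewrite ?inE//.
      exact: measurableU.
    by move=> w hw; have [wE|wE] := pselect (eball r w); [left|right].
  have h2 : (Q (~` eball r) <= eta%:E)%E.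
    rewrite probability_setC//; move: Qr.
    by rewrite -(fineK (fin_num_measure Q _ mE)) -EFinB !lee_fin; lra.
  have := le_trans (hcone u u0) (le_trans h1 (leeD2l _ h2)).
  by rewrite -(fineK (fin_num_measure Q _ mB)) -EFinD lee_fin; lra.
have b0 : 0 <= b.
  by have := le_trans (aL G) (bL G); rewrite ler_pM2r// => /(le_trans (ltW a0)).
apply: (@le_trans _ _ ((1 - eta) * fine (Q B))).
  have : (1 - eta) * ((1 - eta) / 2 - eta) <= (1 - eta) * fine (Q B).
    by rewrite ler_wpM2l// subr_ge0; lra.
  apply: le_trans; have := sqr_ge0 eta; rewrite expr2; lra.
rewrite -ER_indic// -ERZl; last exact: bmf_indic.
apply: ER_le; [by apply: bmfZ; exact: bmf_indic|exact: bmf_acc_lin|] => w.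
rewrite indicE; case: (boolP (w \in B)) => [|_]; last by rewrite mulr0 acc_ge0.
rewrite inE mulr1 /B /half_cone /eball /= => -[hw wr].
set y := x + L *m w.
have yx : y - x = L *m w by rewrite /y addrC addKr.
have Lw : enorm (L *m w) <= rho / 2.
  apply: le_trans (bL w) _; apply: (@le_trans _ _ (rho / 2 / r * r)); last by rewrite divfK// gt_eqF.
  by apply: ler_pM => //; exact: enorm_ge0.
have xr : enorm (x - p) < rho by apply: lt_le_trans xp _; rewrite ler_pdivrMr// ler_pMr// ler1n.
have yr : enorm (y - p) < rho.
  rewrite (_ : y - p = (x - p) + L *m w); last by rewrite /y addrAC.
  by apply: le_lt_trans (ler_enormD _ _) _; lra.
have [xr1 xr2] : enorm (x - p) < r1 /\ enorm (x - p) < r2.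
  by move: xr; rewrite /rho lt_min => /andP[].
have [yr1 yr2] : enorm (y - p) < r1 /\ enorm (y - p) < r2.
  by move: yr; rewrite /rho lt_min => /andP[].
apply: hacc => //; apply/supportP; apply: (hG x y) => //; first exact/supportP.
(* It remains to chain (eps / kappa) |G| |L w| <= (eps / kappa) |G| b |w| <= eps a |G| |w| <= eps |L
   G| |w|. *)
rewrite yx dot_mulmx_sym//; apply: le_trans hw _; rewrite lerN2.
have Lwb := bL w; have wn := enorm_ge0 w.
have cc : 0 <= eps / kappa * enorm G by rewrite mulr_ge0 ?divr_ge0// ltW.
have : eps / kappa * enorm G * enorm (L *m w) <= eps / kappa * enorm G * (b * enorm w).
  exact: ler_wpM2l.
move=> /le_trans; apply.
have : eps / kappa * enorm G * (b * enorm w) <= eps / kappa * enorm G * (kappa * a * enorm w).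
  by rewrite (ler_wpM2l cc)// ler_wpM2r.
move=> /le_trans; apply.
rewrite (_ : _ * _ = eps * (a * enorm G) * enorm w); last by field; rewrite gt_eqF.
by rewrite ler_wpM2r// ler_wpM2l// ltW.
Qed.

Lemma acceptance_small (kappa alpha : R) : 0 < kappa -> alpha < 2^-1 ->
  exists2 b0 : R, 0 < b0 & forall x, target x != 0 -> forall (L : 'M[R]_d) a b,
    L^T = L -> 0 < a -> b <= kappa * a -> b <= b0 ->
    (forall v, a * enorm v <= enorm (L *m v)) -> (forall v, enorm (L *m v) <= b * enorm v) ->
    alpha <= \int[Q]_w acc x (x + L *m w).
Proof.
move=> k0 alpha2.
pose Pr (b0 : R) x := target x != 0 -> forall (L : 'M[R]_d) a b,
    L^T = L -> 0 < a -> b <= kappa * a -> b <= b0 ->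
    (forall v, a * enorm v <= enorm (L *m v)) -> (forall v, enorm (L *m v) <= b * enorm v) ->
    alpha <= \int[Q]_w acc x (x + L *m w).
(* Compactness as a near-covering property, with b0 tending to 0 from the right as parameter: each
   point p supplies a neighbourhood and a threshold below which the bound holds. *)
have /compact_near_coveringP/(_ R (0^'+) Pr) := target_compact.
case=> [p /supportP tp|].
  have [r0 r00 [b0 b00 h]] := local_acceptance tp k0 alpha2.
  exists ([set x | enorm (x - p) < r0], [set b | b <= b0]) => /=.
    split; first exact: near_enorm_lt.
    by near=> b; rewrite /= ltW//; near: b; exact: nbhs_right_lt.
  move=> [x b'] /= [xp bb'] tx L a b LT a0 bka bb aL bL.
  by apply: (h x xp tx L a b) => //; exact: le_trans bb'.
move=> e /= e0 he; exists (e / 2); first by rewrite divr_gt0.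
move=> x tx; apply: (he (e / 2)) => //=; last exact/supportP.
- by rewrite sub0r normrN gtr0_norm ?divr_gt0// ltr_pdivrMr// ltr_pMr// ltr1n.
- by rewrite divr_gt0.
Unshelve. all: by end_near. Qed.

End acceptance_rate.

(** * The filtration of the driving noise *)

Definition adapted {dO} {Omega : measurableType dO} (G : set (set Omega)) {dT}
    {T : measurableType dT} (Y : Omega -> T) : Prop :=
  forall A, measurable A -> (<<s G >>) (Y @^-1` A).

Section adapted_functions.
Context {dO : measure_display} {Omega : measurableType dO} (G : set (set Omega)).
Implicit Types (dT : measure_display).

Lemma adaptedP dT (T : measurableType dT) (Y : Omega -> T) :
  adapted G Y <-> measurable_fun (T := g_sigma_algebraType G) setT Y.
Proof.
split=> [aY _ A mA|mY A mA]; first by rewrite setTI; exact: aY.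
by have := mY measurableT _ mA; rewrite setTI.
Qed.

Lemma adapted_cst dT (T : measurableType dT) (c : T) : adapted G (fun _ => c).
Proof. by apply/adaptedP; exact: measurable_cst. Qed.

Lemma adapted_comp dT (T : measurableType dT) dT' (T' : measurableType dT')
    (h : T -> T') (Y : Omega -> T) :
  measurable_fun setT h -> adapted G Y -> adapted G (fun w => h (Y w)).
Proof.
by move=> mh aY A mA; apply: (aY (h @^-1` A)); rewrite -[X in measurable X]setTI; exact: mh.
Qed.

Lemma adapted_pair dT (T : measurableType dT) dT' (T' : measurableType dT')
    (Y : Omega -> T) (Z : Omega -> T') :
  adapted G Y -> adapted G Z -> adapted G (fun w => (Y w, Z w)).
Proof.
by move=> /adaptedP aY /adaptedP aZ; apply/adaptedP; exact: measurable_fun_pair.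
Qed.

Lemma adapted_if dT (T : measurableType dT) (A : set Omega) (Y Z : Omega -> T) :
  (<<s G >>) A -> adapted G Y -> adapted G Z ->
  adapted G (fun w => if `[< A w >] then Y w else Z w).
Proof.
move=> mA /adaptedP aY /adaptedP aZ; apply/adaptedP.
apply: measurable_fun_if => //; last 2 first.
- exact: measurable_funTS.
- exact: measurable_funTS.
apply: (@measurable_fun_bool _ (g_sigma_algebraType G) _ _ true).
rewrite setTI (_ : _ @^-1` _ = A)//.
by apply/seteqP; split=> w /=; [move=> /asboolP|move=> /asboolP ->].
Qed.

Lemma sub_adapted (G' : set (set Omega)) dT (T : measurableType dT) (Y : Omega -> T) :
  (<<s G >>) `<=` (<<s G' >>) -> adapted G Y -> adapted G' Y.
Proof. by move=> GG' aY A mA; exact: (GG' _ (aY _ mA)). Qed.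

Lemma adapted_measurable dT (T : measurableType dT) (Y : Omega -> T) :
  (<<s G >>) `<=` measurable -> adapted G Y -> measurable_fun setT Y.
Proof. by move=> Gm aY _ A mA; rewrite setTI; exact: (Gm _ (aY _ mA)). Qed.

End adapted_functions.

Section history.
Context {R : realType} {dO : measure_display} {Omega : measurableType dO} (d : nat).
Variables (P : probability Omega R) (q : 'cV[R]_d -> R)
  (W : nat -> {RV P >-> 'cV[R]_d}) (U : nat -> {RV P >-> R}).
Hypothesis noise : driving_noise q W U.

Let noise_events (k : nat + nat) : set (set Omega) :=
  match k with
  | inl n => preimage_set_system setT (W n.+2) measurable
  | inr n => preimage_set_system setT (U n.+2) measurable
  end.

Let past k : seq (nat + nat) := map inl (iota 0 k) ++ map inr (iota 0 k).

Let mem_past_l k i : (inl i \in past k) = (i < k)%N.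
Proof.
rewrite mem_cat (mem_map (@inl_inj _ _)) mem_iota add0n/=.
by case: (i < k)%N => //=; apply/mapP => -[].
Qed.

Let mem_past_r k i : (inr i \in past k) = (i < k)%N.
Proof.
rewrite mem_cat (mem_map (@inr_inj _ _)) mem_iota add0n/= orbC.
by case: (i < k)%N => //=; apply/mapP => -[].
Qed.

Let uniq_past k : uniq (past k).
Proof.
rewrite cat_uniq !map_inj_uniq ?iota_uniq//; last 2 first.
- exact: inr_inj.
- exact: inl_inj.
by rewrite andbT/=; apply/hasPn => i /mapP[j _ ->]; apply/mapP => -[].
Qed.

(* A pi-system generating the events known after k steps, i.e. once the
   variables W_2, ..., W_(k+1) and U_2, ..., U_(k+1) have been drawn. *)
Definition history k : set (set Omega) :=
  [set A | exists2 E, forall i, i \in past k -> noise_events i (E i) &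
     A = \big[setI/setT]_(i <- past k) E i].

Let noise_eventsT i : noise_events i setT.
Proof. by case: i => i; exists setT => //; rewrite preimage_setT setTI. Qed.

Let noise_eventsI i A B : noise_events i A -> noise_events i B -> noise_events i (A `&` B).
Proof.
case: i => i [A' mA <-] [B' mB <-]; exists (A' `&` B'); rewrite ?setTI ?preimage_setI//;
  exact: measurableI.
Qed.

Let noise_events_measurable i A : noise_events i A -> measurable A.
Proof. by case: i => i [A' mA <-]; exact: measurable_funP. Qed.

Let big_setI_in (s : seq (nat + nat)) (E E' : nat + nat -> set Omega) :
  {in s, E =1 E'} ->
  \big[setI/setT]_(i <- s) E i = \big[setI/setT]_(i <- s) E' i.
Proof. by move=> EE'; apply: eq_big_seq. Qed.

Lemma history_setI k : setI_closed (history k).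
Proof.
move=> _ _ [E hE ->] [E' hE' ->]; exists (fun i => E i `&` E' i); last by rewrite -big_split.
by move=> i ik; apply: noise_eventsI; [exact: hE|exact: hE'].
Qed.

Lemma history_measurable k : (<<s history k >>) `<=` measurable.
Proof.
apply: smallest_sub; first exact: sigma_algebra_measurable.
move=> _ [E hE ->]; rewrite big_seq; elim/big_ind: _ => //.
- by move=> A B; exact: measurableI.
- by move=> i ik; exact: noise_events_measurable (hE i ik).
Qed.

Let big_setI_single (s : seq (nat + nat)) i (A : set Omega) : uniq s -> i \in s ->
  \big[setI/setT]_(j <- s) (if j == i then A else setT) = A.
Proof.
move=> us si; rewrite (bigD1_seq i)//= eqxx big1 ?setIT// => j /negPf ->.
by [].
Qed.

Let history_generator k i A : i \in past k -> noise_events i A -> (<<s history k >>) A.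
Proof.
move=> ik hA; apply: sub_sigma_algebra.
exists (fun j => if j == i then A else setT); last by rewrite big_setI_single.
by move=> j jk; case: eqP => [->|] //.
Qed.

Lemma adapted_W k : adapted (history k.+1) (W k.+2).
Proof.
move=> A mA; apply: (@history_generator _ (inl k)); first by rewrite mem_past_l.
by exists A => //; rewrite setTI.
Qed.

Lemma adapted_U k : adapted (history k.+1) (U k.+2).
Proof.
move=> A mA; apply: (@history_generator _ (inr k)); first by rewrite mem_past_r.
by exists A => //; rewrite setTI.
Qed.

Lemma history_incr k : (<<s history k >>) `<=` (<<s history k.+1 >>).
Proof.
apply: smallest_sub; first exact: smallest_sigma_algebra.
move=> _ [E hE ->]; apply: sub_sigma_algebra.
exists (fun i => if i \in past k then E i else setT).
  by move=> i _; case: ifPn => // ik; exact: hE.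
rewrite -big_mkcond/= -[RHS]big_filter.
apply: perm_big; apply: uniq_perm; rewrite ?filter_uniq//.
move=> i; rewrite mem_filter; case: (boolP (i \in past k)) => //=.
by case: i => i; rewrite ?mem_past_l ?mem_past_r => ik; rewrite ltnW.
Qed.

Let history_indep_generator k A B C : history k A -> measurable B -> measurable C ->
  P (A `&` (W k.+2 @^-1` B `&` U k.+2 @^-1` C)) =
  (P A * (P (W k.+2 @^-1` B) * P (U k.+2 @^-1` C)))%E.
Proof.
have [_ _ ind] := noise => -[E hE ->] mB mC.
pose E' (i : nat + nat) := if i == inl k then W k.+2 @^-1` B else
  if i == inr k then U k.+2 @^-1` C else E i.
have lk : inl k \notin past k by rewrite mem_past_l ltnn.
have rk : inr k \notin past k by rewrite mem_past_r ltnn.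
have hE' i : i \in past k -> E' i = E i.
  move=> ik; rewrite /E'.
  have [il|_] := eqVneq i (inl k); first by move: lk; rewrite -il ik.
  by have [ir|//] := eqVneq i (inr k); move: rk; rewrite -ir ik.
have E'l : E' (inl k) = W k.+2 @^-1` B by rewrite /E' eqxx.
have E'r : E' (inr k) = U k.+2 @^-1` C by rewrite /E' eqxx.
(* Independence for the longer list splits off the factors of W and U; for [past k] it recombines
   the remaining product into P A. *)
have hind : forall s, (s = past k \/ s = inl k :: inr k :: past k) ->
    P (\big[setI/setT]_(i <- s) E' i) = (\prod_(i <- s) P (E' i))%E.
  move=> s sE; apply: ind.
    by case: sE => ->; rewrite ?uniq_past//= inE lk rk uniq_past.
  move=> i si.
  have [il|il] := eqVneq i (inl k); first by rewrite il E'l; exists B => //; rewrite setTI.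
  have [ir|ir] := eqVneq i (inr k); first by rewrite ir E'r; exists C => //; rewrite setTI.
  have ik : i \in past k by move: si; case: sE => ->; rewrite // !inE (negPf il) (negPf ir).
  by rewrite hE'//; exact: hE.
rewrite -(big_setI_in hE').
have := hind _ (or_intror erefl); rewrite !big_cons -(hind _ (or_introl erefl)) E'l E'r.
by rewrite setIA setIC => ->; rewrite muleA muleC.
Qed.

(** As functions of A both sides are finite measures, a restriction of P and a multiple of P, and
    they agree on the pi-system [history k]. *)
Lemma history_indep k A B C : (<<s history k >>) A -> measurable B -> measurable C ->
  P (A `&` (W k.+2 @^-1` B `&` U k.+2 @^-1` C)) =
  (P A * (P (W k.+2 @^-1` B) * P (U k.+2 @^-1` C)))%E.
Proof.
move=> hA mB mC; set D := _ `&` _ @^-1` _.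
have mD : measurable D by apply: measurableI; exact: measurable_funPTI.
have p0 : 0 <= fine (P (W k.+2 @^-1` B)) * fine (P (U k.+2 @^-1` C)) by rewrite mulr_ge0// fine_ge0.
have pE : (P (W k.+2 @^-1` B) * P (U k.+2 @^-1` C))%E = (NngNum p0)%:num%:E.
  by rewrite /= EFinM !fineK ?fin_num_measure//; exact: measurable_funPTI.
rewrite pE muleC.
have := @g_sigma_algebra_measure_unique _ _ _ (history k) _ (fun=> setT) _ _
  (mrestr P mD) (mscale (NngNum p0) P) (@history_setI k) _ _ A hA.
apply => //.
- by move=> B' hB'; apply: (@history_measurable k); exact: sub_sigma_algebra.
- by move=> _; exists (fun=> setT) => [i _|]; [exact: noise_eventsT|rewrite big1].
- by rewrite bigcup_const.
- move=> A' hA'; rewrite /mrestr /mscale/= [LHS](history_indep_generator hA' mB mC).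
  by rewrite pE muleC.
- by move=> _; change (P (setT `&` D) < +oo)%E; rewrite setTI; apply: le_lt_trans (probability_le1 _ mD) (ltry 1).
Qed.

End history.

(** * Integrating out the fresh noise *)

Section fresh_noise.
Context {R : realType} {dO : measure_display} {Omega : measurableType dO} (d : nat).
Variables (P : probability Omega R) (q : 'cV[R]_d -> R)
  (W : nat -> {RV P >-> 'cV[R]_d}) (U : nat -> {RV P >-> R}).
Variables (Q : probability 'cV[R]_d R) (Un : probability R R).
Hypothesis noise : driving_noise q W U.
Hypothesis QE : forall A, measurable A ->
  Q A = (\int[lebesgue_cV d]_(z in A) (q z)%:E)%E.
Hypothesis UnE : forall A, measurable A -> Un A = uniform_prob (@ltr01 R) A.

Local Notation history := (history W U).

(** For a fixed A both sides are measures in B which agree on rectangles. *)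
Let fresh_indep k (A : set Omega) B : (<<s history k >>) A -> measurable B ->
  P (A `&` (fun w => (W k.+2 w, U k.+2 w)) @^-1` B) = (P A * (Q \x Un) B)%E.
Proof.
move=> hA mB; have mA : measurable A := history_measurable hA.
have mWU : measurable_fun setT (fun w => (W k.+2 w, U k.+2 w)) by exact: measurable_fun_pair.
have c0 : 0 <= fine (P A) by rewrite fine_ge0.
pose c := NngNum c0.
have cE : P A = c%:num%:E by rewrite /= fineK// fin_num_measure.
have [lW lU _] := noise.
transitivity ((mscale c Q \x Un) B)%E.
  apply/esym; rewrite setIC.
  transitivity (pushm (mrestr P mA) mWU B); last by [].
  have huniq := @product_measure_unique _ _ _ _ _ (mscale c Q) Un (pushm (mrestr P mA) mWU).
  apply: (huniq _ B mB) => B1 B2 m1 m2.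
  rewrite [LHS](_ : _ = P (A `&` (W k.+2 @^-1` B1 `&` U k.+2 @^-1` B2))); last first.
    by rewrite setIC.
  rewrite (history_indep noise hA m1 m2) lW// lU// -QE// -UnE// muleA; congr (_ * _)%E.
  by rewrite cE.
rewrite cE [LHS]ge0_integral_mscale//.
exact: measurable_fun_xsection.
Qed.

(** The past is the identity map of Omega, viewed as a random variable with values in Omega equipped
    with the sigma-algebra of the history. It is independent of the new pair (W, U), so
    [ER_independent] applies, and h may depend on the past in any measurable way. *)
Lemma ER_fresh k (h : g_sigma_algebraType (history k) * ('cV[R]_d * R) -> R) : bmf h ->
  \int[P]_o h (o, (W k.+2 o, U k.+2 o)) = \int[P]_o \int[Q]_w \int[Un]_u h (o, (w, u)).
Proof.
move=> bh.
have mid : measurable_fun (U := g_sigma_algebraType (history k)) setT (fun o : Omega => o).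
  by move=> _ A mA; rewrite setTI; exact: history_measurable mA.
pose past : {mfun Omega >-> g_sigma_algebraType (history k)} :=
  HB.pack (fun o : Omega => o) (isMeasurableFun.Build _ _ _ _ _ mid).
have mWU : measurable_fun setT (fun w => (W k.+2 w, U k.+2 w)) by exact: measurable_fun_pair.
rewrite (ER_independent (P1 := distribution P past) (P2 := (Q \x Un)%E) bh mid mWU); last first.
  by move=> A B mA mB; rewrite [LHS](fresh_indep mA mB).
rewrite (ER_transfer (P := P) (Q := distribution P past) mid)//; last first.
  exact: (bmf_fubini1 (distribution P past) (Q \x Un)%E bh).
apply: eq_Rintegral => o _; rewrite [LHS](ER_prod1 Q Un)//; exact: bmf_pair1.
Qed.

End fresh_noise.

Lemma uniform_prob_le {R : realType} (a : R) : 0 <= a <= 1 ->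
  uniform_prob (@ltr01 R) `]-oo, a]%classic = a%:E.
Proof.
move=> /andP[a0 a1]; rewrite /uniform_prob integral_uniform_pdf.
  rewrite (eq_integral (fun=> 1%:E)); last first.
    by move=> u; rewrite inE/= => -[_]; rewrite /= in_itv/= => u01; rewrite /uniform_pdf u01 subr0 invr1.
  rewrite (_ : _ `&` _ = `[0, a]%classic); last first.
    apply/seteqP; split=> u /=; rewrite !in_itv/=; first by move=> [-> /andP[-> _]].
    by move=> /andP[-> ua]; rewrite ua (le_trans ua).
  rewrite integral_cst//= mul1e lebesgue_measure_itv/= lte_fin.
  by case: ltgtP a0 => // [_ _|<- _]; rewrite ?sube0 ?sub0e.
Qed.

Lemma ER_uniform {R : realType} (Un : probability R R) (a x y : R) :
  (forall A, measurable A -> Un A = uniform_prob (@ltr01 R) A) -> 0 <= a <= 1 ->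
  \int[Un]_u (if u <= a then x else y) = (1 - a) * y + a * x.
Proof.
move=> UnE a01.
have mA : measurable (`]-oo, a] : set R) by exact: measurable_itv.
have UnA : Un `]-oo, a]%classic = a%:E by rewrite UnE// uniform_prob_le.
rewrite (@eq_Rintegral _ _ _ Un setT (fun u => y + (x - y) * \1_(`]-oo, a]%classic) u)); last first.
  move=> u _; rewrite indicE; case: ifPn => ua.
    have -> : u \in `]-oo, a]%classic by apply/mem_set; rewrite /= in_itv.
    by rewrite mulr1 subrKC.
  have /negPf -> : u \notin `]-oo, a]%classic by apply/negP => /set_mem; rewrite /= in_itv/=; exact/negP.
  by rewrite mulr0 addr0.
rewrite (ERD Un (bmf_cst y) (bmfZ (x - y) (bmf_indic mA))) ER_cst.
rewrite (ERZl Un (x - y) (bmf_indic mA)) ER_indic// UnA/=; ring.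
Qed.

Section one_step.
Context {R : realType} {dO : measure_display} {Omega : measurableType dO} {d : nat}.
Variables (P : probability Omega R) (target q : 'cV[R]_d -> R)
  (W : nat -> {RV P >-> 'cV[R]_d}) (U : nat -> {RV P >-> R}).
Variables (Q : probability 'cV[R]_d R) (Un : probability R R).
Hypotheses (noise : driving_noise q W U)
  (QE : forall A, measurable A -> Q A = (\int[lebesgue_cV d]_(z in A) (q z)%:E)%E)
  (UnE : forall A, measurable A -> Un A = uniform_prob (@ltr01 R) A)
  (mtarget : measurable_fun setT target) (target_ge0 : forall x, 0 <= target x).

Local Notation history := (history W U).
Local Notation acc := (acc target).

Definition mh_move (z : ('M[R]_d * 'cV[R]_d) * ('cV[R]_d * R)) : 'cV[R]_d :=
  let y := z.1.2 + z.1.1 *m z.2.1 in if z.2.2 <= acc z.1.2 y then y else z.1.2.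

Let measurable_move_proposal : measurable_fun setT
  (fun z : ('M[R]_d * 'cV[R]_d) * ('cV[R]_d * R) => z.1.2 + z.1.1 *m z.2.1).
Proof.
apply: (measurableT_comp (f := fun p : ('M[R]_d * 'cV[R]_d) * 'cV[R]_d => p.1.2 + p.1.1 *m p.2)
  (g := fun z : ('M[R]_d * 'cV[R]_d) * ('cV[R]_d * R) => (z.1, z.2.1))).
  exact: measurable_proposal.
by apply: measurable_fun_pair => //; exact: (measurableT_comp measurable_fst measurable_snd).
Qed.

Lemma bmf_move_acc : bmf (fun z : ('M[R]_d * 'cV[R]_d) * ('cV[R]_d * R) =>
  acc z.1.2 (z.1.2 + z.1.1 *m z.2.1)).
Proof.
apply: (bmf_comp (h := fun z : ('M[R]_d * 'cV[R]_d) * ('cV[R]_d * R) =>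
  (z.1.2, z.1.2 + z.1.1 *m z.2.1)) _ (bmf_acc mtarget target_ge0)).
apply: measurable_fun_pair => //.
exact: (measurableT_comp measurable_snd measurable_fst).
Qed.

Let measurable_accept : measurable_fun setT
  (fun z : ('M[R]_d * 'cV[R]_d) * ('cV[R]_d * R) =>
     z.2.2 <= acc z.1.2 (z.1.2 + z.1.1 *m z.2.1)).
Proof.
apply: measurable_fun_ler; last exact: bmf_meas bmf_move_acc.
exact: (measurableT_comp measurable_snd measurable_snd).
Qed.

Lemma measurable_mh_move : measurable_fun setT mh_move.
Proof.
apply: measurable_fun_ifT => //.
exact: (measurableT_comp measurable_snd measurable_fst).
Qed.

(** The Markov property: given the past, the mean of h after one move is [mh h]. Conditioning is
    expressed by the arbitrary bounded factor [Y] measurable with respect to the history. *)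
Lemma ER_mh_move (L : nat -> Omega -> 'M[R]_d) (X : nat -> Omega -> 'cV[R]_d) k
    (Y : g_sigma_algebraType (history k) -> R) (h : 'M[R]_d * 'cV[R]_d -> R) :
  adapted (history k) (L k) -> adapted (history k) (X k) -> bmf Y -> bmf h ->
  \int[P]_o (Y o * h (L k o, mh_move ((L k o, X k o), (W k.+2 o, U k.+2 o)))) =
  \int[P]_o (Y o * mh target Q h (L k o, X k o)).
Proof.
move=> /adaptedP aL /adaptedP aX bY bh.
pose H (z : g_sigma_algebraType (history k) * ('cV[R]_d * R)) : R :=
  Y z.1 * h (L k z.1, mh_move ((L k z.1, X k z.1), z.2)).
have mp : measurable_fun setT (fun z : g_sigma_algebraType (history k) * ('cV[R]_d * R) =>
    ((L k z.1, X k z.1), z.2)).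
  apply: measurable_fun_pair => //; apply: measurable_fun_pair.
    by apply: (measurableT_comp aL).
  by apply: (measurableT_comp aX).
have bH : bmf H.
  apply: bmfM; first exact: (bmf_comp measurable_fst bY).
  apply: (bmf_comp _ bh); apply: measurable_fun_pair.
    by apply: (measurableT_comp aL).
  exact: (measurableT_comp measurable_mh_move mp).
rewrite [LHS](ER_fresh noise QE UnE bH); apply: eq_Rintegral => o _.
rewrite /H/= /mh -ERZl; last exact: bmf_mh_integrand1.
apply: eq_Rintegral => w _; rewrite ERZl; last first.
  apply: (bmf_comp (h := fun u => (L k o, mh_move ((L k o, X k o), (w, u))))) bh.
  apply: measurable_fun_pair => //; apply: measurableT_comp measurable_mh_move _.
  by apply: measurable_fun_pair => //; exact: measurable_fun_pair.
congr (_ * _); rewrite /mh_integrand/=.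
rewrite -(ER_uniform _ _ UnE); last by rewrite acc_ge0//= acc_le1.
by apply: eq_Rintegral => u _; rewrite /mh_move/=; case: ifPn.
Qed.

(** The analogue of [ER_mh_move] for the acceptance probability, which drives the scale. *)
Lemma ER_acc_move (L : nat -> Omega -> 'M[R]_d) (X : nat -> Omega -> 'cV[R]_d) k
    (Y : g_sigma_algebraType (history k) -> R) :
  adapted (history k) (L k) -> adapted (history k) (X k) -> bmf Y ->
  \int[P]_o (Y o * acc (X k o) (X k o + L k o *m W k.+2 o)) =
  \int[P]_o (Y o * \int[Q]_w acc (X k o) (X k o + L k o *m w)).
Proof.
move=> /adaptedP aL /adaptedP aX bY.
pose H (z : g_sigma_algebraType (history k) * ('cV[R]_d * R)) : R :=
  Y z.1 * acc (X k z.1) (X k z.1 + L k z.1 *m z.2.1).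
have mp : measurable_fun setT (fun z : g_sigma_algebraType (history k) * ('cV[R]_d * R) =>
    ((L k z.1, X k z.1), z.2)).
  apply: measurable_fun_pair => //; apply: measurable_fun_pair.
    by apply: (measurableT_comp aL).
  by apply: (measurableT_comp aX).
have bH : bmf H.
  apply: bmfM; first exact: (bmf_comp measurable_fst bY).
  exact: (bmf_comp mp bmf_move_acc).
rewrite [LHS](ER_fresh noise QE UnE bH); apply: eq_Rintegral => o _.
rewrite /H/= -ERZl; last first.
  apply: (bmf_comp (h := fun w : 'cV[R]_d => ((L k o, X k o), (w, 0 : R)))) bmf_move_acc.
  by apply: measurable_fun_pair => //; exact: measurable_fun_pair.
by apply: eq_Rintegral => w _; rewrite ER_cst.
Qed.

End one_step.

(** * Law of large numbers for bounded orthogonal variables *)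

Lemma nneseries_lty_cvg0 {R : realType} (u : R^nat) : (forall n, 0 <= u n) ->
  (\sum_(0 <= n <oo) (u n)%:E < +oo)%E -> u @ \oo --> 0.
Proof.
move=> u0 soo; apply: cvg_series_cvg_0; apply: nondecreasing_is_cvgn.
  by apply: nondecreasing_series => n _ _.
exists (fine (\sum_(0 <= n <oo) (u n)%:E)%E) => _ [n _ <-].
rewrite -lee_fin fineK; last first.
  by rewrite ge0_fin_numE//; apply: nneseries_ge0 => k _ _; rewrite lee_fin.
rewrite /series/= -sumEFin; apply: nneseries_lim_ge => k _ _.
by rewrite lee_fin.
Qed.

Lemma sqr_nneseries_lty_cvg0 {R : realType} (u : R^nat) : (forall n, 0 <= u n) ->
  (\sum_(0 <= n <oo) (u n ^+ 2)%:E < +oo)%E -> u @ \oo --> 0.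
Proof.
move=> u0 /(nneseries_lty_cvg0 (fun k => sqr_ge0 (u k)))/cvgrPdist_le h.
apply/cvgrPdist_le => /= e e0; have := h (e ^+ 2); rewrite exprn_gt0// => /(_ isT).
apply: filterS => n /=; rewrite !sub0r !normrN ger0_norm ?sqr_ge0//.
by rewrite (ger0_norm (u0 n)) ler_sqr ?nnegrE// ltW.
Qed.

Lemma sqrtn_floor n : exists m, (m ^ 2 <= n < m.+1 ^ 2)%N.
Proof.
elim: n => [|n [m /andP[mn nm]]]; first by exists 0%N.
have [nm'|nm'] := ltnP n.+1 (m.+1 ^ 2); first by exists m; rewrite nm' leqW.
by exists m.+1; rewrite nm' (leq_ltn_trans nm)// ltn_exp2r.
Qed.

Section orthogonal_lln.
Context {R : realType} {dO : measure_display} {Omega : measurableType dO}.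
Variables (P : probability Omega R) (D : nat -> Omega -> R) (c : R).
Hypotheses (mD : forall k, measurable_fun setT (D k)) (Dc : forall k w, `|D k w| <= c)
  (orth : forall i j, (i < j)%N -> \int[P]_w (D i w * D j w) = 0).

Let T n w : R := \sum_(k < n) D k w.

Let bmf_D k : bmf (D k).
Proof. by split => //; exists c. Qed.

Let bmf_T n : bmf (T n).
Proof. exact: bmf_sum. Qed.

Let c_ge0 : 0 <= c.
Proof. by have := Dc 0 (@point Omega); apply: le_trans. Qed.

Let second_moment n : \int[P]_w (T n w ^+ 2) <= n%:R * c ^+ 2.
Proof.
elim: n => [|n IH].
  rewrite mul0r (@eq_Rintegral _ _ _ P setT (fun=> 0)); first by rewrite ER_cst.
  by move=> w _; rewrite /T big_ord0 expr0n.
have eqT w : T n.+1 w ^+ 2 = T n w ^+ 2 + (2 * (T n w * D n w) + D n w ^+ 2).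
  by rewrite /T big_ord_recr/=; ring.
rewrite (eq_Rintegral _ (fun w _ => eqT w)).
have bTD : bmf (fun w => T n w * D n w) := bmfM (bmf_T n) (bmf_D n).
rewrite (ERD P (bmfX 2 (bmf_T n)) (bmfD (bmfZ 2 bTD) (bmfX 2 (bmf_D n)))).
rewrite (ERD P (bmfZ 2 bTD) (bmfX 2 (bmf_D n))) (ERZl P 2 bTD).
have -> : \int[P]_w (T n w * D n w) = 0.
  have eqTD w : T n w * D n w = \sum_(k < n) (D k w * D n w) by rewrite /T mulr_suml.
  rewrite (eq_Rintegral _ (fun w _ => eqTD w)) ER_sum; last by move=> k; exact: bmfM.
  by rewrite big1// => k _; rewrite orth.
have : \int[P]_w (D n w ^+ 2) <= c ^+ 2.
  rewrite -[leRHS](ER_cst P); apply: ER_le; [exact: bmfX|exact: bmf_cst|] => w.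
  by rewrite -real_normK ?num_real// ler_sqr ?nnegrE ?(le_trans _ (Dc n w)).
by rewrite -natr1 mulrDl mul1r; lra.
Qed.

(** Averages at the times (n + 1)^2: their second moments are at most c^2 / (n + 1)^2, hence
    summable. *)
Let square_average n w : R := (n.+1 ^ 2)%:R^-1 * T (n.+1 ^ 2) w.

Let summable_second_moments :
  (\int[P]_w \sum_(0 <= n <oo) (square_average n w ^+ 2)%:E < +oo)%E.
Proof.
have bs n : bmf (fun w => square_average n w ^+ 2) by apply: bmfX; exact: bmfZ.
rewrite integral_nneseries//; last 2 first.
- by move=> n; apply/measurable_EFinP; exact: bmf_meas.
- by move=> n w _; rewrite lee_fin sqr_ge0.
apply: (@le_lt_trans _ _ (2 * c ^+ 2)%:E); last exact: ltry.
apply: lime_le.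
  by apply: is_cvg_nneseries => n _ _; apply: integral_ge0 => w _; rewrite lee_fin sqr_ge0.
apply: nearW => n; rewrite (eq_bigr (fun n => (\int[P]_w (square_average n w ^+ 2))%:E)); last first.
  by move=> i _; rewrite RintegralE.
rewrite sumEFin lee_fin.
(* The telescoping bound makes an induction possible: 1 / a^2 <= 2 (1 / a - 1 / (a + 1)) for a >=
   1. *)
apply: (@le_trans _ _ (2 * c ^+ 2 * (1 - n.+1%:R^-1))); last first.
  by rewrite ler_piMr ?mulr_ge0 ?sqr_ge0// lerBlDr lerDl.
elim: n => [|n IH]; first by rewrite big_geq// invr1 subrr mulr0.
rewrite big_nat_recr//=.
have n0 : (0 : R) < n.+1%:R by [].
have : \int[P]_w (square_average n w ^+ 2) <= c ^+ 2 / n.+1%:R ^+ 2.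
  have eqs w : square_average n w ^+ 2 = (n.+1%:R ^- 4) * T (n.+1 ^ 2) w ^+ 2.
    by rewrite /square_average natrX; field; rewrite gt_eqF.
  rewrite (eq_Rintegral _ (fun w _ => eqs w)) (ERZl P _ (bmfX 2 (bmf_T _))).
  have := second_moment (n.+1 ^ 2); rewrite natrX => h.
  rewrite mulrC ler_pdivrMr ?exprn_gt0//; apply: le_trans h _.
  by rewrite le_eqVlt; apply/orP; left; apply/eqP; field; rewrite gt_eqF.
have n1 : (1 : R) <= n.+1%:R by rewrite ler1n.
rewrite -(natr1 n.+1); move: n0 n1 IH; set a : R := n.+1%:R => a0 a1 IH.
have : c ^+ 2 / a ^+ 2 <= 2 * c ^+ 2 * (a^-1 - (a + 1)^-1).
  have a10 : 0 < a + 1 by rewrite addr_gt0.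
  rewrite (_ : _ * (_ - _) = c ^+ 2 * (2 / (a * (a + 1)))); last by field; rewrite !gt_eqF.
  rewrite ler_wpM2l ?sqr_ge0// -div1r ler_pdivrMr ?exprn_gt0// mulrAC ler_pdivlMr ?mulr_gt0//; nra.
move=> h1 h2; have := lerD IH (le_trans h2 h1).
by rewrite -mulrDr addrA subrK.
Qed.

Let square_average_cvg0 : {ae P, forall w, (fun n => square_average n w) @ \oo --> 0}.
Proof.
have : P.-integrable setT (fun w => \sum_(0 <= n <oo) (square_average n w ^+ 2)%:E)%E.
  apply/integrableP; split.
    apply: ge0_emeasurable_sum => [n w _ _|n _]; first by rewrite lee_fin sqr_ge0.
    by apply/measurable_EFinP; apply: bmf_meas; apply: bmfX; exact: bmfZ.
  rewrite (eq_integral (fun w => \sum_(0 <= n <oo) (square_average n w ^+ 2)%:E)%E)//.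
  by move=> w _; rewrite gee0_abs// nneseries_ge0// => n _ _; rewrite lee_fin sqr_ge0.
move=> /(integrable_ae measurableT); apply: filterS => w /(_ I) fw.
have s0 : (fun n => square_average n w ^+ 2) @ \oo --> 0.
  apply: nneseries_lty_cvg0 => [n|]; first exact: sqr_ge0.
  by move: fw; rewrite ge0_fin_numE// nneseries_ge0// => n _ _; rewrite lee_fin sqr_ge0.
apply/cvgrPdist_le => /= e e0.
move/cvgrPdist_le : s0 => /(_ (e ^+ 2)); rewrite exprn_gt0// => /(_ isT).
apply: filterS => n /=; rewrite !sub0r !normrN ger0_norm ?sqr_ge0//.
by rewrite -[in leLHS]real_normK ?num_real// ler_sqr ?nnegrE// ltW.
Qed.

Lemma orthogonal_lln : {ae P, forall w, (fun n => n%:R^-1 * \sum_(k < n) D k w) @ \oo --> 0}.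
Proof.
move: square_average_cvg0; apply: filterS => w s0.
apply/cvgrPdist_le => /= e e0.
have e2 : 0 < e / 2 by rewrite divr_gt0.
move/cvgrPdist_le : s0 => /(_ _ e2)[N _ hN].
(* Once m + 1 >= 4 c / e, the 2 (m + 1) terms between consecutive squares contribute at most (e / 2)
   (m + 1)^2. *)
have [M hM] : exists M : nat, 4 * c / e <= M%:R.
  exists (Num.bound (4 * c / e)); apply/ltW/archi_boundP.
  by rewrite divr_ge0 ?mulr_ge0// ltW.
exists ((maxn N M).+1 ^ 2)%N => // n /= hn.
have [m /andP[mn nm]] := sqrtn_floor n.
have : (maxn N M < m)%N.
  by have := leq_ltn_trans hn nm; rewrite ltn_exp2r// ltnS.
case: m mn nm => // m mn nm; rewrite ltnS geq_max => /andP[Nm Mm].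
have n0 : (0 : R) < n%:R by rewrite ltr0n (leq_trans _ mn)// expn_gt0.
rewrite sub0r normrN normrM gtr0_norm ?invr_gt0// mulrC ler_pdivrMr//.
have Tm : `|T (m.+1 ^ 2) w| <= e / 2 * n%:R.
  have := hN m Nm; rewrite /= sub0r normrN /square_average normrM gtr0_norm ?invr_gt0 ?ltr0n ?expn_gt0//.
  rewrite mulrC ler_pdivrMr ?ltr0n ?expn_gt0// => /le_trans; apply.
  by rewrite ler_wpM2l ?ler_nat// ltW.
(* For (m + 1)^2 <= n < (m + 2)^2, at most 2 (m + 1) terms separate the two sums. *)
have Td : `|\sum_(k < n) D k w - T (m.+1 ^ 2) w| <= c * (2 * m.+1%:R).
  rewrite /T -!(big_mkord predT (fun k => D k w)) (big_cat_nat (leq0n _) mn)//= addrAC subrr add0r.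
  apply: le_trans (ler_norm_sum _ _ _) _.
  apply: (@le_trans _ _ (\sum_((m.+1 ^ 2) <= k < n) c)); first exact: ler_sum_nat.
  rewrite sumr_const_nat -[c *+ _]mulr_natr ler_wpM2l// -natrM ler_nat.
  by rewrite leq_subLR -ltnS (leq_trans nm)// -(addn1 m.+1) sqrnD muln1 exp1n addnAC addn1.
have -> : \sum_(k < n) D k w = T (m.+1 ^ 2) w + (\sum_(k < n) D k w - T (m.+1 ^ 2) w).
  by rewrite addrC subrK.
apply: le_trans (ler_normD _ _) _.
have m0 : (0 : R) < m.+1%:R by [].
have : c * (2 * m.+1%:R) <= e / 2 * n%:R.
  apply: (@le_trans _ _ (e / 2 * (m.+1 ^ 2)%:R)); last by rewrite ler_wpM2l ?ler_nat// ltW.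
  have : 4 * c <= m.+1%:R * e.
    rewrite -ler_pdivrMr//; apply: le_trans hM _; by rewrite ler_nat ltnW.
  rewrite natrX => /(ler_wpM2r (ltW m0)); rewrite expr2; lra.
move: Tm Td; lra.
Qed.

End orthogonal_lln.

(** * Stability of the scale *)

Section stability.
Context {R : realType} {dO : measure_display} {Omega : measurableType dO} {d : nat}.
Variables (P : probability Omega R) (target q : 'cV[R]_d -> R)
  (W : nat -> {RV P >-> 'cV[R]_d}) (U : nat -> {RV P >-> R}).
Variables (Q : probability 'cV[R]_d R) (Un : probability R R).
Hypotheses (noise : driving_noise q W U)
  (QE : forall A, measurable A -> Q A = (\int[lebesgue_cV d]_(z in A) (q z)%:E)%E)
  (UnE : forall A, measurable A -> Un A = uniform_prob (@ltr01 R) A)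
  (mtarget : measurable_fun setT target) (target_ge0 : forall x, 0 <= target x).

Local Notation history := (history W U).
Local Notation acc := (acc target).

Variables (L : nat -> Omega -> 'M[R]_d) (X : nat -> Omega -> 'cV[R]_d) (S : nat -> Omega -> R).
Variables (alpha s0 K : R) (eta : nat -> R).
Hypotheses (aL : forall k, adapted (history k) (L k)) (aX : forall k, adapted (history k) (X k))
  (aS : forall k, adapted (history k) (S k)).
Hypotheses (alpha01 : 0 <= alpha <= 1) (K0 : 0 <= K) (eta0 : forall k, 0 <= eta k)
  (eta2 : (\sum_(0 <= k <oo) (eta k ^+ 2)%:E < +oo)%E).
Hypotheses (S0 : forall o, S 0 o = s0) (X0 : forall o, target (X 0 o) != 0)
  (SS : forall k o, S k.+1 o =
     S k o + eta k * (acc (X k o) (X k o + L k o *m W k.+2 o) - alpha))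
  (Xsupp : forall k, P [set o | target (X k o) == 0] = 0%E)
  (drift_large : forall k o, target (X k o) != 0 -> K <= S k o ->
     \int[Q]_w acc (X k o) (X k o + L k o *m w) <= alpha)
  (drift_small : forall k o, target (X k o) != 0 -> S k o <= - K ->
     alpha <= \int[Q]_w acc (X k o) (X k o + L k o *m w)).

(* Lyapunov function: the squared distance to [- K, K]. *)
Let V (s : R) : R := Num.max 0 (s - K) ^+ 2 + Num.max 0 (- K - s) ^+ 2.
(** The derivative of [V]. *)
Let V' (s : R) : R := 2 * (Num.max 0 (s - K) - Num.max 0 (- K - s)).

Let sqr_max_le (s h : R) :
  Num.max 0 (s + h) ^+ 2 <= Num.max 0 s ^+ 2 + 2 * Num.max 0 s * h + h ^+ 2.
Proof. by case: (leP 0 (s + h)); case: (leP 0 s); nra. Qed.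

(** A second-order expansion; each of the two squared positive parts contributes h^2 to the
    remainder. *)
Let V_step s h : V (s + h) <= V s + V' s * h + 2 * h ^+ 2.
Proof.
have := sqr_max_le (s - K) h; have := sqr_max_le (- K - s) (- h).
rewrite (_ : - K - s - h = - K - (s + h)); last by rewrite opprD addrA.
by rewrite (addrAC s) /V /V' sqrrN; lra.
Qed.

Let V'_sqr_le s : V' s ^+ 2 <= 4 * V s.
Proof. by rewrite /V /V'; case: (leP 0 (s - K)); case: (leP 0 (- K - s)); nra. Qed.

Let V_ge0 s : 0 <= V s.
Proof. by rewrite addr_ge0// sqr_ge0. Qed.

Let normr_le_V s : `|s| <= K + V s + 1.
Proof.
have := sqr_ge0 (s - K - 1); have := sqr_ge0 (- K - s - 1); rewrite !expr2 /V ler_norml => h1 h2.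
by case: (leP 0 (s - K)); case: (leP 0 (- K - s)) => h3 h4; apply/andP; split; move: K0; nra.
Qed.

Let measurable_V : measurable_fun setT V.
Proof.
apply: measurable_funD; apply: measurable_funX; apply: measurable_maxr => //.
  exact: measurable_funB.
exact: measurable_funB.
Qed.

Let measurable_V' : measurable_fun setT V'.
Proof.
apply: measurable_funM => //; apply: measurable_funB; apply: measurable_maxr => //.
  exact: measurable_funB.
exact: measurable_funB.
Qed.

Section level.
Variable lam : R.
Hypothesis lam0 : 0 < lam.

(** The level has not been reached up to time n. Membership in the support is included because the
    drift hypotheses speak only of points of the support, while the chain may leave it on a null
    event. *)
Let below n : set Omega := [set o | forall k, (k <= n)%N ->
  (V (S k o) < lam) && (target (X k o) != 0)].

Let belowS n : below n.+1 = below n `&` [set o | (V (S n.+1 o) < lam) && (target (X n.+1 o) != 0)].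
Proof.
apply/seteqP; split=> o /=.
  by move=> h; split=> [k kn|]; apply: h => //; exact: leqW.
by move=> [h hn] k; rewrite leq_eqVlt => /predU1P[->//|]; rewrite ltnS; exact: h.
Qed.

Let history_supp n : (<<s history n >>) [set o | target (X n o) == 0].
Proof.
rewrite (_ : mkset _ = X n @^-1` (target @^-1` [set 0])); last first.
  by apply/seteqP; split=> o /eqP.
apply: (@aX n).
by rewrite -[X in measurable X]setTI; exact: mtarget.
Qed.

Let history_level n :
  (<<s history n >>) [set o | (V (S n o) < lam) && (target (X n o) != 0)].
Proof.
rewrite (_ : mkset _ = [set o | V (S n o) < lam] `&` ~` [set o | target (X n o) == 0]); last first.
  by apply/seteqP; split=> o /=; [move=> /andP[-> /negP]|move=> [-> /negP ->]].
apply: (@measurableI _ (g_sigma_algebraType (history n))); last first.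
  exact: (@measurableC _ (g_sigma_algebraType (history n)) _ (@history_supp n)).
apply: (aS (k := n) (A := [set s | V s < lam])).
have := measurable_fun_ltr measurable_V (measurable_cst lam).
move=> /(_ measurableT [set true]); rewrite setTI => m.
by rewrite (_ : mkset _ = (fun t => V t < lam) @^-1` [set true])//; exact: m.
Qed.

Let history_below n : (<<s history n >>) (below n).
Proof.
elim: n => [|n IH].
  rewrite (_ : below 0 = [set o | (V (S 0 o) < lam) && (target (X 0 o) != 0)]); first exact: history_level.
  by apply/seteqP; split=> o /=; [move=> /(_ 0%N); exact|move=> h [|//]].
rewrite belowS; apply: (@measurableI _ (g_sigma_algebraType (history n.+1))).
  exact: history_incr IH.
exact: history_level.
Qed.

Let measurable_below n : measurable (below n).
Proof. exact: (history_measurable (@history_below n)). Qed.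

Let Y n (o : Omega) : R := \1_(below n) o * V' (S n o).

Let below_V n o : \1_(below n) o * V (S n o) <= lam.
Proof.
rewrite indicE; case: (boolP (o \in below n)) => [|_]; last by rewrite mul0r ltW.
by rewrite inE mul1r => /(_ n (leqnn n)) /andP[Vn _]; exact: ltW.
Qed.

Let bmf_Y n : bmf (Y n : g_sigma_algebraType (history n) -> R).
Proof.
have /adaptedP mS := @aS n.
split.
  apply: (@measurable_funM _ (g_sigma_algebraType (history n)) _ _ (\1_(below n)) (fun o => V' (S n o))).
    exact: (bmf_meas (bmf_indic (T := g_sigma_algebraType (history n)) (@history_below n))).
  exact: (measurableT_comp measurable_V' mS).
exists (4 * lam + 1) => o; rewrite /Y indicE.
case: (boolP (o \in below n)) => [|_]; last by rewrite mul0r normr0 addr_ge0 ?mulr_ge0// ltW.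
rewrite inE mul1r => /(_ n (leqnn n)) /andP[Vn _]; have := V'_sqr_le (S n o).
have := sqr_ge0 (V' (S n o) - 1); have := sqr_ge0 (V' (S n o) + 1); rewrite !expr2 => h1 h2.
by rewrite ler_norml => h3; apply/andP; split; move: lam0; nra.
Qed.

(* [V] stopped at the exit from [below], with exit cost [lam]. *)
Let e n o : R := lam * (1 - \1_(below n) o) + \1_(below n) o * V (S n o).

Let bmf_below n : bmf (\1_(below n) : Omega -> R).
Proof. exact: bmf_indic. Qed.

Let bmf_e n : bmf (e n).
Proof.
apply: bmfD; first by apply: bmfZ; apply: bmfB => //; exact: bmf_cst.
apply: (bmf_ge0 (M := lam)) => [|o]; last by rewrite below_V mulr_ge0// indicE; case: (_ \in _).
apply: measurable_funM; first exact: bmf_meas.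
apply: (measurableT_comp measurable_V).
exact: adapted_measurable (@history_measurable _ _ _ _ P W U n) (@aS n).
Qed.

Let A n o := acc (X n o) (X n o + L n o *m W n.+2 o) - alpha.

(** While the path stays in [below], this is [V_step] with |A n| <= 1. On leaving through the level,
    [V] is already at least lam and pays the exit cost; on leaving the support, the last term pays
    it. *)
Let eS n o : e n.+1 o <=
  e n o + (eta n * (Y n o * A n o) + (2 * eta n ^+ 2 + lam * \1_[set o | target (X n.+1 o) == 0] o)).
Proof.
rewrite /e /Y belowS indicI/=.
have := V_step (S n o) (eta n * A n o); rewrite -SS.
have A1 : A n o ^+ 2 <= 1.
  rewrite /A; have := acc_ge0 target_ge0 (X n o) (X n o + L n o *m W n.+2 o).
  have := acc_le1 target (X n o) (X n o + L n o *m W n.+2 o).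
  by move: alpha01 => /andP[]; nra.
have A2 : (eta n * A n o) ^+ 2 <= eta n ^+ 2 by rewrite exprMn ler_piMr// sqr_ge0.
have e20 := sqr_ge0 (eta n).
have lam1 : 0 <= lam * \1_[set o | target (X n.+1 o) == 0] o.
  by rewrite indicE mulr_ge0// ltW.
rewrite !indicE in lam1 *; case: (boolP (o \in below n)) => _ /=; last by move=> _; lra.
rewrite !mul1r; case: (boolP (o \in [set _ | _ && _])) => /=.
  by move=> _; lra.
rewrite notin_setE/= => /negP; rewrite negb_and negbK -leNgt => /orP[|t0]; first by lra.
have -> : o \in [set o | target (X n.+1 o) == 0] by apply/mem_set.
rewrite mulr1.
have := V_ge0 (S n.+1 o); lra.
Qed.

Let bmf_accept n : bmf (fun o => acc (X n o) (X n o + L n o *m W n.+2 o)).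
Proof.
apply: (bmf_comp (h := fun o => ((L n o, X n o), (W n.+2 o, 0 : R)))) (bmf_move_acc mtarget target_ge0).
apply: measurable_fun_pair; apply: measurable_fun_pair => //.
  exact: adapted_measurable (@history_measurable _ _ _ _ P W U n) (@aL n).
exact: adapted_measurable (@history_measurable _ _ _ _ P W U n) (@aX n).
Qed.

Let bmf_Y_Omega n : bmf (Y n : Omega -> R).
Proof.
split; last by case: (bmf_Y n).
apply: (@adapted_measurable _ _ (history n)); first exact: history_measurable.
by apply/adaptedP; exact: bmf_meas.
Qed.

(** After conditioning on the past, the mean of A n and V' have opposite signs outside [- K, K] by
    the drift hypotheses, and V' vanishes inside. *)
Let ER_Y_A n : \int[P]_o (Y n o * A n o) <= 0.
Proof.
have bacc := bmf_accept n; have bY := bmf_Y_Omega n.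
rewrite (@eq_Rintegral _ _ _ P setT (fun o => Y n o * acc (X n o) (X n o + L n o *m W n.+2 o) - alpha * Y n o)); last first.
  by move=> o _; rewrite /A; ring.
rewrite (ERB P (bmfM bY bacc) (bmfZ alpha bY)).
rewrite (ER_acc_move noise QE UnE mtarget target_ge0 (@aL n) (@aX n) (bmf_Y n)).
have bm : bmf (fun o => \int[Q]_w acc (X n o) (X n o + L n o *m w)).
  have bz : bmf (fun z : ('M[R]_d * 'cV[R]_d) * 'cV[R]_d => acc z.1.2 (z.1.2 + z.1.1 *m z.2)).
    apply: (bmf_comp (h := fun z : ('M[R]_d * 'cV[R]_d) * 'cV[R]_d => (z.1, (z.2, 0 : R))))
      (bmf_move_acc mtarget target_ge0).
    by apply: measurable_fun_pair => //; exact: measurable_fun_pair.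
  apply: (bmf_comp (h := fun o => (L n o, X n o))) (bmf_fubini1 (\d_((0 : 'M[R]_d), (0 : 'cV[R]_d))) Q bz).
  apply: measurable_fun_pair.
    exact: adapted_measurable (@history_measurable _ _ _ _ P W U n) (@aL n).
  exact: adapted_measurable (@history_measurable _ _ _ _ P W U n) (@aX n).
rewrite -(ERB P (bmfM bY bm) (bmfZ alpha bY)) -[leRHS](ER_cst P).
apply: ER_le; [exact: bmfB (bmfM bY bm) (bmfZ alpha bY)|exact: bmf_cst|] => o.
rewrite /Y indicE; case: (boolP (o \in _)) => [|_]; last by rewrite !mul0r mulr0 subr0.
rewrite inE => /(_ n (leqnn n)) /andP[_ tX].
rewrite mul1r [alpha * _]mulrC -mulrBr.
have := drift_large tX; have := drift_small tX.
set I := \int[Q]_w _ => small large; rewrite /V'.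
case: (leP K (S n o)) => [KS|SK].
  have -> : Num.max 0 (- K - S n o) = 0 by apply/max_idPl; move: K0; lra.
  have -> : Num.max 0 (S n o - K) = S n o - K by apply/max_idPr; move: K0; lra.
  by have := large KS; nra.
have -> : Num.max 0 (S n o - K) = 0 by apply/max_idPl; move: K0; lra.
case: (leP (S n o) (- K)) => [KS|KS].
  have -> : Num.max 0 (- K - S n o) = - K - S n o by apply/max_idPr; move: K0; lra.
  by have := small KS; nra.
have -> : Num.max 0 (- K - S n o) = 0 by apply/max_idPl; move: K0; lra.
by rewrite subrr mulr0 mul0r.
Qed.

Let ER_e n : \int[P]_o e n o <= V s0 + 2 * \sum_(0 <= k < n) eta k ^+ 2.
Proof.
elim: n => [|n IH].
  rewrite big_geq// mulr0 addr0 -[leRHS](ER_cst P); apply: ER_le => //; first exact: bmf_cst.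
  move=> o; rewrite /e indicE S0; case: (boolP (o \in below 0)) => [_|].
    by rewrite subrr mulr0 add0r mul1r.
  rewrite notin_setE/= => h; rewrite subr0 mulr1 mul0r addr0 leNgt; apply/negP => h'.
  by apply: h => -[|//] _; rewrite S0 h' X0.
have bY := bmf_Y_Omega n; have bA : bmf (A n) := bmfB (bmf_accept n) (bmf_cst alpha).
have b1 := bmfZ (eta n) (bmfM bY bA).
have mt : measurable [set o | target (X n.+1 o) == 0] := history_measurable (@history_supp n.+1).
have b3 := bmfZ lam (bmf_indic mt).
have b2 := bmfD b1 (bmfD (bmf_cst (2 * eta n ^+ 2)) b3).
apply: le_trans (ER_le P (bmf_e n.+1) (bmfD (bmf_e n) b2) (eS n)) _.
rewrite (ERD P (bmf_e n) b2) (ERD P b1 (bmfD (bmf_cst _) b3)) (ERZl P (eta n) (bmfM bY bA)).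
rewrite (ERD P (bmf_cst _) b3) ER_cst (ERZl P lam (bmf_indic mt)) (ER_indic P mt).
rewrite [P _](Xsupp n.+1) /= mulr0 addr0.
rewrite big_nat_recr//= mulrDr [leRHS]addrA addrA; apply: lerD => //.
by rewrite -[leRHS]addr0; apply: lerD => //; exact: mulr_ge0_le0.
Qed.

(** Off [below n] the function [e n] equals lam, so Markov's inequality bounds the probability of
    each complement by C / lam. The complements increase with n, and the bound passes to their
    union. *)
Lemma exceed_prob (C : R) : (forall n, V s0 + 2 * \sum_(0 <= k < n) eta k ^+ 2 <= C) ->
  measurable (~` \bigcap_n below n) /\ (P (~` \bigcap_n below n) <= (C / lam)%:E)%E.
Proof.
move=> hC; rewrite setC_bigcap.
have mC n : measurable (~` below n) by apply: measurableC.
split; first exact: bigcupT_measurable.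
have nd : nondecreasing_seq (fun n => ~` below n).
  move=> m n mn; apply/subsetPset; apply: subsetC => o h k km; exact: h (leq_trans km mn).
have cv := nondecreasing_cvg_mu (mu := P) mC (bigcupT_measurable _ mC) nd.
rewrite -(cvg_lim _ cv)//; apply: lime_le; first by apply/cvg_ex; eexists; exact: cv.
apply: nearW => n /=; rewrite -[P _]fineK ?fin_num_measure// lee_fin ler_pdivlMr// mulrC.
rewrite -ER_indic// -ERZl; last exact: bmf_indic.
apply: le_trans (hC n); apply: le_trans (ER_e n).
apply: ER_le => // [|o]; first by apply: bmfZ; exact: bmf_indic.
rewrite /e !indicE in_setC; case: (o \in below n) => /=.
  by rewrite mulr0 subrr mulr0 add0r mul1r.
by rewrite subr0 mul0r addr0.
Qed.

End level.

(** A path with unbounded scale exits every level n + 1, and such an exit has probability at most C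
    / (n + 1). *)
Lemma scale_bounded : {ae P, forall o, exists M, forall k, `|S k o| <= M}.
Proof.
pose C := V s0 + 2 * fine (\sum_(0 <= k <oo) (eta k ^+ 2)%:E)%E.
have hC n : V s0 + 2 * \sum_(0 <= k < n) eta k ^+ 2 <= C.
  rewrite lerD2l ler_wpM2l// -lee_fin fineK; last first.
    by rewrite ge0_fin_numE//; apply: nneseries_ge0 => k _ _; rewrite lee_fin sqr_ge0.
  by rewrite -sumEFin; apply: nneseries_lim_ge => k _ _; rewrite lee_fin sqr_ge0.
have C0 : 0 <= C by apply: le_trans (hC 0%N); rewrite big_geq// mulr0 addr0.
pose A n := ~` \bigcap_k [set o | forall j, (j <= k)%N ->
  (V (S j o) < n.+1%:R) && (target (X j o) != 0)].
have hA n := exceed_prob (ltr0Sn R n) hC; rewrite -/(A _) in hA.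
have mA n : measurable (A n) by case: (hA n).
exists (\bigcap_n A n); split.
- exact: bigcapT_measurable.
- apply/eqP; rewrite eq_le measure_ge0 andbT; apply/lee_addgt0Pr => e e0; rewrite add0e.
  have [n hn] : exists n : nat, C / e <= n%:R.
    by exists (Num.bound (C / e)); apply/ltW/archi_boundP; rewrite divr_ge0// ltW.
  apply: (@le_trans _ _ (P (A n))).
    by apply: le_measure; rewrite ?inE//; [exact: bigcapT_measurable|exact: bigcap_inf].
  have [_ /le_trans] := hA n; apply; rewrite lee_fin ler_pdivrMr// mulrC -ler_pdivrMr//.
  by apply: le_trans hn _; rewrite ler_nat.
- move=> o /= unbounded n _ /= h; apply: unbounded.
  exists (K + n.+1%:R + 1) => k; apply: le_trans (normr_le_V _) _.
  by rewrite lerD2r lerD2l ltW//; have /andP[] := h k I k (leqnn k).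
Qed.

End stability.

(** * Ergodic averages *)

Section pathwise_averages.
Context {R : realType} {d : nat}.
Variables (target : 'cV[R]_d -> R) (Q : probability 'cV[R]_d R).
Hypotheses (mtarget : measurable_fun setT target) (target_ge0 : forall x, 0 <= target x).
Variables (f : 'cV[R]_d -> R) (B : R).
Hypotheses (mf : measurable_fun setT f) (fB : forall x, 0 <= f x <= B).

Local Notation h := (mh_iter target Q f).

(* Truncated solution of the Poisson equation [g - mh g = f - \int f]. *)
Definition poisson_sum m (p : 'M[R]_d * 'cV[R]_d) : R := \sum_(j < m) h j p.

Let bf : bmf f := bmf_ge0 mf fB.

Let bh j : bmf (h j).
Proof. exact: bmf_mh_iter. Qed.

Lemma bmf_poisson_sum m : bmf (poisson_sum m).
Proof. exact: bmf_sum. Qed.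

Let mh_poisson_sum m p : mh target Q (poisson_sum m) p = \sum_(j < m) h j.+1 p.
Proof.
elim: m => [|m IH].
  rewrite big_ord0 (_ : poisson_sum 0 = fun=> 0); last first.
    by apply/funext => p'; rewrite /poisson_sum big_ord0.
  have := @mh_bounds R d target mtarget target_ge0 Q (fun=> 0) 0 0 p (bmf_cst 0).
  by rewrite lexx => /(_ (fun=> isT)) /andP[h1 h2]; apply/eqP; rewrite eq_le h1 h2.
rewrite big_ord_recr/= -IH -(mhD mtarget target_ge0 Q p (bmf_poisson_sum m) (bh m)).
by congr (mh _ _ _ _); apply/funext => p'; rewrite /poisson_sum big_ord_recr.
Qed.

Lemma poisson_sum_sub m p : poisson_sum m p - mh target Q (poisson_sum m) p = f p.2 - h m p.
Proof.
rewrite mh_poisson_sum /poisson_sum -sumrB; elim: m => [|m IH]; first by rewrite big_ord0 subrr.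
by rewrite big_ord_recr/= IH addrA subrK.
Qed.

Lemma poisson_sum_bounds m p : 0 <= poisson_sum m p <= m%:R * B.
Proof.
have hb j : 0 <= h j p <= B by exact: mh_iter_bounds.
rewrite /poisson_sum sumr_ge0 => [|j _]; last by case/andP: (hb j).
rewrite mulr_natl -[m in leRHS]card_ord -sumr_const.
by apply: ler_sum => j _; case/andP: (hb j).
Qed.

Variables (x : nat -> 'cV[R]_d) (L : nat -> 'M[R]_d) (pf r : R) (kappa : nat -> R).
Hypotheses (r01 : 0 <= r < 1)
  (ergodic : forall j k, `|h j (L k, x k) - pf| <= r ^+ j * B)
  (lipschitz : forall j k, `|h j (L k, x k.+1) - h j (L k.+1, x k.+1)| <= j%:R * kappa k)
  (kappa0 : kappa @ \oo --> 0)
  (lln : forall m, (fun n => n%:R^-1 * \sum_(k < n)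
     (poisson_sum m (L k, x k.+1) - mh target Q (poisson_sum m) (L k, x k))) @ \oo --> 0).

Let B_ge0 : 0 <= B.
Proof. by have /andP[] := fB 0; exact: le_trans. Qed.

Let poisson_lipschitz m k :
  `|poisson_sum m (L k.+1, x k.+1) - poisson_sum m (L k, x k.+1)| <= m%:R ^+ 2 * kappa k.
Proof.
have k0 : 0 <= kappa k by have := lipschitz 1 k; rewrite mul1r; exact: le_trans.
rewrite -sumrB; apply: le_trans (ler_norm_sum _ _ _) _.
apply: (@le_trans _ _ (\sum_(j < m) m%:R * kappa k)).
  apply: ler_sum => j _; rewrite distrC; apply: le_trans (lipschitz j k) _.
  by rewrite ler_wpM2r// ler_nat ltnW.
by rewrite sumr_const card_ord -[_ *+ m]mulr_natl expr2 mulrA.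
Qed.

Lemma averages_cvg : (fun n => n%:R^-1 * \sum_(k < n) f (x k)) @ \oo --> pf.
Proof.
apply/cvgrPdist_le => /= e e0.
(* The truncation m is fixed first and makes the mixing error small; the other terms, which grow
   with m, then vanish as n tends to infinity. B + 1 avoids a division by zero. *)
have [m hm] : exists m, r ^+ m * B <= e / 4.
  have B1 : 0 < B + 1 by rewrite ltr_wpDl.
  have /andP[r0 r1] := r01.
  have rn : `|r| < 1 by rewrite ger0_norm.
  have /cvgrPdist_le/(_ (e / 4 / (B + 1))) := cvg_expr rn.
  rewrite !divr_gt0// => /(_ isT)[m _ /(_ m (leqnn m))] /=.
  rewrite sub0r normrN ger0_norm ?exprn_ge0// ler_pdivlMr// => hm.
  by exists m; apply: le_trans hm; rewrite ler_wpM2l ?exprn_ge0// lerDl.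
have kmean : (fun n => n%:R^-1 * \sum_(k < n) kappa k) @ \oo --> 0.
  have := cesaro kappa0; rewrite /arithmetic_mean => hc.
  rewrite -(cvg_shiftS _) (_ : (fun n => _) = [sequence n.+1%:R^-1 * series kappa n.+1]_n)//.
  by apply/funext => n /=; rewrite /series/= big_mkord.
have inv0 : (fun n => n%:R^-1) @ \oo --> (0 : R).
  by rewrite -(cvg_shiftS _); exact: cvg_harmonic.
have e4 : 0 < e / 4 by rewrite divr_gt0.
have m1 : 0 < m%:R * B + 1 by rewrite ltr_wpDl// mulr_ge0.
have m2 : 0 < (m%:R ^+ 2 + 1 : R) by rewrite ltr_wpDl// sqr_ge0.
near=> n.
have n0 : (0 : R) < n%:R by rewrite ltr0n; near: n; exists 1%N.
have h1 : n%:R^-1 * (m%:R * B + 1) <= e / 4.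
  rewrite -ler_pdivlMr// -[leLHS]gtr0_norm ?invr_gt0// -normrN -sub0r; near: n.
  by move/cvgrPdist_le : inv0; apply; rewrite divr_gt0.
have h2 : n%:R^-1 * (\sum_(k < n) kappa k) * (m%:R ^+ 2 + 1) <= e / 4.
  rewrite -ler_pdivlMr//; apply: le_trans (ler_norm _) _; rewrite -normrN -sub0r; near: n.
  by move/cvgrPdist_le : kmean; apply; rewrite divr_gt0.
pose G := poisson_sum m.
have h3 : `|n%:R^-1 * \sum_(k < n) (G (L k, x k.+1) - mh target Q G (L k, x k))| <= e / 4.
  rewrite -normrN -sub0r; near: n.
  by have /cvgrPdist_le := lln m; apply.
have k0 k : 0 <= kappa k by have := lipschitz 1 k; rewrite mul1r; exact: le_trans.
have h4 : `|n%:R^-1 * \sum_(k < n) (G (L k.+1, x k.+1) - G (L k, x k.+1))| <= e / 4.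
  rewrite normrM gtr0_norm ?invr_gt0//; apply: le_trans h2; rewrite -mulrA ler_pM2l ?invr_gt0//.
  apply: le_trans (ler_norm_sum _ _ _) _.
  rewrite mulr_suml; apply: ler_sum => k _; apply: le_trans (poisson_lipschitz m k) _.
  by rewrite mulrC ler_wpM2l// lerDl.
have h5 : `|n%:R^-1 * (G (L 0, x 0) - G (L n, x n))| <= e / 4.
  rewrite normrM gtr0_norm ?invr_gt0//; apply: le_trans h1; rewrite ler_pM2l ?invr_gt0//.
  have /andP[a1 a2] := poisson_sum_bounds m (L 0, x 0).
  have /andP[a3 a4] := poisson_sum_bounds m (L n, x n).
  by rewrite /G ler_norml; apply/andP; split; lra.
have h6 : `|n%:R^-1 * \sum_(k < n) (h m (L k, x k) - pf)| <= e / 4.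
  rewrite normrM gtr0_norm ?invr_gt0// mulrC ler_pdivrMr// mulr_natr.
  apply: le_trans (ler_norm_sum _ _ _) _.
  rewrite -[n in leRHS]card_ord -sumr_const; apply: ler_sum => k _.
  exact: le_trans (ergodic m k) hm.
have tel : G (L 0, x 0) - G (L n, x n) = \sum_(k < n) (G (L k, x k) - G (L k.+1, x k.+1)).
  rewrite -(big_mkord predT (fun k => G (L k, x k) - G (L k.+1, x k.+1))).
  under eq_bigr do rewrite -opprB.
  by rewrite sumrN (telescope_sumr (fun k => G (L k, x k)))// opprB.
(* Four terms of size at most e / 4: the mixing error, the martingale increments, the change of L at
   a fixed point, and the telescoping sum. *)
rewrite (_ : pf - _ = - (n%:R^-1 * \sum_(k < n) (h m (L k, x k) - pf)
   + n%:R^-1 * \sum_(k < n) (G (L k, x k.+1) - mh target Q G (L k, x k))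
   + n%:R^-1 * \sum_(k < n) (G (L k.+1, x k.+1) - G (L k, x k.+1))
   + n%:R^-1 * (G (L 0, x 0) - G (L n, x n)))).
  move: h3 h4 h5 h6; rewrite normrN.
  set a1 := n%:R^-1 * _; set a2 := n%:R^-1 * _; set a3 := n%:R^-1 * _; set a4 := n%:R^-1 * _.
  rewrite !ler_norml => /andP[? ?] /andP[? ?] /andP[? ?] /andP[? ?]; apply/andP; split; lra.
rewrite tel -!mulrDr -!big_split/= [X in _ = - (_ * X)](_ : _ = \sum_(k < n) (f (x k) - pf)); last first.
  by apply: eq_bigr => k _; have := poisson_sum_sub m (L k, x k); rewrite -/G/=; lra.
by rewrite sumrB sumr_const card_ord mulrBr -[pf *+ n]mulr_natl mulKf ?gt_eqF// opprB.
Unshelve. all: by end_near. Qed.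

End pathwise_averages.

(** A monotone function can only be discontinuous by a jump, and surjectivity excludes one: values
    just above and just below phi s are attained, at points that enclose s. *)
Lemma nondecreasing_surj_continuous {R : realType} (phi : R -> R) :
  {homo phi : s t / s <= t} -> (forall s, 0 < phi s) -> (forall y, 0 < y -> exists s, phi s = y) ->
  continuous phi.
Proof.
move=> mono pos surj s; apply/cvgrPdist_le => e e0.
have ps := pos s.
have [t1 t1E] : exists t, phi t = phi s + e by apply: surj; rewrite addr_gt0.
(* The maximum with phi s / 2 keeps the lower value positive, hence in the range of phi. *)
have [t2 t2E] : exists t, phi t = Num.max (phi s - e) (phi s / 2).
  by apply: surj; rewrite lt_max divr_gt0// orbT.
have st1 : s < t1 by rewrite ltNge; apply/negP => /mono; rewrite t1E; lra.
have t2s : t2 < s.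
  by rewrite ltNge; apply/negP => /mono; rewrite t2E leNgt gt_max; case/negP; apply/andP; split; lra.
have st : s \in `]t2, t1[ by rewrite in_itv/= t2s st1.
apply: filterS (near_in_itvoo st) => t; rewrite in_itv/= => /andP[/ltW/mono t2t /ltW/mono tt1].
move: t2t; rewrite t1E t2E ge_max in tt1 * => /andP[h1 _].
by rewrite ler_norml; apply/andP; split; lra.
Qed.

(** The Heine-Cantor theorem with only s confined to the segment; t may lie outside it. *)
Lemma continuous_unif_segment {R : realType} (phi : R -> R) (M e : R) :
  continuous phi -> 0 < e ->
  exists2 dl : R, 0 < dl & forall s t, `|s| <= M -> `|s - t| <= dl -> `|phi s - phi t| <= e.
Proof.
move=> cphi e0.
pose Pr (dl s : R) := forall t, `|s - t| <= dl -> `|phi s - phi t| <= e.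
have /compact_near_coveringP/(_ R (0^'+) Pr) := @segment_compact R (- M) M.
case=> [p _|].
  have e2 : 0 < e / 2 by rewrite divr_gt0.
  have /cvgrPdist_le/(_ _ e2)/nbhs_ballP[r /= r0 hr] := cphi p.
  have r2 : 0 < r / 2 by rewrite divr_gt0.
  exists (ball p (r / 2), [set dl | dl < r / 2]) => /=.
    split; first exact: nbhsx_ballx.
    by near=> dl; rewrite /=; near: dl; exact: nbhs_right_lt.
  move=> [s dl] /= [ps dr] t st.
  have pt : ball p r t.
    move: ps; rewrite /ball/= => ps; rewrite (_ : p - t = (p - s) + (s - t)); last by rewrite addrA subrK.
    by apply: le_lt_trans (ler_normD _ _) _; lra.
  have ps' : ball p r s by move: ps; rewrite /ball/=; lra.
  have := hr _ pt; have := hr _ ps' => /= h1 h2.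
  rewrite (_ : phi s - phi t = (phi p - phi t) - (phi p - phi s)); last by ring.
  by apply: le_trans (ler_normB _ _) _; lra.
move=> dl /= dl0 h; exists (dl / 2); first by rewrite divr_gt0.
move=> s t sM; apply: (h (dl / 2)) => //=.
- by rewrite sub0r normrN gtr0_norm ?divr_gt0// ltr_pdivrMr// ltr_pMr// ltr1n.
- by rewrite divr_gt0.
- by rewrite in_itv/= -ler_norml.
Unshelve. all: by end_near. Qed.

(** * The adaptive chain with general shape matrices, time starting at 0 *)

Section adaptive_chain.
Context {R : realType} {dO : measure_display} {Omega : measurableType dO} {d : nat}.
Variables (P : probability Omega R) (target q : 'cV[R]_d -> R) (qhat : R -> R)
  (W : nat -> {RV P >-> 'cV[R]_d}) (U : nat -> {RV P >-> R}).
Variables (Q Pi : probability 'cV[R]_d R) (Un : probability R R) (m M D : R).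
Hypotheses (noise : driving_noise q W U)
  (QE : forall A, measurable A -> Q A = (\int[lebesgue_cV d]_(z in A) (q z)%:E)%E)
  (UnE : forall A, measurable A -> Un A = uniform_prob (@ltr01 R) A)
  (mtarget : measurable_fun setT target) (target_ge0 : forall x, 0 <= target x)
  (PiE : forall A, measurable A -> Pi A = (\int[lebesgue_cV d]_(x in A) (target x)%:E)%E)
  (mq : measurable_fun setT q) (q_ge0 : forall x, 0 <= q x)
  (qE : forall z, q z = qhat (enorm z)) (qhat_gt0 : forall x, 0 <= x -> 0 < qhat x)
  (qhat_decr : forall x y, 0 <= x -> x <= y -> qhat y <= qhat x)
  (m_gt0 : 0 < m) (target_bounds : forall x, target x != 0 -> m <= target x <= M)
  (diam_le : forall x y, target x != 0 -> target y != 0 -> enorm (x - y) <= D).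

Local Notation history := (history W U).
Local Notation acc := (acc target).

Variables (phi : R -> R) (eta gam : nat -> R) (alpha s0 ca cb : R).
Variables (C : nat -> Omega -> 'M[R]_d) (X : nat -> Omega -> 'cV[R]_d) (S : nat -> Omega -> R).
Hypotheses (phi_mono : {homo phi : s t / s <= t}) (phi_gt0 : forall s, 0 < phi s)
  (phi_surj : forall y, 0 < y -> exists s, phi s = y)
  (alpha01 : 0 <= alpha <= 1) (eta0 : forall k, 0 <= eta k)
  (eta2 : (\sum_(0 <= k <oo) (eta k ^+ 2)%:E < +oo)%E)
  (acc_large : exists2 a0 : R, 0 < a0 & forall x (L : 'M[R]_d), target x != 0 ->
     (forall v, a0 * enorm v <= enorm (L *m v)) -> \int[Q]_w acc x (x + L *m w) <= alpha)
  (acc_small : exists2 b0 : R, 0 < b0 & forall x, target x != 0 -> forall (L : 'M[R]_d) a b,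
     L^T = L -> 0 < a -> b <= cb / ca * a -> b <= b0 ->
     (forall v, a * enorm v <= enorm (L *m v)) -> (forall v, enorm (L *m v) <= b * enorm v) ->
     alpha <= \int[Q]_w acc x (x + L *m w)).
Hypotheses (ca0 : 0 < ca) (cb0 : 0 < cb)
  (C_ge : forall k o v, ca * enorm v <= enorm (C k o *m v))
  (C_le : forall k o v, enorm (C k o *m v) <= cb * enorm v)
  (C_sym : forall k o, (C k o)^T = C k o)
  (C_step : forall k o v, target (X k.+1 o) != 0 ->
     enorm ((C k.+1 o - C k o) *m v) <= gam k * enorm v)
  (gam_ge0 : forall k, 0 <= gam k) (gam0 : gam @ \oo --> 0).

Let L k o : 'M[R]_d := phi (S k o) *: C k o.

Hypotheses (aC : forall k, adapted (history k) (C k)) (aX : forall k, adapted (history k) (X k))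
  (aS : forall k, adapted (history k) (S k)).
Hypotheses (S0 : forall o, S 0 o = s0) (X0 : forall o, target (X 0 o) != 0)
  (XS : forall k o, X k.+1 o = mh_move target ((L k o, X k o), (W k.+2 o, U k.+2 o)))
  (SS : forall k o, S k.+1 o =
     S k o + eta k * (acc (X k o) (X k o + L k o *m W k.+2 o) - alpha)).

Let phi_cont : continuous phi.
Proof. exact: nondecreasing_surj_continuous. Qed.

Let aL k : adapted (history k) (L k).
Proof.
apply: (adapted_comp (h := fun p : R * 'M[R]_d => p.1 *: p.2)) (adapted_pair _ (@aC k)).
  by apply: measurable_mxZ => //; exact: measurable_snd.
apply: adapted_comp (@aS k).
exact: continuous_measurable_fun.
Qed.

Let mL k : measurable_fun setT (L k) :=
  adapted_measurable (@history_measurable _ _ _ _ P W U k) (@aL k).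
Let mX k : measurable_fun setT (X k) :=
  adapted_measurable (@history_measurable _ _ _ _ P W U k) (@aX k).

Let uniform_gt0 : {ae P, forall o, forall k, 0 < U k.+2 o}.
Proof.
apply: ae_foralln => k.
have mA : measurable (`]-oo, (0 : R)]%classic) by exact: measurable_itv.
exists (U k.+2 @^-1` `]-oo, (0 : R)]%classic); split.
- exact: measurable_funPTI.
- have [_ lU _] := noise; have h := lU k.+2 _ isT mA.
  by rewrite [LHS]h uniform_prob_le// lexx ler01.
- by move=> o /=; rewrite in_itv/= => /negP; rewrite -leNgt.
Qed.

(* A proposal outside the support is accepted if U vanishes, so the chain stays
   in the support only almost surely. *)
Let support_of_uniform o : (forall k, 0 < U k.+2 o) -> forall k, target (X k o) != 0.
Proof.
move=> Upos; elim=> [|k IH]; first exact: X0.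
rewrite XS /mh_move/=; case: ifPn => // h; apply/eqP => t0.
by move: h; rewrite acc_out// leNgt Upos.
Qed.

Let support_ae : {ae P, forall o, forall k, target (X k o) != 0}.
Proof. by move: uniform_gt0; apply: filterS => o; exact: support_of_uniform. Qed.

Let Xsupp k : P [set o | target (X k o) == 0] = 0%E.
Proof.
apply: measure_negligible.
  apply: (@history_measurable _ _ _ _ P W U k).
  rewrite (_ : mkset _ = X k @^-1` (target @^-1` [set 0])); last first.
    by apply/seteqP; split=> o /eqP.
  by apply: (@aX k); rewrite -[X in measurable X]setTI; exact: mtarget.
have [N [mN N0 hN]] := support_ae; exists N; split => // o /= t0.
by apply: hN => /= /(_ k); rewrite t0.
Qed.

Let L_ge k o v : phi (S k o) * ca * enorm v <= enorm (L k o *m v).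
Proof. by rewrite /L -scalemxAl enormZ gtr0_norm// -mulrA ler_pM2l. Qed.

Let L_le k o v : enorm (L k o *m v) <= phi (S k o) * cb * enorm v.
Proof. by rewrite /L -scalemxAl enormZ gtr0_norm// -mulrA ler_pM2l. Qed.

Let L_sym k o : (L k o)^T = L k o.
Proof. by rewrite /L linearZ/= C_sym. Qed.

Let scale_bounded_ae : {ae P, forall o, exists B, forall k, `|S k o| <= B}.
Proof.
have [a0 a00 large] := acc_large; have [b0 b00 small] := acc_small.
(* Above s1 the lower bound phi(s) ca of L exceeds [a0]; below s2 the upper bound phi(s) cb falls
   under [b0]. The ratio of the bounds is always cb / ca. *)
have [s1 s1E] := phi_surj (divr_gt0 a00 ca0).
have [s2 s2E] := phi_surj (divr_gt0 b00 cb0).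
pose K := Num.max 0 (Num.max s1 (- s2)).
have K0 : 0 <= K by rewrite le_max lexx.
have Ks1 : s1 <= K by rewrite !le_max lexx !orbT.
have Ks2 : - s2 <= K by rewrite !le_max lexx !orbT.
apply: (scale_bounded noise QE UnE mtarget target_ge0 aL aX aS alpha01 K0 eta0 eta2 S0 X0 SS Xsupp).
- move=> k o tx KS; apply: large => // v; apply: le_trans (L_ge k o v).
  by rewrite ler_wpM2r ?enorm_ge0// -ler_pdivrMr// -s1E phi_mono// (le_trans Ks1).
- move=> k o tx KS; apply: (small _ tx (L k o) (phi (S k o) * ca) (phi (S k o) * cb)) => //.
  + by rewrite mulr_gt0.
  + by rewrite mulrCA divfK ?gt_eqF.
  + by rewrite -ler_pdivlMr// -s2E phi_mono//; move: KS; lra.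
Qed.

Variables (f : 'cV[R]_d -> R) (B : R).
Hypotheses (mf : measurable_fun setT f) (fB : forall x, 0 <= f x <= B).

Let B_ge0 : 0 <= B.
Proof. by have /andP[] := fB 0; exact: le_trans. Qed.

Local Notation G := (poisson_sum target Q f).

Let bG j : bmf (G j).
Proof. exact: bmf_poisson_sum. Qed.

Let increment j k o : R := G j (L k o, X k.+1 o) - mh target Q (G j) (L k o, X k o).

Let increment_le j k o : `|increment j k o| <= j%:R * B.
Proof.
have hG p : 0 <= G j p <= j%:R * B by exact: poisson_sum_bounds.
have /andP[h1 h2] := mh_bounds mtarget target_ge0 Q (L k o, X k o) (bG j) hG.
have /andP[h3 h4] := hG (L k o, X k.+1 o).
by rewrite /increment ler_norml; apply/andP; split; lra.
Qed.

Let history_mono i k : (i <= k)%N -> (<<s history i >>) `<=` (<<s history k >>).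
Proof.
move=> /subnK <-; elim: (k - i)%N => [|n IH] //.
by rewrite addSn; apply: subset_trans IH _; exact: history_incr.
Qed.

Let adapted_increment j k : adapted (history k.+1) (increment j k).
Proof.
have aLk : adapted (history k.+1) (L k) by apply: sub_adapted (@aL k); exact: history_mono.
have aXk : adapted (history k.+1) (X k) by apply: sub_adapted (@aX k); exact: history_mono.
have a1 : adapted (history k.+1) (fun o => G j (L k o, X k.+1 o)).
  exact: (adapted_comp (bmf_meas (bG j)) (adapted_pair aLk (@aX k.+1))).
have a2 : adapted (history k.+1) (fun o => mh target Q (G j) (L k o, X k o)).
  exact: (adapted_comp (bmf_meas (bmf_mh mtarget target_ge0 Q (bG j))) (adapted_pair aLk aXk)).
exact: (adapted_comp (h := fun z : R * R => z.1 - z.2)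
  (measurable_funB measurable_fst measurable_snd) (adapted_pair a1 a2)).
Qed.

Let bmf_increment j k : bmf (increment j k).
Proof.
split; last by exists (j%:R * B) => o.
exact: adapted_measurable (@history_measurable _ _ _ _ P W U k.+1) (@adapted_increment j k).
Qed.

(** For i < k the increment i is a function of the history at time k, and by [ER_mh_move] the two
    terms of the increment k have the same integral against it. *)
Let increment_orthogonal j i k : (i < k)%N ->
  \int[P]_o (increment j i o * increment j k o) = 0.
Proof.
move=> ik.
have bY : bmf (increment j i : g_sigma_algebraType (history k) -> R).
  split; last by exists (j%:R * B) => o.
  by apply/adaptedP; apply: sub_adapted (@adapted_increment j i); exact: history_mono.
have mLX : measurable_fun setT (fun o => (L k o, X k o)) by exact: measurable_fun_pair.
have mLX' : measurable_fun setT (fun o => (L k o, X k.+1 o)) by exact: measurable_fun_pair.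
have b1 : bmf (fun o => increment j i o * G j (L k o, X k.+1 o)).
  by apply: bmfM => //; exact: (bmf_comp mLX' (bG j)).
have b2 : bmf (fun o => increment j i o * mh target Q (G j) (L k o, X k o)).
  by apply: bmfM => //; exact: (bmf_comp mLX (bmf_mh mtarget target_ge0 Q (bG j))).
rewrite (eq_Rintegral _ (fun o _ => mulrBr (increment j i o) _ _)) (ERB P b1 b2).
rewrite -(ER_mh_move noise QE UnE mtarget target_ge0 (@aL k) (@aX k) bY (bG j)).
apply/eqP; rewrite subr_eq0; apply/eqP; apply: eq_Rintegral => o _.
by rewrite XS.
Qed.

Let increment_lln : {ae P, forall o, forall j,
  (fun n => n%:R^-1 * \sum_(k < n) increment j k o) @ \oo --> 0}.
Proof.
apply: ae_foralln => j; apply: (orthogonal_lln (c := j%:R * B)) => //.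
- by move=> k; exact: bmf_meas (bmf_increment j k).
- by move=> i k; exact: increment_orthogonal.
Qed.

Let eta_cvg0 : eta @ \oo --> 0.
Proof. exact: sqr_nneseries_lty_cvg0. Qed.

Let S_step k o : `|S k.+1 o - S k o| <= eta k.
Proof.
rewrite SS addrAC subrr add0r normrM ger0_norm// ler_piMr//.
have a0 := acc_ge0 target_ge0 (X k o) (X k o + L k o *m W k.+2 o).
have a1 := acc_le1 target (X k o) (X k o + L k o *m W k.+2 o).
by move: alpha01 => /andP[? ?]; rewrite ler_norml; apply/andP; split; lra.
Qed.

Theorem adaptive_chain_lln :
  {ae P, forall o, (fun n => n%:R^-1 * \sum_(k < n) f (X k o)) @ \oo --> \int[Pi]_x f x}.
Proof.
move: support_ae scale_bounded_ae increment_lln; apply: filterS3 => o tX [B' SB] lln.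
have B'0 : 0 <= B' by apply: le_trans (SB 0%N).
(* From here on the path is fixed: its bound B' on the scale determines a, b and thereby the rate of
   ergodicity. *)
pose a := phi (- B') * ca; pose b := phi B' * cb.
have a0 : 0 < a by rewrite mulr_gt0.
have b0 : 0 < b by rewrite mulr_gt0.
have SB' k : - B' <= S k o <= B' by rewrite -ler_norml.
have aL' k v : a * enorm v <= enorm (L k o *m v).
  apply: le_trans (L_ge k o v); rewrite ler_wpM2r ?enorm_ge0// ler_wpM2r ?(ltW ca0)//.
  by apply: phi_mono; case/andP: (SB' k).
have bL' k v : enorm (L k o *m v) <= b * enorm v.
  apply: le_trans (L_le k o v) _; rewrite ler_wpM2r ?enorm_ge0// ler_wpM2r ?(ltW cb0)//.
  by apply: phi_mono; case/andP: (SB' k).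
pose dk k := `|phi (S k.+1 o) - phi (S k o)| * cb + phi B' * gam k.
have dk0 k : 0 <= dk k by rewrite addr_ge0// mulr_ge0// ltW.
have Ldk k v : enorm ((L k.+1 o - L k o) *m v) <= dk k * enorm v.
  have -> : (L k.+1 o - L k o) *m v = (phi (S k.+1 o) - phi (S k o)) *: (C k.+1 o *m v) +
      phi (S k o) *: ((C k.+1 o - C k o) *m v).
    by rewrite /L mulmxBl -!scalemxAl mulmxBl scalerBl scalerBr addrA subrK.
  apply: le_trans (ler_enormD _ _) _; rewrite !enormZ mulrDl; apply: lerD.
    by rewrite -mulrA ler_wpM2l.
  rewrite gtr0_norm// -mulrA; apply: ler_pM => //; [exact: ltW|exact: enorm_ge0| |exact: C_step].
  by apply: phi_mono; case/andP: (SB' k).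
have dk_cvg : dk @ \oo --> 0.
  (* The steps of S are at most eta, which tends to 0, and phi is uniformly continuous around
     [- B', B']. *)
  have h1 : (fun k => phi (S k.+1 o) - phi (S k o)) @ \oo --> 0.
    apply/cvgrPdist_le => /= e e0.
    have [dl dl0 h] := continuous_unif_segment B' phi_cont e0.
    have /cvgrPdist_le/(_ _ dl0) := eta_cvg0; apply: filterS => k /=.
    rewrite !sub0r !normrN distrC (ger0_norm (eta0 k)) => ek; apply: h => //.
    by rewrite distrC; apply: le_trans (S_step k o) ek.
  have -> : (0 : R) = Num.norm (0 : R) * cb + phi B' * 0 by rewrite normr0 mul0r mulr0 addr0.
  apply: cvgD; apply: cvgM => //; first exact: (cvg_norm h1).
    exact: cvg_cst.
  exact: cvg_cst.
have dl0 := minorization_gt0 qhat_gt0 m_gt0 target_bounds diam_le a0 b0 (tX 0%N).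
have dl1 := minorization_le1 mtarget target_ge0 PiE mq q_ge0 QE qE qhat_gt0 qhat_decr
  m_gt0 target_bounds diam_le a0 b0 (aL' 0%N) (bL' 0%N) (tX 0%N).
apply: (@averages_cvg _ _ _ Q mtarget target_ge0 f B mf fB (X ^~ o) (L ^~ o) _
  (1 - minorization qhat m M D a b) (fun k => B * ((2 * d)%:R * (dk k / a)))).
- by apply/andP; split; lra.
- move=> j k; exact: (mh_iter_ergodic mtarget target_ge0 PiE mq q_ge0 QE qE qhat_gt0 qhat_decr
    m_gt0 target_bounds diam_le a0 b0 (aL' k) (bL' k) j mf fB (tX k)).
- move=> j k; exact: (mh_iter_lipschitz mtarget target_ge0 mq q_ge0 QE qE qhat_decr j (X k.+1 o)
    a0 (dk0 k) (aL' k) (aL' k.+1) (Ldk k) mf fB).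
- rewrite (_ : (fun k => _) = (fun k => B * (2 * d)%:R / a * dk k)); last first.
    by apply/funext => k; ring.
  rewrite -(mulr0 (B * (2 * d)%:R / a)); exact: cvgMr.
- exact: lln.
Qed.

End adaptive_chain.

(** * The two algorithms *)

Section density_probability.
Context {R : realType} {d : nat}.
Variables (p : 'cV[R]_d -> R) (dp : density p).

(** The proof of [density p] is an argument so that the measure and probability structures can be
    attached to the term [density_measure dp]. *)
Definition density_measure (_ : density p) (A : set 'cV[R]_d) : \bar R :=
  (\int[lebesgue_cV d]_(x in A) (p x)%:E)%E.

Let density_measure0 : density_measure dp set0 = 0%E.
Proof. by rewrite /density_measure integral_set0. Qed.

Let density_measure_ge0 A : (0 <= density_measure dp A)%E.
Proof. by have [_ p0 _] := dp; apply: integral_ge0 => x _; rewrite lee_fin. Qed.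

Let density_measure_sigma_additive : semi_sigma_additive (density_measure dp).
Proof.
have [mp p0 _] := dp.
move=> /= F mF tF mUF; rewrite /density_measure; apply: cvg_toP.
  apply: ereal_nondecreasing_is_cvgn => k n kn.
  apply: lee_sum_nneg_natr => // j _ _; apply: integral_ge0 => /= x Fkx.
  by rewrite lee_fin.
rewrite ge0_integral_bigcup//=.
- exact/measurable_funTS/measurable_EFinP.
- by move=> x _; rewrite lee_fin.
Qed.

HB.instance Definition _ := isMeasure.Build _ _ _ (density_measure dp)
  density_measure0 density_measure_ge0 density_measure_sigma_additive.

Let density_measure_setT : density_measure dp [set: 'cV[R]_d] = 1%E.
Proof. by have [_ _ h] := dp. Qed.

HB.instance Definition _ :=
  @Measure_isProbability.Build _ _ R (density_measure dp) density_measure_setT.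

End density_probability.

(** * Covariance matrices with bounded spectrum *)

Section covariance_set.
Context {R : realType} {n : nat}.
Implicit Types M : 'M[R]_n.+1.

(** The eigenvalue condition in terms of the quadratic form, which depends linearly on M and so
    makes measurability accessible. *)
Definition cov_set (a b : R) : set 'M[R]_n.+1 := [set M | M^T = M /\
  forall v, a * enorm v ^+ 2 <= qform M v <= b * enorm v ^+ 2].

Lemma mean_cov_setP zeta (m : 'cV[R]_n.+1) M :
  mean_cov_set zeta m M <-> enorm m <= zeta /\ cov_set zeta^-1 zeta M.
Proof.
split=> [[Ms mz eM]|[mz [Ms hM]]].
  by split => //; split => // v; exact: qform_bounds.
split=> // l el; have [v v0 Mv] := sym_eigenvalueP Ms el.
have vn : 0 < enorm v ^+ 2 by rewrite exprn_gt0// enorm_gt0.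
have := hM v; rewrite qformE Mv dotZr -enorm2.
by rewrite !ler_pM2r.
Qed.

Lemma entry_norm_le M e : (forall i j, `|M i j| <= e) -> entry_norm M <= (n.+1 ^ 2)%:R * e.
Proof.
move=> Me; rewrite /entry_norm natrX expr2 -mulrA.
apply: (@le_trans _ _ (\sum_(i < n.+1) (n.+1%:R * e))).
  apply: ler_sum => i _; rewrite mulr_natl -[n.+1 in leRHS]card_ord -sumr_const.
  exact: ler_sum.
by rewrite sumr_const card_ord -[leLHS]mulr_natl.
Qed.

Lemma qformB M M' v : qform (M - M') v = qform M v - qform M' v.
Proof. by rewrite /qform mulmxBr mulmxBl !mxE. Qed.

(** The complement is open: an asymmetric pair of entries, or a violation of the bounds at one
    vector v, survives a small change of the entries. *)
Lemma measurable_cov_set a b : measurable (cov_set a b).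
Proof.
rewrite -[cov_set a b]setCK; apply: measurableC.
rewrite -[X in measurable X]setTI; apply: relatively_open_measurable => // M _ nM.
have [Ms|Ms] := eqVneq M^T M; last first.
  have [i [j Mij]] : exists i j, M i j != M j i.
    apply: contrapT => h; case/eqP: Ms; apply/matrixP => i j; rewrite mxE.
    by apply/eqP/negP => /negP hij; apply: h; exists j, i.
  have e0 : 0 < `|M i j - M j i| / 2 by rewrite divr_gt0// normr_gt0 subr_eq0.
  exists (`|M i j - M j i| / 2) => // M' _ h [M's _].
  have e1 := h i j; have e2 := h j i.
  have M'ij : M' i j = M' j i by rewrite -[in LHS]M's mxE.
  move: e1 e2; rewrite M'ij => e1 e2.
  have : `|M i j - M j i| <= `|M' j i - M i j| + `|M' j i - M j i|.
    rewrite (_ : M i j - M j i = (M' j i - M j i) - (M' j i - M i j)); last by ring.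
    by rewrite [leRHS]addrC; exact: ler_normB.
  lra.
have [v [g [g0 hg]]] : exists (v : 'cV[R]_n.+1) (g : R), 0 < g /\
    forall x, `|x - qform M v| < g -> ~ (a * enorm v ^+ 2 <= x <= b * enorm v ^+ 2).
  have [v hv] : exists v, ~ (a * enorm v ^+ 2 <= qform M v <= b * enorm v ^+ 2).
    by apply: contrapT => h; apply: nM; split=> // v; apply: contrapT => hv; apply: h; exists v.
  clear Ms nM; have [h1|h1] := ltP (qform M v) (a * enorm v ^+ 2).
    exists v, (a * enorm v ^+ 2 - qform M v); rewrite subr_gt0; split=> // x.
    by rewrite ltr_norml => /andP[h2 h3] /andP[h4 h5]; lra.
  have h2 : b * enorm v ^+ 2 < qform M v.
    by rewrite ltNge; apply/negP => h2; apply: hv; rewrite h1.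
  exists v, (qform M v - b * enorm v ^+ 2); rewrite subr_gt0; split=> // x.
  by rewrite ltr_norml => /andP[h3 h4] /andP[h5 h6]; lra.
have N0 : (0 : R) < (n.+1 ^ 2)%:R by rewrite ltr0n expn_gt0.
have v1 : 0 < enorm v ^+ 2 + 1 by rewrite ltr_wpDl// sqr_ge0.
exists (g / ((n.+1 ^ 2)%:R * (enorm v ^+ 2 + 1))); first by rewrite divr_gt0// mulr_gt0.
move=> M' _ h [M's hM']; apply: hg (hM' v).
rewrite -qformB; apply: le_lt_trans (normr_qform_le _ _) _.
apply: (@le_lt_trans _ _ (g / (enorm v ^+ 2 + 1) * enorm v ^+ 2)).
  rewrite ler_wpM2r ?sqr_ge0//.
  apply: (@le_trans _ _ ((n.+1 ^ 2)%:R * (g / ((n.+1 ^ 2)%:R * (enorm v ^+ 2 + 1))))).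
    by apply: entry_norm_le => i j; rewrite !mxE ltW//; exact: h.
  by rewrite le_eqVlt; apply/orP; left; apply/eqP; field; rewrite !gt_eqF.
by rewrite mulrAC ltr_pdivrMr// ltr_pM2l// ltrDl.
Qed.

Lemma normr_entry_le_mulmx M i j : `|M i j| <= enorm (M *m delta_mx j 0 : 'cV[R]_n.+1).
Proof.
by apply: le_trans (normr_entry_le_enorm _ i); rewrite -colE mxE.
Qed.

Lemma enorm_delta (j : 'I_n.+1) : enorm (delta_mx j 0 : 'cV[R]_n.+1) = 1.
Proof.
apply/eqP; rewrite -sqrp_eq1 ?enorm_ge0// enorm2 /dot (bigD1 j)//= big1 => [|i ij].
  by rewrite !mxE !eqxx mulr1 addr0.
by rewrite !mxE (negPf ij) mul0r.
Qed.

(** On [cov_set a b] with a > 0 the square root is Lipschitz in the entries; a bound on the operator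
    norm of a difference bounds each of its entries. *)
Lemma measurable_sqrtmx_entry a b i j : 0 < a ->
  measurable_fun (cov_set a b) (fun M => sqrtmx M i j).
Proof.
move=> a0; apply: relatively_continuous_measurable; first exact: measurable_cov_set.
move=> M [Ms hM] e e0.
have sa : 0 < 2 * Num.sqrt a by rewrite mulr_gt0// sqrtr_gt0.
have N0 : (0 : R) < (n.+1 ^ 2)%:R by rewrite ltr0n expn_gt0.
exists (e / 2 * (2 * Num.sqrt a) / (n.+1 ^ 2)%:R); first by rewrite divr_gt0// mulr_gt0// divr_gt0.
move=> M' [M's hM'] h.
have := normr_entry_le_mulmx (sqrtmx M' - sqrtmx M) i j; rewrite !mxE => /le_lt_trans; apply.
apply: le_lt_trans (sqrtmx_lipschitz a0 M's Ms hM' hM _) _.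
rewrite enorm_delta mulr1 ltr_pdivrMr//.
apply: (@le_lt_trans _ _ (e / 2 * (2 * Num.sqrt a))); last first.
  by rewrite ltr_pM2r// ltr_pdivrMr// ltr_pMr// ltr1n.
apply: (@le_trans _ _ ((n.+1 ^ 2)%:R * (e / 2 * (2 * Num.sqrt a) / (n.+1 ^ 2)%:R))).
  by apply: entry_norm_le => k l; rewrite !mxE ltW//; exact: h.
by rewrite mulrC divfK// gt_eqF.
Qed.

Lemma adapted_sqrtmx {dO} {Omega : measurableType dO} (G : set (set Omega))
    (Y : Omega -> 'M[R]_n.+1) a b : 0 < a -> (forall o, cov_set a b (Y o)) ->
  adapted G Y -> adapted G (fun o => sqrtmx (Y o)).
Proof.
move=> a0 hY aY; apply/adaptedP; apply: measurable_fun_mx => i j; apply/adaptedP => A mA.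
rewrite (_ : _ @^-1` A = Y @^-1` (cov_set a b `&` (fun M => sqrtmx M i j) @^-1` A)); last first.
  by apply/seteqP; split=> o /=; [move=> h; split|case].
by apply: aY; apply: measurable_sqrtmx_entry => //; exact: measurable_cov_set.
Qed.

End covariance_set.

(** * Measurability of the algorithms with respect to the history *)

Section adaptive_scaling_adapted.
Context {R : realType} {dO : measure_display} {Omega : measurableType dO} {d : nat}.
Variables (P : probability Omega R) (target : 'cV[R]_d -> R)
  (W : nat -> {RV P >-> 'cV[R]_d}) (U : nat -> {RV P >-> R}).
Variables (phi : R -> R) (eta : nat -> R) (alpha : R)
  (C : nat -> Omega -> 'M[R]_d) (x1 : 'cV[R]_d) (s1 : R)
  (X : nat -> Omega -> 'cV[R]_d) (S : nat -> Omega -> R).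
Hypotheses (mtarget : measurable_fun setT target) (target_ge0 : forall x, 0 <= target x)
  (mphi : measurable_fun setT phi)
  (scaling : adaptive_scaling target phi eta alpha W U C x1 s1 X S).

Local Notation history := (history W U).

Lemma adaptive_scaling_X k o : X k.+2 o =
  mh_move target ((phi (S k.+1 o) *: C k.+1 o, X k.+1 o), (W k.+2 o, U k.+2 o)).
Proof.
have [_ _ /(_ k.+2 o isT) [-> _]] := scaling.
by rewrite /mh_move/= -scalemxAl.
Qed.

Lemma adaptive_scaling_S k o : S k.+2 o = S k.+1 o + eta k.+2 *
  (acc target (X k.+1 o) (X k.+1 o + phi (S k.+1 o) *: C k.+1 o *m W k.+2 o) - alpha).
Proof.
have [_ _ /(_ k.+2 o isT) [_ ->]] := scaling.
by rewrite /= -scalemxAl.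
Qed.

Lemma adapted_init : adapted (history 0) (X 1) /\ adapted (history 0) (S 1).
Proof.
have [_ init _] := scaling.
have -> : X 1 = fun=> x1 by apply/funext => o; case: (init o).
have -> : S 1 = fun=> s1 by apply/funext => o; case: (init o).
by split; exact: adapted_cst.
Qed.

Lemma adapted_step k : adapted (history k) (C k.+1) -> adapted (history k) (X k.+1) ->
  adapted (history k) (S k.+1) ->
  adapted (history k.+1) (X k.+2) /\ adapted (history k.+1) (S k.+2).
Proof.
move=> aC aX aS.
have up dT (T : measurableType dT) (Y : Omega -> T) :
    adapted (history k) Y -> adapted (history k.+1) Y.
  by apply: sub_adapted; exact: history_incr.
have aL : adapted (history k.+1) (fun o => phi (S k.+1 o) *: C k.+1 o).
  apply: (adapted_comp (h := fun p : R * 'M[R]_d => p.1 *: p.2) _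
    (adapted_pair (adapted_comp mphi (up _ _ _ aS)) (up _ _ _ aC))).
  by apply: measurable_mxZ => //; exact: measurable_snd.
have az := adapted_pair (adapted_pair aL (up _ _ _ aX))
  (adapted_pair (@adapted_W _ _ _ _ P W U k) (@adapted_U _ _ _ _ P W U k)).
split.
  rewrite (_ : X k.+2 = fun o => mh_move target
    ((phi (S k.+1 o) *: C k.+1 o, X k.+1 o), (W k.+2 o, U k.+2 o))); last first.
    by apply/funext => o; exact: adaptive_scaling_X.
  exact: (adapted_comp (measurable_mh_move mtarget target_ge0) az).
rewrite (_ : S k.+2 = fun o => S k.+1 o + eta k.+2 *
  (acc target (X k.+1 o) (X k.+1 o + phi (S k.+1 o) *: C k.+1 o *m W k.+2 o) - alpha)); last first.
  by apply/funext => o; exact: adaptive_scaling_S.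
have aacc := adapted_comp (bmf_meas (bmf_move_acc mtarget target_ge0)) az.
apply: (adapted_comp (h := fun p : R * R => p.1 + eta k.+2 * (p.2 - alpha)) _
  (adapted_pair (up _ _ _ aS) aacc)).
apply: measurable_funD; first exact: measurable_fst.
apply: measurable_funM => //; apply: measurable_funB => //; exact: measurable_snd.
Qed.

End adaptive_scaling_adapted.

Section algorithms_lln.
Context {R : realType} {dO : measure_display} {Omega : measurableType dO} {n : nat}.
Local Notation d := n.+1.
Variables (P : probability Omega R) (target q : 'cV[R]_d -> R) (qhat : R -> R)
  (W : nat -> {RV P >-> 'cV[R]_d}) (U : nat -> {RV P >-> R}).
Variables (Q Pi : probability 'cV[R]_d R) (Un : probability R R) (m M r : R).
Hypotheses (noise : driving_noise q W U)
  (QE : forall A, measurable A -> Q A = (\int[lebesgue_cV d]_(z in A) (q z)%:E)%E)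
  (UnE : forall A, measurable A -> Un A = uniform_prob (@ltr01 R) A)
  (mtarget : measurable_fun setT target) (target_ge0 : forall x, 0 <= target x)
  (PiE : forall A, measurable A -> Pi A = (\int[lebesgue_cV d]_(x in A) (target x)%:E)%E)
  (mq : measurable_fun setT q) (q_ge0 : forall x, 0 <= q x)
  (qE : forall z, q z = qhat (enorm z)) (qhat_gt0 : forall x, 0 <= x -> 0 < qhat x)
  (qhat_decr : forall x y, 0 <= x -> x <= y -> qhat y <= qhat x)
  (m_gt0 : 0 < m) (target_bounds : forall x, target x != 0 -> m <= target x <= M)
  (target_r : forall x, target x != 0 -> enorm x <= r)
  (supportP : forall x, dsupport target x <-> target x != 0)
  (target_compact : compact (dsupport target))
  (target_continuous : {within dsupport target, continuous target})
  (normals : forall x, boundary (dsupport target) x ->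
     exists n, outer_normal (dsupport target) x n).
Variables (phi : R -> R) (eta : nat -> R) (alpha : R).
Hypotheses (phi_mono : {homo phi : s t / s <= t}) (phi_gt0 : forall s, 0 < phi s)
  (phi_surj : forall y, 0 < y -> exists s, phi s = y)
  (alpha0 : 0 < alpha) (alpha2 : alpha < 2^-1)
  (eta0 : forall k, 0 <= eta k.+2)
  (eta2 : (\sum_(0 <= k <oo) (eta k.+2 ^+ 2)%:E < +oo)%E).
Variables (f : 'cV[R]_d -> R) (B : R).
Hypotheses (mf : measurable_fun setT f) (fB : forall x, 0 <= f x <= B).

Local Notation history := (history W U).

Let mphi : measurable_fun setT phi.
Proof. by apply: continuous_measurable_fun; exact: nondecreasing_surj_continuous. Qed.

Let target_diam x y : target x != 0 -> target y != 0 -> enorm (x - y) <= r + r.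
Proof.
by move=> tx ty; apply: le_trans (ler_enormB _ _) _; apply: lerD; exact: target_r.
Qed.

Let eta_cvg0 : (fun k => eta k.+2) @ \oo --> 0.
Proof. exact: sqr_nneseries_lty_cvg0. Qed.

(** Common core of both algorithms: about the shape matrices it asks for two-sided bounds, symmetry,
    and increments of order eta while the chain is in the support. The processes are shifted by one
    so that time starts at 0, and the step sizes by two. *)
Lemma adaptive_scaling_lln (C : nat -> Omega -> 'M[R]_d) x1 s1 X S ca cb c :
  adaptive_scaling target phi eta alpha W U C x1 s1 X S ->
  0 < ca -> 0 < cb -> 0 <= c ->
  (forall k o v, ca * enorm v <= enorm (C k.+1 o *m v)) ->
  (forall k o v, enorm (C k.+1 o *m v) <= cb * enorm v) ->
  (forall k o, (C k.+1 o)^T = C k.+1 o) ->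
  (forall k o v, target (X k.+2 o) != 0 ->
     enorm ((C k.+2 o - C k.+1 o) *m v) <= eta k.+2 * c * enorm v) ->
  (forall k, adapted (history k) (C k.+1)) ->
  (forall k, adapted (history k) (X k.+1)) ->
  (forall k, adapted (history k) (S k.+1)) ->
  {ae P, forall w, (fun n : nat => n%:R^-1 * \sum_(1 <= k < n.+1) f (X k w)) @ \oo -->
    \int[Pi]_x f x}.
Proof.
move=> scaling ca0 cb0 c0 Cge Cle Csym Cstep aC aX aS.
have [tx1 init _] := scaling.
have alpha01 : 0 <= alpha <= 1 by apply/andP; split; move: alpha0 alpha2; lra.
have X0 o : target (X 1%N o) != 0 by have [-> _] := init o; rewrite gt_eqF.
have S0 o : S 1%N o = s1 by case: (init o).
have gam0 : (fun k => eta k.+2 * c) @ \oo --> 0.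
  by rewrite -(mul0r c); apply: cvgM => //; exact: cvg_cst.
have large := acceptance_large (ltn0Sn n) mtarget target_ge0 mq q_ge0 QE qE qhat_gt0 qhat_decr
  target_diam alpha0.
have small := @acceptance_small _ _ target q qhat Q m (ltn0Sn n) mtarget target_ge0 mq q_ge0 QE
  qE qhat_gt0 qhat_decr m_gt0 (fun x tx => proj1 (andP (target_bounds tx))) supportP
  target_compact target_continuous normals (cb / ca) alpha (divr_gt0 cb0 ca0) alpha2.
have := adaptive_chain_lln noise QE UnE mtarget target_ge0 PiE mq q_ge0 qE qhat_gt0 qhat_decr
  m_gt0 target_bounds target_diam phi_mono phi_gt0 phi_surj alpha01 eta0 eta2 large small ca0 cb0
  Cge Cle Csym Cstep (fun k => mulr_ge0 (eta0 k) c0) gam0 aC aX aS S0 X0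
  (adaptive_scaling_X scaling) (adaptive_scaling_S scaling) mf fB.
apply: filterS => o; apply: cvg_trans; apply: near_eq_cvg; apply: nearW => N.
by rewrite big_add1 big_mkord.
Qed.

Lemma asm_lln X : asm target phi eta alpha W U X ->
  {ae P, forall w, (fun n : nat => n%:R^-1 * \sum_(1 <= k < n.+1) f (X k w)) @ \oo -->
    \int[Pi]_x f x}.
Proof.
move=> [Sigma [x1 [s1 [S [Sp scaling]]]]].
have Ss := proj1 Sp; have [a [b [a0 ab]]] := sym_posdef_bounds Sp.
have b0 : 0 < b.
  have /andP[h1 h2] := ab (delta_mx 0 0); have := le_trans h1 h2.
  by rewrite enorm_delta expr1n !mulr1; exact: lt_le_trans.
have aXS k : adapted (history k) (X k.+1) /\ adapted (history k) (S k.+1).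
  elim: k => [|k [aX aS]]; first exact: (adapted_init scaling).
  have aC : adapted (history k) (fun=> sqrtmx Sigma) by exact: adapted_cst.
  have := adapted_step mtarget target_ge0 mphi scaling aC aX aS.
  exact.
apply: (adaptive_scaling_lln (ca := Num.sqrt a) (cb := Num.sqrt b) (c := 0) scaling).
- by rewrite sqrtr_gt0.
- by rewrite sqrtr_gt0.
- by [].
- by move=> k o v; exact: (sqrtmx_enorm_ge Ss a0 ab).
- by move=> k o v; exact: (sqrtmx_enorm_le Ss a0 ab).
- by move=> k o; exact: (sqrtmx_sym Ss a0 ab).
- by move=> k o v _; rewrite subrr mul0mx enorm0 mulr0 mul0r.
- by move=> k; exact: adapted_cst.
- by move=> k; case: (aXS k).
- by move=> k; case: (aXS k).
Qed.

Lemma aswam_lln X : aswam target phi eta alpha W U X ->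
  {ae P, forall w, (fun n : nat => n%:R^-1 * \sum_(1 <= k < n.+1) f (X k w)) @ \oo -->
    \int[Pi]_x f x}.
Proof.
move=> [zeta [Sigma1 [x1 [s1 [S [mu [Sigma [zeta1 _ mc1 scaling [init step]]]]]]]]].
have zeta0 : 0 < zeta by exact: lt_le_trans zeta1.
have z'0 : 0 < zeta^-1 by rewrite invr_gt0.
pose m' k o := (1 - eta k.+2) *: mu k.+1 o + eta k.+2 *: X k.+2 o.
pose M' k o := (1 - eta k.+2) *: Sigma k.+1 o +
  eta k.+2 *: ((X k.+2 o - mu k.+1 o) *m (X k.+2 o - mu k.+1 o)^T).
pose A k := [set o | mean_cov_set zeta (m' k o) (M' k o)].
have stepE k o : mu k.+2 o = (if `[< A k o >] then m' k o else mu k.+1 o) /\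
    Sigma k.+2 o = (if `[< A k o >] then M' k o else Sigma k.+1 o).
  by have := step k.+2 o isT; rewrite /A /m' /M' /=; case: ifP => _ [-> ->].
have mc k o : mean_cov_set zeta (mu k.+1 o) (Sigma k.+1 o).
  elim: k => [|k IH]; first by have [-> ->] := init o.
  by have [-> ->] := stepE k o; case: ifP => // /asboolP.
have cov k o : cov_set zeta^-1 zeta (Sigma k.+1 o) by case/mean_cov_setP: (mc k o).
have up k dT (T : measurableType dT) (Y : Omega -> T) :
    adapted (history k) Y -> adapted (history k.+1) Y.
  by apply: sub_adapted; exact: history_incr.
(* The four processes have to be treated together: the next point depends on Sigma, and the next
   Sigma on the new point and on mu. Measurability of [sqrtmx] rests on Sigma remaining in
   [cov_set]. *)
have aall k : [/\ adapted (history k) (X k.+1), adapted (history k) (S k.+1),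
    adapted (history k) (mu k.+1) & adapted (history k) (Sigma k.+1)].
  elim: k => [|k [aX aS am aM]].
    have [aX aS] := adapted_init scaling; split => //.
      have -> : mu 1%N = fun=> x1 by apply/funext => o; case: (init o).
      exact: adapted_cst.
    have -> : Sigma 1%N = fun=> Sigma1 by apply/funext => o; case: (init o).
    exact: adapted_cst.
  have aC : adapted (history k) (fun o => sqrtmx (Sigma k.+1 o)).
    exact: (adapted_sqrtmx z'0 (cov k) aM).
  have [aX' aS'] := adapted_step mtarget target_ge0 mphi scaling aC aX aS.
  have /adaptedP mX := aX'; have /adaptedP mm := up _ _ _ _ am; have /adaptedP mM := up _ _ _ _ aM.
  have am' : adapted (history k.+1) (m' k).
    apply/adaptedP; apply: measurable_mxD; exact: measurable_mxZ.
  have mXm : measurable_fun (T := g_sigma_algebraType (history k.+1)) setT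
      (fun o => X k.+2 o - mu k.+1 o).
    by apply: measurable_mxD => //; exact: measurable_mxN.
  have aM' : adapted (history k.+1) (M' k).
    apply/adaptedP; apply: measurable_mxD; apply: measurable_mxZ => //.
    by apply: measurable_mxM => //; exact: measurable_mxT.
  have mA : (<<s history k.+1 >>) (A k).
    rewrite (_ : A k = m' k @^-1` [set v | enorm v <= zeta] `&` M' k @^-1` cov_set zeta^-1 zeta).
      apply: (@measurableI _ (g_sigma_algebraType (history k.+1))); last first.
        by apply: aM'; exact: measurable_cov_set.
      apply: am'.
      have := measurable_fun_ler (@measurable_enorm R d) (measurable_cst zeta).
      move=> /(_ measurableT [set true]); rewrite setTI => h.
      by rewrite (_ : mkset _ = (fun t => enorm t <= zeta) @^-1` [set true])//; exact: h.
    by apply/seteqP; split=> o; rewrite /A /=; move/mean_cov_setP.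
  split=> //.
    rewrite (_ : mu k.+2 = fun o => if `[< A k o >] then m' k o else mu k.+1 o).
      by apply: adapted_if => //; exact: up.
    by apply/funext => o; case: (stepE k o).
  rewrite (_ : Sigma k.+2 = fun o => if `[< A k o >] then M' k o else Sigma k.+1 o).
    by apply: adapted_if => //; exact: up.
  by apply/funext => o; case: (stepE k o).
have r0 : 0 <= r.
  have [tx1 _ _] := scaling.
  by apply: le_trans (target_r (x := x1) _); rewrite ?enorm_ge0// gt_eqF.
(* Each entry of (X - mu) (X - mu)^T - Sigma is at most (r + zeta)^2 + zeta in absolute value, with
   |X| <= r on the support and |mu|, |Sigma| <= zeta; there are d^2 entries. *)
pose c0 : R := (d ^ 2)%:R * ((r + zeta) ^+ 2 + zeta).
have c00 : 0 <= c0 by rewrite mulr_ge0// addr_ge0 ?sqr_ge0// ltW.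
have Sigma_step k o : target (X k.+2 o) != 0 ->
    entry_norm (Sigma k.+2 o - Sigma k.+1 o) <= eta k.+2 * c0.
  move=> tx; have [_ ->] := stepE k o; case: ifP => _; last first.
    rewrite subrr; apply: (@le_trans _ _ 0); last exact: mulr_ge0.
    by apply: le_trans (entry_norm_le (e := 0) _) _; rewrite ?mulr0// => i j; rewrite mxE normr0.
  rewrite /c0 mulrCA; apply: entry_norm_le => i j.
  rewrite (_ : M' k o - Sigma k.+1 o = eta k.+2 *:
      ((X k.+2 o - mu k.+1 o) *m (X k.+2 o - mu k.+1 o)^T - Sigma k.+1 o)); last first.
    by rewrite /M' scalerBr scalerBl scale1r addrAC [X in X + _ = _]addrAC subrr add0r addrC.
  rewrite mxE normrM ger0_norm// ler_wpM2l// !mxE; apply: le_trans (ler_normB _ _) _.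
  apply: lerD.
    rewrite big_ord_recl big_ord0 addr0 !mxE normrM expr2.
    have [_ mz _] := mc k o.
    have Xm : enorm (X k.+2 o - mu k.+1 o) <= r + zeta.
      by apply: le_trans (ler_enormB _ _) _; apply: lerD => //; exact: target_r.
    apply: ler_pM => //; apply: le_trans Xm.
      by have := normr_entry_le_enorm (X k.+2 o - mu k.+1 o) i; rewrite !mxE.
    by have := normr_entry_le_enorm (X k.+2 o - mu k.+1 o) j; rewrite !mxE.
  have [Ss _ es] := mc k o.
  apply: le_trans (normr_entry_le_mulmx _ _ _) _; rewrite -[leRHS]mulr1 -(@enorm_delta R n j).
  apply: enorm_mulmx_eigenvalue => //; first exact: ltW.
  by move=> l /es /andP[h1 h2]; rewrite ger0_norm// (le_trans _ h1)// ltW.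
(* 1 / s is the Lipschitz constant of the square root on matrices with spectrum above 1 / zeta. *)
pose s := 2 * Num.sqrt zeta^-1.
have s0 : 0 < s by rewrite mulr_gt0// sqrtr_gt0.
apply: (adaptive_scaling_lln (ca := Num.sqrt zeta^-1) (cb := Num.sqrt zeta) (c := c0 / s) scaling).
- by rewrite sqrtr_gt0.
- by rewrite sqrtr_gt0.
- by rewrite divr_ge0// ltW.
- by move=> k o v; have [Ss hS] := cov k o; exact: (sqrtmx_enorm_ge Ss z'0 hS).
- by move=> k o v; have [Ss hS] := cov k o; exact: (sqrtmx_enorm_le Ss z'0 hS).
- by move=> k o; have [Ss hS] := cov k o; exact: (sqrtmx_sym Ss z'0 hS).
- move=> k o v tx; have [Ss hS] := cov k o; have [Ss' hS'] := cov k.+1 o.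
  apply: le_trans (sqrtmx_lipschitz z'0 Ss' Ss hS' hS v) _.
  by rewrite ler_wpM2r ?enorm_ge0// mulrA ler_wpM2r ?invr_ge0 ?(ltW s0)//; exact: Sigma_step.
- by move=> k; have [_ _ _ aM] := aall k; exact: (adapted_sqrtmx z'0 (cov k) aM).
- by move=> k; case: (aall k).
- by move=> k; case: (aall k).
Qed.

End algorithms_lln.

(** The nonnegative case is [ge0_integral_density]; it is applied to f + K, and the constant K
    cancels because p has integral 1. *)
Lemma integral_density_measure {R : realType} d (p f : 'cV[R]_d -> R) (dp : density p) :
  bmf f -> \int[density_measure dp]_x f x = \int[lebesgue_cV d]_x (f x * p x).
Proof.
have [mp p0 p1] := dp => -[mf [K fK]].
have ip : (lebesgue_cV d).-integrable setT (EFin \o p).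
  apply/integrableP; split; first exact/measurable_EFinP.
  rewrite (eq_integral (fun x => (p x)%:E)) ?p1 ?ltry// => x _ /=.
  by rewrite ger0_norm.
have ifp : (lebesgue_cV d).-integrable setT (EFin \o (fun x => f x * p x)).
  apply: (le_integrable measurableT _ _ (integrableZl measurableT K ip)).
    by apply/measurable_EFinP; exact: measurable_funM.
  move=> x _ /=; rewrite lee_fin !normrM; apply: ler_wpM2r => //.
  by apply: le_trans (fK x) _; exact: ler_norm.
have iKp : (lebesgue_cV d).-integrable setT (EFin \o (fun x => K * p x)).
  exact: (integrableZl measurableT K ip).
have fK0 x : 0 <= f x + K by have := fK x; rewrite ler_norml => /andP[]; lra.
have bfK : bmf (fun x => f x + K) by apply: bmfD; [split => //; exists K|exact: bmf_cst].
have h : \int[density_measure dp]_x (f x + K) = \int[lebesgue_cV d]_x (f x * p x + K * p x).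
  rewrite /Rintegral (ge0_integral_density (mu := lebesgue_cV d) mp p0)//.
    by congr fine; apply: eq_integral => x _; rewrite -EFinM mulrDl.
  by apply/measurable_EFinP; exact: (bmf_meas bfK).
have bf : bmf f by split => //; exists K.
move: h; rewrite (ERD (density_measure dp) bf (bmf_cst K)) ER_cst (RintegralD measurableT ifp iKp).
have -> : \int[lebesgue_cV d]_x (K * p x) = K.
  rewrite RintegralZl// [X in K * X](_ : _ = 1) ?mulr1//.
  by rewrite /Rintegral p1.
by move/addIr.
Qed.

Lemma compact_enorm_le {R : realType} d (A : set 'cV[R]_d) : compact A ->
  exists r, forall x, A x -> enorm x <= r.
Proof.
move=> /compact_near_coveringP/(_ R (pinfty_nbhs R) (fun r x => enorm x <= r)).
case=> [p _|r [_ h]].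
  exists ([set x | enorm (x - p) < 1], [set r | enorm p + 1 < r]) => /=.
    by split; [exact: near_enorm_lt|exists (enorm p + 1); rewrite num_real].
  move=> [x r] /= [xp pr]; apply: le_trans (ltW pr).
  rewrite (_ : x = p + (x - p)); last by rewrite addrC subrK.
  by apply: le_trans (ler_enormD _ _) _; rewrite lerD2l ltW.
by exists (r + 1) => x Ax; apply: h => //; rewrite ltrDl.
Qed.

Theorem theorem7 (R : realType) (d : nat) (d_gt0 : (0 < d)%N)
    (dO : measure_display) (Omega : measurableType dO) (P : probability Omega R)
    (target q : 'cV[R]_d -> R) (phi : R -> R) (eta : nat -> R) (alpha_star : R)
    (W : nat -> {RV P >-> 'cV[R]_d}) (U : nat -> {RV P >-> R})
    (X : nat -> Omega -> 'cV[R]_d) (f : 'cV[R]_d -> R)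
    (target_density : density target)
    (target_compact : compact (dsupport target))
    (target_continuous : {within dsupport target, continuous target})
    (target_bounds : exists m M : R, 0 < m /\
      forall x, dsupport target x -> m <= target x <= M)
    (target_normals :
      uniformly_continuous_normals (fun _ : unit => dsupport target))
    (alpha_star_range : 0 < alpha_star < 2^-1)
    (phi_scaling : scaling_function phi)
    (q_proposal : proposal_density q)
    (eta_steps : step_sizes eta)
    (noise : driving_noise q W U)
    (generated : asm target phi eta alpha_star W U X \/
                 aswam target phi eta alpha_star W U X)
    (f_measurable : measurable_fun setT f)
    (f_bounded : exists M : R, forall x, `|f x| <= M) :
  {ae P, forall w,
    (fun n : nat => n%:R^-1 * \sum_(1 <= k < n.+1) f (X k w)) @ \oo -->
    \int[lebesgue_cV d]_x (f x * target x)}.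
Proof.
(* Polynomials in a matrix use the ring structure on matrices of size n + 1. *)
destruct d as [|n]; first by [].
have [mtarget target_ge0 _] := target_density.
have [m [M [m0 hb]]] := target_bounds.
have supportP x : dsupport target x <-> target x != 0.
  split=> [/hb /andP[mx _]|tx]; first by rewrite gt_eqF// (lt_le_trans m0).
  exact: subset_closure.
have tb x : target x != 0 -> m <= target x <= M by move=> /supportP; exact: hb.
have [r hr] := compact_enorm_le target_compact.
have tr x : target x != 0 -> enorm x <= r by move=> /supportP; exact: hr.
have normals x : boundary (dsupport target) x -> exists nx, outer_normal (dsupport target) x nx.
  by have [_ [nrm [hn _]]] := target_normals => bx; exists (nrm tt x); exact: hn.
have [[mq q0 _] [qhat [dqhat [[qE qpos _ qdecr _] _]]]] := q_proposal.
have [lW lU _] := noise.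
(* All variables with index at least 2 have these two laws, which thus serve as the proposal and
   uniform probabilities. *)
pose Q := distribution P (W 2); pose Un := distribution P (U 2).
have QE A (mA : measurable A) : Q A = (\int[lebesgue_cV n.+1]_(z in A) (q z)%:E)%E.
  exact: (lW 2 A isT mA).
have UnE A (mA : measurable A) : Un A = uniform_prob (@ltr01 R) A by exact: (lU 2 A isT mA).
pose Pi := density_measure target_density.
have [mono [ppos psurj] _ _] := phi_scaling.
have /andP[al0 al2] := alpha_star_range.
have [e0 _ e2] := eta_steps.
have eta2 : (\sum_(0 <= k <oo) (eta k.+2 ^+ 2)%:E < +oo)%E.
  move: e2; rewrite -(nneseries_addn (f := fun k => (eta k ^+ 2)%:E) 2); last first.
    by move=> i; rewrite lee_fin sqr_ge0.
  by under eq_eseriesr do rewrite addn2.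
have [K fK] := f_bounded.
have bf : bmf f by split=> //; exists K.
have fK01 x : 0 <= f x + K <= 2 * K.
  by have := fK x; rewrite ler_norml => /andP[h1 h2]; apply/andP; split; lra.
have mfK : measurable_fun setT (fun x => f x + K) by exact: measurable_funD.
(* The averages were treated for functions with values in [0, B]; f + K qualifies with B = 2 K, and
   K is subtracted afterwards. *)
suff : {ae P, forall w, (fun n : nat => n%:R^-1 * \sum_(1 <= k < n.+1) (f (X k w) + K)) @ \oo -->
    \int[Pi]_x (f x + K)}.
  apply: filterS => w; rewrite (ERD Pi bf (bmf_cst K)) ER_cst integral_density_measure//.
  move=> h; rewrite -[\int[_]_x _](addrK K).
  have hK : (fun N : nat => N%:R^-1 * \sum_(1 <= k < N.+1) (f (X k w) + K) - K) @ \oo -->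
      \int[lebesgue_cV n.+1]_x (f x * target x) + K - K by apply: cvgB h _; exact: cvg_cst.
  apply: cvg_trans hK; apply: near_eq_cvg; exists 1%N => // N /= N0.
  rewrite big_split/= sumr_const_nat subn1/= mulrDr -[K *+ N]mulr_natl mulKf ?addrK//.
  by rewrite pnatr_eq0 -lt0n.
case: generated => gen.
- exact: (asm_lln (Pi := Pi) noise QE UnE mtarget target_ge0 (fun A _ => erefl) mq q0 qE qpos qdecr
    m0 tb tr supportP target_compact target_continuous normals mono ppos psurj al0 al2
    (fun k => e0 k.+2 isT) eta2 mfK fK01 gen).
- exact: (aswam_lln (Pi := Pi) noise QE UnE mtarget target_ge0 (fun A _ => erefl) mq q0 qE qpos qdecr
    m0 tb tr supportP target_compact target_continuous normals mono ppos psurj al0 al2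
    (fun k => e0 k.+2 isT) eta2 mfK fK01 gen).
Qed.
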